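(* Let $(M,\mathcal F)$ be a Finsler space with $M$ admitting a global coordinate system $(u^i)$ (induced coordinates $((x^i),(y^i))$ on $TM$), and let $X=X^s\,\partial/\partial u^s$ be a vector field on $M$ with (global) flow $\varphi$. Then for every geodesic $\gamma$ of $\mathcal F$ and every $s$ the curve $t\mapsto\varphi(s,\gamma(t))$ is an extremal of the length functional (i.e. the flow takes geodesics into geodesics as point sets) if and only if the component functions $X^s$ satisfy on $TM\setminus\{0\}$, for $i=1,\dots,n$, $$\Big[\frac{\partial^2\mathcal F}{\partial x^s\partial x^i}-\frac{\partial^3\mathcal F}{\partial x^s\partial x^k\partial y^i}y^k-\frac{\partial^3\mathcal F}{\partial x^s\partial y^k\partial y^i}C^k\Big](X^s)^{\mathsf v}$$ $$+\Big[\Big(\frac{\partial^2\mathcal F}{\partial y^s\partial x^i}-\frac{\partial^2\mathcal F}{\partial y^i\partial x^s}\Big)y^r-\frac{\partial^2\mathcal F}{\partial y^s\partial y^i}C^r-\Big(\frac{\partial^3\mathcal F}{\partial y^s\partial x^k\partial y^i}y^k+\frac{\partial^3\mathcal F}{\partial y^s\partial y^k\partial y^i}C^k\Big)y^r\Big]\Big(\frac{\partial X^s}{\partial u^r}\Big)^{\mathsf v}$$ $$-\Big[\frac{\partial^2\mathcal F}{\partial y^s\partial y^i}y^my^r\Big]\Big(\frac{\partial^2X^s}{\partial u^m\partial u^r}\Big)^{\mathsf v}=0,$$ where $C^1,\dots,C^n$ are functions on $TM\setminus\{0\}$ satisfying $\frac{\partial^2\mathcal F}{\partial y^k\partial y^i}C^k=\frac{\partial\mathcal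 F}{\partial x^i}-\frac{\partial^2\mathcal F}{\partial x^k\partial y^i}y^k$ for $i=1,\dots,n$.
   Context: A Finsler function on $M$ is $\mathcal F\colon TM\to\mathbb R$ smooth and positive on $TM\setminus\{0\}$, positively $1$-homogeneous on each tangent space, and strongly convex ($\partial^2\mathcal F^2/\partial y^i\partial y^j$ positive definite). Induced coordinates on $TM$: $x^i=u^i\circ\tau$, $y^i(v)=v(u^i)$, $\tau\colon TM\to M$ the projection; $h^{\mathsf v}:=h\circ\tau$ for functions $h$ on $M$. Summation over repeated indices. The length functional is $\gamma\mapsto\int\mathcal F(\dot\gamma(t))\,dt$; its $C^2$ extremals are the solutions of $\frac{\partial\mathcal F}{\partial x^i}\circ\dot\gamma-\frac{d}{dt}\big(\frac{\partial\mathcal F}{\partial y^i}\circ\dot\gamma\big)=0$; a geodesic is an extremal of positive constant speed. *)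

(* Defs.v *)
From mathcomp Require Export ssreflect ssrfun ssrbool eqtype ssrnat seq fintype bigop.
From Stdlib Require Export Reals ClassicalEpsilon.
Set Implicit Arguments. Unset Strict Implicit.

Open Scope R_scope.

Definition vec (n : nat) := 'I_n -> R.

Definition sumI (n : nat) (f : 'I_n -> R) : R := \big[Rplus/0%R]_(i < n) f i.

Definition nonzero (n : nat) (y : vec n) : Prop := exists j, y j <> 0.

Definition scal (n : nat) (l : R) (y : vec n) : vec n := fun j => l * y j.

Definition shift (n : nat) (v : vec n) (i : 'I_n) (h : R) : vec n :=
  fun j => if j == i then v j + h else v j.

(* The derivative of f at t when it exists (chosen by classical epsilon;
   an arbitrary value otherwise).  Only used where existence is ensured
   or explicitly asserted. *)
Definition Deriv (f : R -> R) (t : R) : R :=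
  epsilon (inhabits 0) (fun l => derivable_pt_lim f t l).

Definition pd (n : nat) (g : vec n -> R) (i : 'I_n) (v : vec n) : R :=
  Deriv (fun h => g (shift v i h)) 0.

(* Functions on TM = U x R^n in induced coordinates (x, y). *)
Definition Dx (n : nat) (i : 'I_n) (G : vec n -> vec n -> R) : vec n -> vec n -> R :=
  fun x y => pd (fun x' => G x' y) i x.
Definition Dy (n : nat) (i : 'I_n) (G : vec n -> vec n -> R) : vec n -> vec n -> R :=
  fun x y => pd (fun y' => G x y') i y.

Definition open_set (n : nat) (U : vec n -> Prop) : Prop :=
  forall x, U x -> exists d, 0 < d /\
    forall x', (forall j, Rabs (x' j - x j) < d) -> U x'.

Definition cont1 (n : nat) (W : vec n -> Prop) (g : vec n -> R) : Prop :=
  forall x, W x -> forall eps, 0 < eps -> exists d, 0 < d /\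
    forall x', (forall j, Rabs (x' j - x j) < d) -> Rabs (g x' - g x) < eps.

Definition has_pd (n : nat) (W : vec n -> Prop) (g : vec n -> R) (i : 'I_n) : Prop :=
  forall x, W x -> derivable_pt_lim (fun h => g (shift x i h)) 0 (pd g i x).

Fixpoint Ck1 (k : nat) (n : nat) (W : vec n -> Prop) (g : vec n -> R) : Prop :=
  cont1 W g /\
  match k with
  | O => True
  | S k' => forall i, has_pd W g i /\ Ck1 k' W (pd g i)
  end.

Definition smooth1 (n : nat) (W : vec n -> Prop) (g : vec n -> R) : Prop :=
  forall k, Ck1 k W g.

Definition cont2 (n : nat) (W : vec n -> vec n -> Prop) (G : vec n -> vec n -> R) : Prop :=
  forall x y, W x y -> forall eps, 0 < eps -> exists d, 0 < d /\
    forall x' y', (forall j, Rabs (x' j - x j) < d /\ Rabs (y' j - y j) < d) ->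
      Rabs (G x' y' - G x y) < eps.

Definition has_Dx (n : nat) (W : vec n -> vec n -> Prop) (G : vec n -> vec n -> R) (i : 'I_n) : Prop :=
  forall x y, W x y -> derivable_pt_lim (fun h => G (shift x i h) y) 0 (Dx i G x y).
Definition has_Dy (n : nat) (W : vec n -> vec n -> Prop) (G : vec n -> vec n -> R) (i : 'I_n) : Prop :=
  forall x y, W x y -> derivable_pt_lim (fun h => G x (shift y i h)) 0 (Dy i G x y).

Fixpoint Ck2 (k : nat) (n : nat) (W : vec n -> vec n -> Prop) (G : vec n -> vec n -> R) : Prop :=
  cont2 W G /\
  match k with
  | O => True
  | S k' => forall i, has_Dx W G i /\ has_Dy W G i /\
                      Ck2 k' W (Dx i G) /\ Ck2 k' W (Dy i G)
  end.

Definition smooth2 (n : nat) (W : vec n -> vec n -> Prop) (G : vec n -> vec n -> R) : Prop :=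
  forall k, Ck2 k W G.

Definition TM0 (n : nat) (U : vec n -> Prop) : vec n -> vec n -> Prop :=
  fun x y => U x /\ nonzero y.

Definition Finsler (n : nat) (U : vec n -> Prop) (F : vec n -> vec n -> R) : Prop :=
  smooth2 (TM0 U) F /\
  (forall x y, U x -> nonzero y -> 0 < F x y) /\
  (forall x y l, U x -> 0 < l -> F x (scal l y) = l * F x y) /\
  (forall x y xi, U x -> nonzero y -> nonzero xi ->
     0 < sumI (fun i => sumI (fun j =>
            Dy i (Dy j (fun x' y' => F x' y' ^ 2)) x y * xi i * xi j))).

Definition smooth_field (n : nat) (U : vec n -> Prop) (X : vec n -> vec n) : Prop :=
  forall s, smooth1 U (fun x => X x s).

Definition is_flow (n : nat) (U : vec n -> Prop) (X : vec n -> vec n)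
    (phi : R -> vec n -> vec n) : Prop :=
  forall p, U p ->
    phi 0 p = p /\
    (forall s, U (phi s p)) /\
    (forall s j, derivable_pt_lim (fun s' => phi s' p j) s (X (phi s p) j)).

Definition open_interval (I : R -> Prop) : Prop :=
  (exists t, I t) /\
  (forall a b t, I a -> I b -> a <= t <= b -> I t) /\
  (forall t, I t -> exists d, 0 < d /\ forall u, Rabs (u - t) < d -> I u).

Definition vel (n : nat) (g : R -> vec n) (t : R) : vec n :=
  fun j => Deriv (fun tau => g tau j) t.

Definition C2_on (n : nat) (I : R -> Prop) (g : R -> vec n) : Prop :=
  forall j,
    (forall t, I t -> derivable_pt_lim (fun tau => g tau j) t (vel g t j)) /\
    (forall t, I t -> derivable_pt_lim (fun tau => vel g tau j) t
                                       (Deriv (fun tau => vel g tau j) t)) /\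
    (forall t, I t -> continuity_pt (fun tau => Deriv (fun s => vel g s j) tau) t).

(* C^2 regular curve in U solving the Euler-Lagrange equations
     dF/dx^i o g' - d/dt (dF/dy^i o g') = 0   of the length functional. *)
Definition extremal (n : nat) (U : vec n -> Prop) (F : vec n -> vec n -> R)
    (I : R -> Prop) (g : R -> vec n) : Prop :=
  open_interval I /\
  (forall t, I t -> U (g t)) /\
  C2_on I g /\
  (forall t, I t -> nonzero (vel g t)) /\
  (forall i t, I t ->
     derivable_pt_lim (fun tau => Dy i F (g tau) (vel g tau)) t
                      (Dx i F (g t) (vel g t))).

Definition geodesic (n : nat) (U : vec n -> Prop) (F : vec n -> vec n -> R)
    (I : R -> Prop) (g : R -> vec n) : Prop :=
  extremal U F I g /\
  exists c, 0 < c /\ forall t, I t -> F (g t) (vel g t) = c.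

Definition dX (n : nat) (X : vec n -> vec n) (s r : 'I_n) : vec n -> R :=
  pd (fun x => X x s) r.
Definition ddX (n : nat) (X : vec n -> vec n) (s m r : 'I_n) : vec n -> R :=
  pd (dX X s r) m.

Definition thm3_expr (n : nat) (F : vec n -> vec n -> R) (C : vec n -> vec n -> vec n)
    (X : vec n -> vec n) (i : 'I_n) (x y : vec n) : R :=
  sumI (fun s =>
    (Dx s (Dx i F) x y
     - sumI (fun k => Dx s (Dx k (Dy i F)) x y * y k)
     - sumI (fun k => Dx s (Dy k (Dy i F)) x y * C x y k)) * X x s)
  + sumI (fun s => sumI (fun r =>
    ((Dy s (Dx i F) x y - Dy i (Dx s F) x y) * y r
     - Dy s (Dy i F) x y * C x y r
     - (sumI (fun k => Dy s (Dx k (Dy i F)) x y * y k)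
        + sumI (fun k => Dy s (Dy k (Dy i F)) x y * C x y k)) * y r)
    * dX X s r x))
  - sumI (fun s => sumI (fun m => sumI (fun r =>
      Dy s (Dy i F) x y * y m * y r * ddX X s m r x))).

(* Main.v *)
From mathcomp Require Import ssralg matrix mxalgebra Rstruct.
From Stdlib Require Import Lra FunctionalExtensionality Classical Ranalysis5.
From Coquelicot Require Import Coquelicot.
Require Import Defs.
Set Implicit Arguments. Unset Strict Implicit.
Open Scope R_scope.

(** Write [E_i(x, y, z)] for the Euler-Lagrange expression
    [F_{x^i} - F_{x^k y^i} y^k - F_{y^k y^i} z^k], so that a regular curve [u] is an extremal iff
    [E(u, u', u'') = 0].  The displayed expression of the theorem is the derivative of [E_i] in
    the direction of the second prolongation of [X], taken at [z = C(x, y)].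

    Along [u_s = phi(s, g)], the prolonged curve satisfies the linearised flow equations, hence
    [d/ds E_i] is that derivative taken at [z = u_s'']; it depends on [z - C] only, and only modulo
    [y], because [F_{y^k y^i} y^k = 0].  If the condition holds, then [d/ds E] is therefore bounded
    by a multiple of [E] (strong convexity recovers [z - C] modulo [y] from [E]), and Gronwall's
    inequality gives [E = 0] for all [s].  Conversely, through every [(x, y)] there is a geodesic
    (Cauchy-Lipschitz), and differentiating [E = 0] at [s = 0] along it gives the condition. *)

(** [is_flow] speaks only of the [s]-derivative of [phi], whereas an extremal is by definition a
    [C^2] curve, so the regularity of [t -> phi s (g t)] has to be earned before the Euler-Lagrange
    equations can be discussed at all. The curves [s -> phi s (g t)] are read as a family of
    solutions with parameter [t] and time [s]. Differentiability in a parameter, applied to [X],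
    gives the velocities; applied to the complete lift of [X], it gives the accelerations; stability
    of a third system gives their continuity in [t]. Vectors are indexed by arbitrary finite types
    so that one calculus serves all three systems.

    The second obstacle is reparametrisation: the flow does not preserve speed, and [C] is fixed by
    its equations only up to a multiple of [y], possibly in a discontinuous way. Estimates therefore
    go through the fundamental tensor, which is nondegenerate, and the converse runs along the
    representative of [C] for which [F] is constant. The invariance under adding multiples of [y]
    then leads back to the given [C]. *)

Local Notation "\sum_ ( i : T ) E" := (\big[Rplus/0%R]_(i : T) E) : R_scope.
Local Notation "\sum_ i E" := (\big[Rplus/0%R]_i E) : R_scope.

(** * Finite sums of reals *)

Lemma sum_le (I : finType) (f g : I -> R) :
  (forall i, f i <= g i) -> \sum_i f i <= \sum_i g i.
Proof.
move=> H; elim/big_rec2: _ => [|i a b _ Hab]; first by lra.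
by have := H i; lra.
Qed.

Lemma sum_ge0 (I : finType) (f : I -> R) : (forall i, 0 <= f i) -> 0 <= \sum_i f i.
Proof.
by move=> H; elim/big_rec: _ => [|i a _ Ha]; [lra | have := H i; lra].
Qed.

Lemma sum_abs (I : finType) (f : I -> R) : Rabs (\sum_i f i) <= \sum_i Rabs (f i).
Proof.
elim/big_rec2: _ => [|i a b _ Hab]; first by rewrite Rabs_R0; lra.
by have := Rabs_triang (f i) b; lra.
Qed.

Lemma sum_const (I : finType) (c : R) : \sum_(i : I) c = INR #|I| * c.
Proof.
rewrite big_const; elim: #|I| => [|k IH]; first by rewrite /=; ring.
by rewrite iterS IH S_INR; ring.
Qed.

Lemma sum_term_le (I : finType) (f : I -> R) (i : I) :
  (forall j, 0 <= f j) -> f i <= \sum_j f j.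
Proof.
move=> H; rewrite (bigD1 i) //=.
suff : 0 <= \big[Rplus/0]_(j | j != i) f j by lra.
by elim/big_rec: _ => [|j a _ Ha]; [lra | have := H j; lra].
Qed.

Lemma sum_opp (I : finType) (f : I -> R) : \sum_i (- f i) = - \sum_i f i.
Proof.
by elim/big_rec2: _ => [|i a b _ ->]; lra.
Qed.

Lemma sumB (I : finType) (f g : I -> R) :
  \sum_i (f i - g i) = \sum_i f i - \sum_i g i.
Proof. by rewrite -[RHS]/(_ + - _) -sum_opp -big_split. Qed.

Lemma sumD (I : finType) (f g : I -> R) :
  \sum_i (f i + g i) = \sum_i f i + \sum_i g i.
Proof. by rewrite -big_split. Qed.

Lemma sumZ (I : finType) (c : R) (f : I -> R) :
  \sum_i (c * f i) = c * \sum_i f i.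
Proof. by rewrite big_distrr. Qed.

Lemma sumZr (I : finType) (c : R) (f : I -> R) :
  \sum_i (f i * c) = (\sum_i f i) * c.
Proof. by rewrite big_distrl. Qed.

Lemma derivable_sum (I : finType) (f : I -> R -> R) (f' : I -> R) (t : R) :
  (forall i, derivable_pt_lim (f i) t (f' i)) ->
  derivable_pt_lim (fun u => \sum_i f i u) t (\sum_i f' i).
Proof.
move=> H.
suff G : forall l : seq I, derivable_pt_lim (fun u => \big[Rplus/0]_(i <- l) f i u) t
    (\big[Rplus/0]_(i <- l) f' i) by exact: G.
elim=> [|i l IH].
  rewrite big_nil; apply: (derivable_pt_lim_ext (fun _ => 0)).
    by move=> u; rewrite big_nil.
  exact: derivable_pt_lim_const.
rewrite big_cons; apply: (derivable_pt_lim_ext (fun u => f i u + \big[Rplus/0]_(j <- l) f j u)).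
  by move=> u; rewrite big_cons.
exact: derivable_pt_lim_plus.
Qed.

(** * Continuity, Lipschitz bounds and strict differentiability in finitely many variables *)

Section States.
Variable T : finType.
Implicit Types (x p q a c v w : T -> R) (f g : (T -> R) -> R).

Definition nrm v : R := \sum_j Rabs (v j).
(** Estimates are stated with the [l^1] norm [nrm]; its Euclidean companion is kept squared because
    that is differentiable along curves, as Gronwall's inequality requires. *)
Definition sqn v : R := \sum_j (v j) ^ 2.
Definition sub p q : T -> R := fun j => p j - q j.
Definition box x (d : R) p : Prop := forall j, Rabs (p j - x j) < d.
(** Over ['I_n] this is convertible to [shift], so facts about [upd] apply directly to the partial
    derivatives [pd], [Dx] and [Dy]. *)
Definition upd x (i : T) (h : R) : T -> R := fun j => if j == i then x j + h else x j.

Lemma nrm_ge0 v : 0 <= nrm v.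
Proof. by apply: sum_ge0 => i; exact: Rabs_pos. Qed.

Lemma sqn_ge0 v : 0 <= sqn v.
Proof. by apply: sum_ge0 => i; exact: pow2_ge_0. Qed.

Lemma nrm_term v j : Rabs (v j) <= nrm v.
Proof. by apply: (sum_term_le (f := fun j => Rabs (v j))) => i; exact: Rabs_pos. Qed.

Lemma sqn_term v j : (v j) ^ 2 <= sqn v.
Proof. by apply: (sum_term_le (f := fun j => v j ^ 2)) => i; exact: pow2_ge_0. Qed.

Lemma nrm_le_const v (d : R) : (forall j, Rabs (v j) <= d) -> nrm v <= INR #|T| * d.
Proof. by move=> H; rewrite -sum_const; apply: sum_le. Qed.

Lemma nrm0_eq v : nrm v <= 0 -> forall j, v j = 0.
Proof.
move=> H j; have := nrm_term v j; have := Rabs_pos (v j) => H1 H2.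
by apply: NNPP => /Rabs_no_R0; lra.
Qed.

Lemma nrmD v w : nrm (fun j => v j + w j) <= nrm v + nrm w.
Proof. by rewrite -sumD; apply: sum_le => j; exact: Rabs_triang. Qed.

Lemma nrm_sub_sym p q : nrm (sub p q) = nrm (sub q p).
Proof. by apply: eq_bigr => j _; rewrite /sub Rabs_minus_sym. Qed.

Lemma nrm_sq v : nrm v ^ 2 <= INR #|T| * sqn v.
Proof.
have -> : nrm v ^ 2 = \sum_i \sum_j (Rabs (v i) * Rabs (v j)).
  under eq_bigr => i _ do rewrite sumZ.
  by rewrite sumZr /nrm; ring.
have -> : INR #|T| * sqn v = \sum_(i : T) \sum_j ((v i ^ 2 + v j ^ 2) / 2).
  under eq_bigr => i _ do rewrite sumZr sumD sum_const.
  rewrite sumZr sumD sum_const sumZ -/(sqn v); field.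
apply: sum_le => i; apply: sum_le => j.
rewrite -(pow2_abs (v i)) -(pow2_abs (v j)).
by have := pow2_ge_0 (Rabs (v i) - Rabs (v j)); nra.
Qed.

Lemma sq_nrm v : sqn v <= nrm v ^ 2.
Proof.
have -> : nrm v ^ 2 = \sum_i (Rabs (v i) * nrm v) by rewrite sumZr /nrm; ring.
apply: sum_le => i; rewrite -pow2_abs.
by have := nrm_term v i; have := Rabs_pos (v i); nra.
Qed.

Lemma sum_mul_le v w : Rabs (\sum_j v j * w j) <= nrm v * nrm w.
Proof.
apply: Rle_trans (sum_abs _) _; rewrite /nrm -sumZr; apply: sum_le => j.
rewrite Rabs_mult; apply: Rmult_le_compat_l; first exact: Rabs_pos.
exact: nrm_term.
Qed.

Lemma box_center x d : 0 < d -> box x d x.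
Proof. by move=> Hd j; rewrite Rminus_diag Rabs_R0. Qed.

Lemma box_le x d d' p : d <= d' -> box x d p -> box x d' p.
Proof. by move=> Hd H j; have := H j; lra. Qed.

Lemma box_trans x p q d d' : box x d p -> box p d' q -> box x (d + d') q.
Proof.
move=> H1 H2 j; have := Rabs_triang (q j - p j) (p j - x j); have := H1 j; have := H2 j.
by replace (q j - p j + (p j - x j)) with (q j - x j) by ring; lra.
Qed.

Definition cts f x : Prop :=
  forall eps, 0 < eps -> exists d, 0 < d /\ forall p, box x d p -> Rabs (f p - f x) < eps.

(* Strict differentiability, with the continuity of the derivative built in: the base point [p] of
   the derivative and the two points [a], [c] vary independently near [x]. *)
Definition cdiff f (df : (T -> R) -> T -> R) x : Prop :=
  forall eps, 0 < eps -> exists d, 0 < d /\ forall p a c, box x d p -> box x d a -> box x d c ->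
    Rabs (f a - f c - \sum_j df p j * (a j - c j)) <= eps * nrm (sub a c).

Definition lip f x : Prop :=
  exists d K, 0 < d /\ 0 < K /\ forall a c, box x d a -> box x d c ->
    Rabs (f a - f c) <= K * nrm (sub a c).

Lemma cdiff_lip f df x : cdiff f df x -> lip f x.
Proof.
move=> /(_ 1 Rlt_0_1)[d [Hd H]]; exists d, (1 + nrm (df x)); split=> //; split.
  by have := nrm_ge0 (df x); lra.
move=> a c Ha Hc; have H1 := H x a c (box_center x Hd) Ha Hc.
have H2 := sum_mul_le (df x) (sub a c).
change (Rabs (\sum_j df x j * (a j - c j)) <= nrm (df x) * nrm (sub a c)) in H2.
set S := \sum_j df x j * (a j - c j) in H1 H2.
have := Rabs_triang (f a - f c - S) S.
replace (f a - f c - S + S) with (f a - f c) by ring.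
lra.
Qed.

Lemma lip_cts f x : lip f x -> cts f x.
Proof.
move=> [d [K [Hd [HK H]]]] eps He.
(* The index type may be empty; adding one to its cardinality keeps the divisor positive. *)
have HN : 0 < INR #|T| + 1 by have := pos_INR #|T|; lra.
have Hq : 0 < eps / (K * (INR #|T| + 1)).
  by apply: Rdiv_lt_0_compat => //; apply: Rmult_lt_0_compat.
exists (Rmin d (eps / (K * (INR #|T| + 1)))); split; first exact: Rmin_pos.
move=> p Hp; have H1 := H p x (box_le (Rmin_l _ _) Hp) (box_center x Hd).
apply: Rle_lt_trans H1 _.
have H2 : nrm (sub p x) <= INR #|T| * (eps / (K * (INR #|T| + 1))).
  by apply: nrm_le_const => j; have := Hp j; have := Rmin_r d (eps / (K * (INR #|T| + 1))); rewrite /sub; lra.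
apply: Rle_lt_trans (Rmult_le_compat_l _ _ _ (Rlt_le _ _ HK) H2) _.
set N := INR #|T| in HN *.
have -> : K * (N * (eps / (K * (N + 1)))) = eps - eps / (N + 1) by field; lra.
have : 0 < eps / (N + 1) by exact: Rdiv_lt_0_compat.
lra.
Qed.

Lemma cts_const k x : cts (fun _ => k) x.
Proof. by move=> eps He; exists 1; split; [lra | move=> p _; rewrite Rminus_diag Rabs_R0]. Qed.

Lemma cts_proj j x : cts (fun p => p j) x.
Proof. by move=> eps He; exists eps; split. Qed.

Lemma cts_add f g x : cts f x -> cts g x -> cts (fun p => f p + g p) x.
Proof.
move=> Hf Hg eps He.
have [d1 [Hd1 H1]] := Hf (eps / 2) ltac:(lra).
have [d2 [Hd2 H2]] := Hg (eps / 2) ltac:(lra).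
exists (Rmin d1 d2); split; first exact: Rmin_pos.
move=> p Hp; have {H1} := H1 p (box_le (Rmin_l _ _) Hp).
have {H2} := H2 p (box_le (Rmin_r _ _) Hp) => A B.
have := Rabs_triang (f p - f x) (g p - g x).
by replace (f p - f x + (g p - g x)) with (f p + g p - (f x + g x)) by ring; lra.
Qed.

Lemma cts_bound f x : cts f x -> exists d, 0 < d /\
  forall p, box x d p -> Rabs (f p) <= Rabs (f x) + 1.
Proof.
move=> /(_ 1 Rlt_0_1)[d [Hd H]]; exists d; split=> // p /H H1.
have := Rabs_triang (f p - f x) (f x).
by replace (f p - f x + f x) with (f p) by ring; lra.
Qed.

Lemma cts_mul f g x : cts f x -> cts g x -> cts (fun p => f p * g p) x.
Proof.
move=> Hf Hg eps He.
have [d0 [Hd0 H0]] := cts_bound Hf.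
set A := Rabs (f x) + 1 in H0; set B := Rabs (g x) + 1.
have HA : 0 < A by rewrite /A; have := Rabs_pos (f x); lra.
have HB : 0 < B by rewrite /B; have := Rabs_pos (g x); lra.
have [d1 [Hd1 H1]] := Hf (eps / (2 * B)) ltac:(apply: Rdiv_lt_0_compat; lra).
have [d2 [Hd2 H2]] := Hg (eps / (2 * A)) ltac:(apply: Rdiv_lt_0_compat; lra).
exists (Rmin d0 (Rmin d1 d2)); split; first by apply: Rmin_pos => //; exact: Rmin_pos.
have L1 := Rmin_l d0 (Rmin d1 d2); have L2 := Rmin_r d0 (Rmin d1 d2).
have L3 := Rmin_l d1 d2; have L4 := Rmin_r d1 d2.
move=> p Hp.
have {H0} K0 := H0 p (box_le L1 Hp).
have {H1} K1 := H1 p (box_le (Rle_trans _ _ _ L2 L3) Hp).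
have {H2} K2 := H2 p (box_le (Rle_trans _ _ _ L2 L4) Hp).
replace (f p * g p - f x * g x) with (f p * (g p - g x) + g x * (f p - f x)) by ring.
apply: Rle_lt_trans (Rabs_triang _ _) _; rewrite !Rabs_mult.
have E1 : Rabs (f p) * Rabs (g p - g x) <= A * Rabs (g p - g x).
  by apply: Rmult_le_compat_r => //; exact: Rabs_pos.
have E2 : Rabs (g x) * Rabs (f p - f x) <= B * Rabs (f p - f x).
  by apply: Rmult_le_compat_r; [exact: Rabs_pos | rewrite /B; lra].
have E3 : A * Rabs (g p - g x) < A * (eps / (2 * A)) by exact: Rmult_lt_compat_l.
have E4 : B * Rabs (f p - f x) < B * (eps / (2 * B)) by exact: Rmult_lt_compat_l.
have E5 : A * (eps / (2 * A)) = eps / 2 by field; lra.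
have E6 : B * (eps / (2 * B)) = eps / 2 by field; lra.
lra.
Qed.

Lemma cts_sum (I : finType) (F : I -> (T -> R) -> R) x :
  (forall i, cts (F i) x) -> cts (fun p => \sum_i F i p) x.
Proof.
move=> H; rewrite /cts.
suff G : forall l : seq I, cts (fun p => \big[Rplus/0]_(i <- l) F i p) x by exact: G.
elim=> [|i l IH].
  by move=> eps He; exists 1; split; [lra | move=> p _; rewrite !big_nil Rminus_diag Rabs_R0].
move=> eps He; have [d [Hd Hp]] := cts_add (H i) IH He.
by exists d; split=> // p /Hp; rewrite !big_cons.
Qed.

Lemma lip_const k x : lip (fun _ => k) x.
Proof.
exists 1, 1; split; [lra | split; [lra |]] => a c _ _.
by rewrite Rminus_diag Rabs_R0; have := nrm_ge0 (sub a c); lra.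
Qed.

Lemma lip_proj j x : lip (fun p => p j) x.
Proof.
exists 1, 1; split; [lra | split; [lra |]] => a c _ _.
by rewrite Rmult_1_l; exact: (nrm_term (sub a c)).
Qed.

Lemma lip_add f g x : lip f x -> lip g x -> lip (fun p => f p + g p) x.
Proof.
move=> [d1 [K1 [Hd1 [HK1 H1]]]] [d2 [K2 [Hd2 [HK2 H2]]]].
exists (Rmin d1 d2), (K1 + K2); split; first exact: Rmin_pos.
split; first lra.
move=> a c Ha Hc.
have A := H1 a c (box_le (Rmin_l _ _) Ha) (box_le (Rmin_l _ _) Hc).
have B := H2 a c (box_le (Rmin_r _ _) Ha) (box_le (Rmin_r _ _) Hc).
have := Rabs_triang (f a - f c) (g a - g c).
by replace (f a - f c + (g a - g c)) with (f a + g a - (f c + g c)) by ring; lra.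
Qed.

Lemma lip_mul f g x : lip f x -> lip g x -> lip (fun p => f p * g p) x.
Proof.
move=> Lf Lg.
have [d3 [Hd3 H3]] := cts_bound (lip_cts Lf).
have [d4 [Hd4 H4]] := cts_bound (lip_cts Lg).
move: Lf Lg => [d1 [K1 [Hd1 [HK1 H1]]]] [d2 [K2 [Hd2 [HK2 H2]]]].
set A := Rabs (f x) + 1 in H3; set B := Rabs (g x) + 1 in H4.
have HA : 0 < A by rewrite /A; have := Rabs_pos (f x); lra.
have HB : 0 < B by rewrite /B; have := Rabs_pos (g x); lra.
have [d [Hd [L1 [L2 [L3 L4]]]]] : exists d, 0 < d /\ d <= d1 /\ d <= d2 /\ d <= d3 /\ d <= d4.
  exists (Rmin (Rmin d1 d2) (Rmin d3 d4)).
  have := Rmin_l (Rmin d1 d2) (Rmin d3 d4); have := Rmin_r (Rmin d1 d2) (Rmin d3 d4).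
  have := Rmin_l d1 d2; have := Rmin_r d1 d2; have := Rmin_l d3 d4; have := Rmin_r d3 d4.
  split; last by split; [|split; [|split]]; lra.
  by do !apply: Rmin_pos.
exists d, (A * K2 + B * K1); split=> //; split; first nra.
move=> a c Ha Hc.
have E1 := H1 a c (box_le L1 Ha) (box_le L1 Hc).
have E2 := H2 a c (box_le L2 Ha) (box_le L2 Hc).
have E3 := H3 a (box_le L3 Ha); have E4 := H4 c (box_le L4 Hc).
replace (f a * g a - f c * g c) with (f a * (g a - g c) + g c * (f a - f c)) by ring.
apply: Rle_trans (Rabs_triang _ _) _; rewrite !Rabs_mult.
have := Rmult_le_compat _ _ _ _ (Rabs_pos (f a)) (Rabs_pos (g a - g c)) E3 E2.
have := Rmult_le_compat _ _ _ _ (Rabs_pos (g c)) (Rabs_pos (f a - f c)) E4 E1.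
lra.
Qed.

Lemma lip_sum (I : finType) (F : I -> (T -> R) -> R) x :
  (forall i, lip (F i) x) -> lip (fun p => \sum_i F i p) x.
Proof.
move=> H; rewrite /lip.
suff G : forall l : seq I, lip (fun p => \big[Rplus/0]_(i <- l) F i p) x by exact: G.
elim=> [|i l IH].
  have [d [K [Hd [HK Hp]]]] := lip_const 0 x.
  by exists d, K; split=> //; split=> // a c Ha Hc; rewrite !big_nil; exact: Hp.
have [d [K [Hd [HK Hp]]]] := lip_add (H i) IH.
by exists d, K; split=> //; split=> // a c Ha Hc; rewrite !big_cons; exact: Hp.
Qed.

Lemma lip_opp f x : lip f x -> lip (fun p => - f p) x.
Proof.
move=> [d [K [Hd [HK H]]]]; exists d, K; split=> //; split=> // a c Ha Hc.
by have := H a c Ha Hc; rewrite -Rabs_Ropp; congr (Rabs _ <= _); ring.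
Qed.

Lemma lip_sub f g x : lip f x -> lip g x -> lip (fun p => f p - g p) x.
Proof. by move=> Hf Hg; apply: lip_add => //; exact: lip_opp. Qed.

End States.

Lemma derivable_shift (g : R -> R) (t l : R) :
  derivable_pt_lim (fun h => g (t + h)) 0 l -> derivable_pt_lim g t l.
Proof.
move=> H eps He; have [d Hd] := H eps He; exists d => h Hh Hhd.
by have := Hd h Hh Hhd; rewrite Rplus_0_r Rplus_0_l.
Qed.

(** Monotonicity in the radius allows taking minima along [enum I], so finitely many existential
    radii merge into one without choosing a function of [i]. *)
Lemma fin_radius (I : finType) (P : I -> R -> Prop) :
  (forall i d d', P i d -> 0 < d' <= d -> P i d') ->
  (forall i, exists d, 0 < d /\ P i d) -> exists d, 0 < d /\ forall i, P i d.
Proof.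
move=> Hm H.
suff [d [Hd G]] : exists d, 0 < d /\ forall i, i \in enum I -> P i d.
  by exists d; split=> // i; apply: G; rewrite mem_enum.
elim: (enum I) => [|i l [d [Hd IH]]]; first by exists 1; split; [lra |].
have [e [He Hi]] := H i; exists (Rmin d e); split; first exact: Rmin_pos.
have Hde : 0 < Rmin d e by exact: Rmin_pos.
move=> k; rewrite inE => /orP[/eqP -> | /IH Hk].
  by apply: Hm Hi _; split=> //; exact: Rmin_r.
by apply: Hm Hk _; split=> //; exact: Rmin_l.
Qed.

Lemma derivable_lip_at (g : R -> R) (t l : R) : derivable_pt_lim g t l ->
  exists d, 0 < d /\ forall h, Rabs h < d -> Rabs (g (t + h) - g t) <= (Rabs l + 1) * Rabs h.
Proof.
move=> /(_ 1 Rlt_0_1)[d Hd]; exists d; split; first exact: cond_pos.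
move=> h Hh; case: (Req_dec h 0) => [-> | Hh0].
  by rewrite Rplus_0_r Rminus_diag Rabs_R0; lra.
have := Hd h Hh0 Hh => H1.
have -> : g (t + h) - g t = (g (t + h) - g t) / h * h by field.
rewrite Rabs_mult; apply: Rmult_le_compat_r; first exact: Rabs_pos.
have := Rabs_triang ((g (t + h) - g t) / h - l) l.
by replace ((g (t + h) - g t) / h - l + l) with ((g (t + h) - g t) / h) by ring; lra.
Qed.

Section Partials.
Variable T : finType.
Implicit Types (x p q a c v w : T -> R) (f g : (T -> R) -> R).

Lemma updD p i (t h : R) : upd (upd p i t) i h = upd p i (t + h).
Proof. by apply: functional_extensionality => j; rewrite /upd; case: eqP => _ //; ring. Qed.

Lemma upd0 p i : upd p i 0 = p.
Proof. by apply: functional_extensionality => j; rewrite /upd; case: eqP => _ //; ring. Qed.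

Lemma box_upd x p i (d h : R) : box x d p -> Rabs h < d -> box x (d + d) (upd p i h).
Proof.
move=> Hp Hh j; have := Hp j; have := Rabs_pos h; rewrite /upd; case: eqP => _; last lra.
have := Rabs_triang (p j - x j) h.
by replace (p j - x j + h) with (p j + h - x j) by ring; lra.
Qed.

(* Changing the coordinates of [c] into those of [a] one at a time reduces the claim to the
   one-dimensional mean value inequality. *)
Lemma cdiff_of_partials f (df : (T -> R) -> T -> R) x (r : R) : 0 < r ->
  (forall p i, box x r p -> derivable_pt_lim (fun h => f (upd p i h)) 0 (df p i)) ->
  (forall i, cts (fun p => df p i) x) -> cdiff f df x.
Proof.
move=> Hr Hd Hc eps He.
have [d0 [Hd0 Hd0']] : exists d, 0 < d /\ forall i p, box x d p -> Rabs (df p i - df x i) < eps / 2.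
  apply: (fin_radius (P := fun i d => forall p, box x d p -> Rabs (df p i - df x i) < eps / 2)).
    by move=> i d d' H [_ Hdd] p Hp; apply: H; exact: box_le Hp.
  by move=> i; apply: Hc; lra.
(* The factor 4 pays for the intermediate points: a mixture of [a] and [c] lies within [d] of [x],
   and one of its coordinates then moves by less than [2 * d]. *)
set d := Rmin r d0 / 4.
have Hm : 0 < Rmin r d0 by exact: Rmin_pos.
have Hdp : 0 < d by rewrite /d; lra.
have Hr4 : 4 * d <= r by have := Rmin_l r d0; rewrite /d; lra.
have Hd4 : 4 * d <= d0 by have := Rmin_r r d0; rewrite /d; lra.
exists d; split=> // p a c Hp Ha Hcx.
pose mix (l : seq T) : T -> R := fun j => if j \in l then a j else c j.
have Hmix l : box x d (mix l) by move=> j; rewrite /mix; case: ifP.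
have main : forall l : seq T, uniq l ->
    Rabs (f (mix l) - f c - \big[Rplus/0]_(j <- l) (df x j * (a j - c j)))
      <= eps / 2 * \big[Rplus/0]_(j <- l) Rabs (a j - c j).
  elim=> [_|i l IH /= /andP[Hil Hul]].
    rewrite !big_nil; have -> : mix [::] = c by [].
    by rewrite Rmult_0_r !Rminus_diag Rabs_R0; lra.
  have {IH} IH := IH Hul; rewrite !big_cons.
  have Emix : mix (i :: l) = upd (mix l) i (a i - c i).
    apply: functional_extensionality => j; rewrite /mix /upd inE.
    by case: (eqVneq j i) => [->|//] /=; rewrite (negbTE Hil); ring.
  pose h0 := a i - c i.
  have Hh0 : Rabs h0 < 2 * d.
    have := Ha i; have := Hcx i; have := Rabs_triang (a i - x i) (- (c i - x i)).
    rewrite Rabs_Ropp /h0; replace (a i - x i + - (c i - x i)) with (a i - c i) by ring; lra.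
  pose G h := f (upd (mix l) i h) - df x i * h.
  have HG : Rabs (G h0 - G 0) <= eps / 2 * Rabs (h0 - 0).
    apply: (bounded_variation G (fun h => df (upd (mix l) i h) i - df x i)) => t Ht.
    rewrite !Rminus_0_r in Ht.
    have Hb : box x (4 * d) (upd (mix l) i t).
      have Hl : box x (2 * d) (mix l) by apply: box_le (Hmix l); lra.
      have Ht' : Rabs t < 2 * d by lra.
      by apply: box_le (box_upd i Hl Ht'); lra.
    split; last by apply: Rlt_le; apply: Hd0'; exact: box_le Hb.
    apply/is_derive_Reals; apply: derivable_pt_lim_minus.
      apply: derivable_shift.
      apply: derivable_pt_lim_ext (Hd _ i (box_le Hr4 Hb)).
      by move=> h; rewrite updD.
    have {2}-> : df x i = df x i * 1 by ring.
    apply: derivable_pt_lim_scal; exact: derivable_pt_lim_id.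
  move: HG; rewrite /G upd0 Rminus_0_r Emix -/h0 => HG.
  have := Rabs_triang (f (upd (mix l) i h0) - df x i * h0 - (f (mix l) - df x i * 0))
    (f (mix l) - f c - \big[Rplus/0]_(j <- l) (df x j * (a j - c j))).
  rewrite Rmult_plus_distr_l.
  set S := \big[Rplus/0]_(j <- l) (df x j * (a j - c j)) in IH *.
  have -> : f (upd (mix l) i h0) - df x i * h0 - (f (mix l) - df x i * 0) + (f (mix l) - f c - S)
    = f (upd (mix l) i h0) - f c - (df x i * h0 + S) by ring.
  lra.
have {main} M1 := main (index_enum T) (index_enum_uniq _).
have Ea : mix (index_enum T) = a by apply: functional_extensionality => j; rewrite /mix mem_index_enum.
rewrite Ea in M1.
(* The comparison so far uses the derivative at [x]; passing to the free base point [p] costs the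
   other half of [eps]. *)
have M2 : Rabs (\sum_j (df x j - df p j) * (a j - c j)) <= eps / 2 * nrm (sub a c).
  apply: Rle_trans (sum_abs _) _; rewrite /nrm -sumZ; apply: sum_le => j.
  rewrite Rabs_mult; apply: Rmult_le_compat_r; first exact: Rabs_pos.
  by rewrite Rabs_minus_sym; apply: Rlt_le; apply: Hd0'; apply: box_le Hp; lra.
have E : \sum_j (df x j - df p j) * (a j - c j) =
    \sum_j (df x j * (a j - c j)) - \sum_j (df p j * (a j - c j)).
  by rewrite -sumB; apply: eq_bigr => j _; ring.
rewrite E in M2.
have := Rabs_triang (f a - f c - \sum_j (df x j * (a j - c j)))
  (\sum_j (df x j * (a j - c j)) - \sum_j (df p j * (a j - c j))).
have -> : f a - f c - \sum_j (df x j * (a j - c j)) +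
  (\sum_j (df x j * (a j - c j)) - \sum_j (df p j * (a j - c j))) =
  f a - f c - \sum_j (df p j * (a j - c j)) by ring.
change (\sum_j Rabs (a j - c j)) with (nrm (sub a c)) in M1.
lra.
Qed.

(** The chain rule along a curve. After the linear part is subtracted, strict differentiability
    bounds what is left by a small multiple of the increment of [c], which is itself at most
    [M * Rabs h]; so the remainder has derivative zero. *)
Lemma cdiff_partial f (df : (T -> R) -> T -> R) x (c : R -> T -> R) (v : T -> R) (t : R) :
  c t = x -> cdiff f df x -> (forall j, derivable_pt_lim (fun u => c u j) t (v j)) ->
  derivable_pt_lim (fun u => f (c u)) t (\sum_j df x j * v j).
Proof.
move=> Ex Hf Hv.
have HS : derivable_pt_lim (fun u => \sum_j df x j * c u j) t (\sum_j df x j * v j).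
  by apply: derivable_sum => j; apply: derivable_pt_lim_scal.
suff HR : derivable_pt_lim (fun u => f (c u) - \sum_j df x j * c u j) t 0.
  have := derivable_pt_lim_plus _ _ _ _ _ HR HS; rewrite Rplus_0_l.
  by apply: derivable_pt_lim_ext => u; rewrite /plus_fct; ring.
have [d1 [Hd1 H1]] : exists d, 0 < d /\ forall j h, Rabs h < d ->
    Rabs (c (t + h) j - c t j) <= (Rabs (v j) + 1) * Rabs h.
  apply: (fin_radius (P := fun j d => forall h, Rabs h < d ->
    Rabs (c (t + h) j - c t j) <= (Rabs (v j) + 1) * Rabs h)).
    by move=> j d d' H [_ Hdd] h Hh; apply: H; lra.
  by move=> j; exact: derivable_lip_at (Hv j).
set M := \sum_j (Rabs (v j) + 1) + 1.
have HM : 0 < M.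
  suff : 0 <= \sum_j (Rabs (v j) + 1) by rewrite /M; lra.
  by apply: sum_ge0 => j; have := Rabs_pos (v j); lra.
have HMj j : Rabs (v j) + 1 <= M.
  suff : Rabs (v j) + 1 <= \sum_j (Rabs (v j) + 1) by rewrite /M; lra.
  by apply: (sum_term_le (f := fun j => Rabs (v j) + 1)) => i; have := Rabs_pos (v i); lra.
move=> eps He.
have [d2 [Hd2 H2]] := Hf (eps / (2 * M)) ltac:(apply: Rdiv_lt_0_compat; lra).
have Hd : 0 < Rmin d1 (d2 / M) by apply: Rmin_pos => //; exact: Rdiv_lt_0_compat.
exists (mkposreal _ Hd) => /= h Hh Hhd.
have Hhd1 : Rabs h < d1 by have := Rmin_l d1 (d2 / M); lra.
have Hhd2 : M * Rabs h < d2.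
  have : M * Rabs h < M * (d2 / M) by apply: Rmult_lt_compat_l => //; have := Rmin_r d1 (d2 / M); lra.
  by have -> : M * (d2 / M) = d2 by field; lra.
have Hbox : box x d2 (c (t + h)).
  move=> j; rewrite -Ex; apply: Rle_lt_trans (H1 j h Hhd1) _; apply: Rle_lt_trans Hhd2.
  by apply: Rmult_le_compat_r => //; exact: Rabs_pos.
have Hx : box x d2 (c t) by rewrite Ex; exact: box_center.
have {H2} H3 := H2 x _ _ (box_center x Hd2) Hbox Hx.
have Hn : nrm (sub (c (t + h)) (c t)) <= M * Rabs h.
  apply: (Rle_trans _ (\sum_j ((Rabs (v j) + 1) * Rabs h))).
    by apply: sum_le => j; exact: H1.
  by rewrite sumZr; apply: Rmult_le_compat_r; [exact: Rabs_pos | rewrite /M; lra].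
rewrite Rminus_0_r Rabs_div //.
have Hap : 0 < Rabs h by exact: Rabs_pos_lt.
apply/Rlt_div_l => //.
have -> : f (c (t + h)) - \sum_j df x j * c (t + h) j - (f (c t) - \sum_j df x j * c t j) =
   f (c (t + h)) - f (c t) - \sum_j df x j * (c (t + h) j - c t j).
  have -> : \sum_j df x j * (c (t + h) j - c t j) =
     \sum_j (df x j * c (t + h) j) - \sum_j (df x j * c t j).
    by rewrite -sumB; apply: eq_bigr => j _; ring.
  ring.
apply: Rle_lt_trans H3 _.
have Hq : 0 < eps / (2 * M) by apply: Rdiv_lt_0_compat; lra.
apply: (Rle_lt_trans _ (eps / (2 * M) * (M * Rabs h))).
  by apply: Rmult_le_compat_l => //; lra.
have -> : eps / (2 * M) * (M * Rabs h) = eps / 2 * Rabs h by field; lra.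
nra.
Qed.

Lemma cts_comp f (c : R -> T -> R) (t : R) :
  cts f (c t) -> (forall j, continuity_pt (fun u => c u j) t) ->
  continuity_pt (fun u => f (c u)) t.
Proof.
move=> Hf Hc eps He; have [d [Hd H]] := Hf eps He.
have [e [He' H']] : exists e, 0 < e /\ forall j u, Rabs (u - t) < e -> Rabs (c u j - c t j) < d.
  apply: (fin_radius (P := fun j e => forall u, Rabs (u - t) < e -> Rabs (c u j - c t j) < d)).
    by move=> i e e' G [_ Hee] u Hu; apply: G; lra.
  move=> j; have [a [Ha G]] := Hc j d Hd; exists a; split=> // u Hu.
  case: (Req_dec u t) => [->|Hut]; first by rewrite Rminus_diag Rabs_R0.
  by apply: G; split=> //; split=> // E; apply: Hut.
by exists e; split=> // u [_ Hu]; apply: H => j; exact: H'.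
Qed.

End Partials.

(** * Gronwall inequalities *)

(** A Lebesgue number argument: each point carries a gauge on whose ball [P] holds with the gauge
    itself as radius, and compactness bounds the useful gauges from below. *)
Lemma unif_compact (A B : R) (P : R -> R -> Prop) :
  (forall s d d', P s d -> 0 < d' <= d -> P s d') ->
  (forall s, A <= s <= B -> exists d, 0 < d /\ forall s', Rabs (s' - s) < d -> P s' d) ->
  exists d, 0 < d /\ forall s, A <= s <= B -> P s d.
Proof.
move=> Hm H.
pose Q s (d : posreal) := A <= s <= B -> forall s', Rabs (s' - s) < d -> P s' d.
(* [compactness_value_1d] asks for a gauge on all of [R]. The implication in [Q] makes any value
   acceptable outside the interval. *)
pose delta s : posreal := epsilon (inhabits (mkposreal 1 Rlt_0_1)) (Q s).
have Hdelta s : A <= s <= B -> forall s', Rabs (s' - s) < delta s -> P s' (delta s).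
  have : Q s (delta s).
    apply: epsilon_spec; case: (classic (A <= s <= B)) => [Hs|Hs].
      by have [d [Hd Hd']] := H s Hs; exists (mkposreal d Hd) => _.
    by exists (mkposreal 1 Rlt_0_1).
  exact.
have [d Hd] := compactness_value_1d A B delta.
exists d; split; first exact: cond_pos.
move=> s Hs; apply: NNPP => Hn; apply: (Hd s Hs) => -[t [Ht [Hst Hdt]]]; apply: Hn.
by apply: Hm (Hdelta t Ht s Hst) _; split=> //; exact: cond_pos.
Qed.

Lemma derivable_continuity_pt (f : R -> R) (t l : R) :
  derivable_pt_lim f t l -> continuity_pt f t.
Proof. by move=> H; apply: derivable_continuous_pt; exists l. Qed.

Lemma continuity_near (f : R -> R) (t eps : R) : continuity_pt f t -> 0 < eps ->
  exists d, 0 < d /\ forall u, Rabs (u - t) < d -> Rabs (f u - f t) < eps.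
Proof.
move=> H He; have [a [Ha G]] := H eps He; exists a; split=> // u Hu.
case: (Req_dec u t) => [->|Hut]; first by rewrite Rminus_diag Rabs_R0.
by apply: G; split=> //; split=> // E; apply: Hut.
Qed.

Lemma curve_box (I : finType) (b : R -> I -> R) (t eps : R) :
  (forall j, continuity_pt (fun u => b u j) t) -> 0 < eps ->
  exists d, 0 < d /\ forall u, Rabs (u - t) < d -> box (b t) eps (b u).
Proof.
move=> Hc He.
have [d [Hd H]] : exists d, 0 < d /\ forall j u, Rabs (u - t) < d -> Rabs (b u j - b t j) < eps.
  apply: (fin_radius (P := fun j e => forall u, Rabs (u - t) < e -> Rabs (b u j - b t j) < eps)).
    by move=> i e e' G [_ Hee] u Hu; apply: G; lra.
  by move=> j; exact: continuity_near.
by exists d; split=> // u Hu j; exact: H.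
Qed.

(** [D u * exp (- K * u)] is nonincreasing. The differential inequality is asked only for [u < s],
    so that the lemma applies at the first instant where the threshold of a conditional estimate
    might be reached. *)
Lemma gronwall_half (D D' : R -> R) (S s K : R) : 0 <= s <= S ->
  (forall u, 0 <= u <= S -> derivable_pt_lim D u (D' u)) ->
  (forall u, 0 <= u < s -> D' u <= K * D u) -> D s <= D 0 * exp (K * s).
Proof.
move=> [Hs0 HsS] HD HK.
case: (Req_dec s 0) => [->|Hs]; first by rewrite Rmult_0_r exp_0; lra.
pose G u := D u * exp (- K * u).
pose G' u := D' u * exp (- K * u) + D u * (exp (- K * u) * - K).
have HG u : 0 <= u <= S -> derivable_pt_lim G u (G' u).
  move=> Hu; apply: derivable_pt_lim_mult; first exact: HD.
  apply: (derivable_pt_lim_comp (fun u => - K * u) exp); last exact: derivable_pt_lim_exp.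
  have {2}-> : - K = - K * 1 by ring.
  by apply: derivable_pt_lim_scal; exact: derivable_pt_lim_id.
have [c [Hc E]] : exists c, (0 < c < s) /\ G s - G 0 = G' c * (s - 0).
  have pr1 c : 0 < c < s -> derivable_pt G c by move=> Hc; exists (G' c); apply: HG; lra.
  have pr2 c : 0 < c < s -> derivable_pt id c by move=> _; exact: derivable_pt_id.
  have [] := MVT_cor2 G G' 0 s; [lra | by move=> c Hc; apply: HG; lra |].
  by move=> c [Hc1 Hc2]; exists c.
have Hneg : G' c <= 0.
  have := HK c ltac:(lra); have := exp_pos (- K * c); rewrite /G' => H1 H2; nra.
have H0 : G 0 = D 0 by rewrite /G Rmult_0_r exp_0 Rmult_1_r.
have HGs : G s <= D 0 by nra.
have Hx : exp (- K * s) * exp (K * s) = 1.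
  by rewrite -exp_plus -exp_0; congr exp; ring.
have -> : D s = G s * exp (K * s) by rewrite /G Rmult_assoc Hx Rmult_1_r.
by apply: Rmult_le_compat_r => //; apply: Rlt_le; exact: exp_pos.
Qed.

(* The differential inequality is only assumed below the threshold [eta]; the conclusion shows
   that the threshold is never reached. *)
Lemma gronwall_conditional (D D' : R -> R) (S K eta : R) : 0 <= K -> 0 <= D 0 ->
  (forall u, 0 <= u <= S -> derivable_pt_lim D u (D' u)) ->
  (forall u, 0 <= u <= S -> D u < eta -> D' u <= K * D u) ->
  D 0 * exp (K * S) < eta -> forall s, 0 <= s <= S -> D s <= D 0 * exp (K * S).
Proof.
move=> HK HD0 HD Hin Hlt.
have mono s : 0 <= s <= S -> D 0 * exp (K * s) <= D 0 * exp (K * S).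
  move=> Hs; apply: Rmult_le_compat_l => //.
  case: (Req_dec (K * s) (K * S)) => [->|Hne]; first lra.
  apply: Rlt_le; apply: exp_increasing.
  have := Rmult_le_compat_l K s S HK ltac:(lra); lra.
suff below s : 0 <= s <= S -> D s < eta.
  move=> s Hs; apply: Rle_trans (mono s Hs).
  by apply: (gronwall_half Hs HD) => u Hu; apply: Hin; [lra | apply: below; lra].
move=> Hs.
(* [E] collects the times before which [D] stays below [eta]. At its supremum [m], [gronwall_half]
   still yields [D m < eta] strictly, and continuity would push [E] past [m] if [m] were smaller
   than [s]. *)
pose E u := 0 <= u <= S /\ forall v, 0 <= v < u -> D v < eta.
have E0 : E 0 by split; [lra | move=> v; lra].
have [m [Hub Hlub]] : {m | is_lub E m}.
  apply: completeness; last by exists 0.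
  by exists S => u [[_ Hu] _].
have HmS : 0 <= m <= S.
  by split; [exact: Hub | apply: Hlub => u [[]]].
have Hbelow v : 0 <= v < m -> D v < eta.
  move=> Hv; apply: NNPP => Hn.
  suff : m <= v by lra.
  apply: Hlub => u [Hu1 Hu2]; case: (Rle_lt_dec u v) => // Huv.
  by have := Hu2 v; lra.
have Hm : D m < eta.
  apply: Rle_lt_trans Hlt; apply: Rle_trans (mono m HmS).
  apply: (gronwall_half HmS HD) => u Hu; apply: Hin; [lra | apply: Hbelow; lra].
have [d [Hd Hnear]] := continuity_near (derivable_continuity_pt (HD m HmS)) (eps := eta - D m) ltac:(lra).
case: (Rle_lt_dec s m) => Hsm.
  case: (Req_dec s m) => [->//|Hne]; apply: Hbelow; lra.
pose m' := Rmin S (m + d / 2).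
have : E m'.
  split.
    split; first by apply: Rmin_glb; lra.
    exact: Rmin_l.
  move=> v [Hv0 Hv]; case: (Rlt_le_dec v m) => Hvm; first by apply: Hbelow; lra.
  have Hv2 := Rmin_r S (m + d / 2).
  have : Rabs (v - m) < d by rewrite /m' in Hv; rewrite Rabs_pos_eq; lra.
  move/Hnear => H1; have := Rle_abs (D v - D m); lra.
move/Hub; rewrite /m'; have : m < Rmin S (m + d / 2) by apply: Rmin_glb_lt; lra.
lra.
Qed.

Section Gronwall.
Variable T : finType.
Implicit Types p dp : R -> T -> R.

(* Since [(sqn p)' <= 2 nrm p (K nrm p + eps) <= (2 K + 1) (nrm p)^2 + eps^2] and
   [(nrm p)^2 <= #|T| sqn p], the quantity [sqn p + eps^2] grows at most at this exponential rate. *)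
Definition growth (K : R) : R := (2 * K + 1) * (INR #|T| + 1).

Lemma growth_ge0 K : 0 <= K -> 0 <= growth K.
Proof. by move=> HK; have := pos_INR #|T|; rewrite /growth; nra. Qed.

(** [eps] is an inhomogeneous error, absorbed by adding [eps ^ 2] to the squared norm; [eta]
    confines the hypothesis to a tube in which the growth bound is known. Exact solutions use
    [eps = 0]. *)
Lemma gronwall_vec_pos p dp (S K eps eta : R) : 0 <= K -> 0 <= S ->
  (forall s j, 0 <= s <= S -> derivable_pt_lim (fun u => p u j) s (dp s j)) ->
  (forall s, 0 <= s <= S -> sqn (p s) + eps ^ 2 < eta -> nrm (dp s) <= K * nrm (p s) + Rabs eps) ->
  (sqn (p 0) + eps ^ 2) * exp (growth K * S) < eta ->
  forall s, 0 <= s <= S -> sqn (p s) + eps ^ 2 <= (sqn (p 0) + eps ^ 2) * exp (growth K * S).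
Proof.
move=> HK HS Hp Hin Hlt.
have Hcg := growth_ge0 HK.
pose D s := sqn (p s) + eps ^ 2.
pose D' s := \sum_j (2 * p s j * dp s j).
apply: (gronwall_conditional (D := D) (D' := D') (eta := eta)) => //.
- by rewrite /D; have := sqn_ge0 (p 0); have := pow2_ge_0 eps; lra.
- move=> u Hu; rewrite -[D' u]Rplus_0_r; apply: derivable_pt_lim_plus.
    apply: derivable_sum => j.
    apply: (derivable_pt_lim_ext (fun u => p u j * p u j)); first by move=> v /=; ring.
    have -> : 2 * p u j * dp u j = dp u j * p u j + p u j * dp u j by ring.
    by apply: derivable_pt_lim_mult; exact: Hp.
  exact: derivable_pt_lim_const.
- move=> u Hu /(Hin u Hu) H.
  have H1 : D' u <= 2 * (nrm (p u) * nrm (dp u)).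
    have -> : D' u = 2 * \sum_j (p u j * dp u j).
      by rewrite -sumZ; apply: eq_bigr => j _; ring.
    by apply: Rmult_le_compat_l; [lra | exact: Rle_trans (Rle_abs _) (sum_mul_le _ _)].
  have H2 := nrm_sq (p u); have H3 := nrm_ge0 (p u); have H4 := pow2_abs eps.
  have H5 := Rabs_pos eps; have H6 := pos_INR #|T|; have H7 := sqn_ge0 (p u).
  rewrite /D /growth; move: (nrm (p u)) (nrm (dp u)) (Rabs eps) (INR #|T|) (sqn (p u)) (D' u)
    H H1 H2 H3 H4 H5 H6 H7 => a b e N q d' H H1 H2 H3 <- H5 H6 H7.
  have A1 : d' <= 2 * a * (K * a + e).
    by apply: Rle_trans H1 _; rewrite -Rmult_assoc; apply: Rmult_le_compat_l; lra.
  have A2 : 2 * a * (K * a + e) <= (2 * K + 1) * a ^ 2 + e ^ 2.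
    by have := pow2_ge_0 (a - e); nra.
  have A3 : (2 * K + 1) * a ^ 2 <= (2 * K + 1) * (N * q).
    by apply: Rmult_le_compat_l; lra.
  have A4 : 0 <= e ^ 2 by exact: pow2_ge_0.
  have A5 : 0 <= (2 * K + 1) * q by apply: Rmult_le_pos; lra.
  have A6 : 0 <= K * N by exact: Rmult_le_pos.
  have A7 : 0 <= (2 * K * N + 2 * K + N) * e ^ 2 by apply: Rmult_le_pos; lra.
  lra.
Qed.

(** Negative times follow by reversing time: [u -> p (- u)] has derivative [- dp (- u)], of the same
    norm. *)
Lemma gronwall_vec p dp (S K eps eta : R) : 0 <= K -> 0 <= S ->
  (forall s j, Rabs s <= S -> derivable_pt_lim (fun u => p u j) s (dp s j)) ->
  (forall s, Rabs s <= S -> sqn (p s) + eps ^ 2 < eta -> nrm (dp s) <= K * nrm (p s) + Rabs eps) ->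
  (sqn (p 0) + eps ^ 2) * exp (growth K * S) < eta ->
  forall s, Rabs s <= S -> sqn (p s) + eps ^ 2 <= (sqn (p 0) + eps ^ 2) * exp (growth K * S).
Proof.
move=> HK HS Hp Hin Hlt s Hs.
case: (Rle_lt_dec 0 s) => Hs0.
  apply: (gronwall_vec_pos (p := p) (dp := dp) (eta := eta)) => //.
  - by move=> u j Hu; apply: Hp; rewrite Rabs_pos_eq; lra.
  - by move=> u Hu; apply: Hin; rewrite Rabs_pos_eq; lra.
  - by move: Hs; rewrite Rabs_pos_eq; lra.
have Hneg u : 0 <= u <= S -> Rabs (- u) <= S by move=> Hu; rewrite Rabs_Ropp Rabs_pos_eq; lra.
have H0 : p (- 0) = p 0 by rewrite Ropp_0.
rewrite -(Ropp_involutive s) -{1}H0.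
apply: (gronwall_vec_pos (p := fun u => p (- u)) (dp := fun u j => - dp (- u) j) (eta := eta)) => //.
- move=> u j Hu; have -> : - dp (- u) j = dp (- u) j * - 1 by ring.
  apply: (derivable_pt_lim_comp (fun u => - u) (fun u => p u j)).
    have -> : -1 = - (1) by [].
    apply: derivable_pt_lim_opp; exact: derivable_pt_lim_id.
  by apply: Hp; exact: Hneg.
- move=> u Hu Hl; have := Hin (- u) (Hneg u Hu) Hl.
  by congr (_ <= _); apply: eq_bigr => j _; rewrite Rabs_Ropp.
- by rewrite H0.
- by move: Hs; rewrite Rabs_left; lra.
Qed.

End Gronwall.

(** * Dependence of solutions on initial conditions *)

Lemma sq_le_sq (a b : R) : 0 <= b -> a ^ 2 <= b ^ 2 -> a <= b.
Proof. by move=> Hb H; apply: Rnot_lt_le => Hlt; nra. Qed.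

(** A single number serves as radius [d] and as constant [/ d]. Shrinking [d] weakens both, which is
    the monotonicity that [fin_radius], and later compactness along a curve, require. *)
Lemma lip_fin (T I : finType) (f : I -> (T -> R) -> R) (x : T -> R) : (forall i, lip (f i) x) ->
  exists d K, 0 < d /\ 0 < K /\ forall i a c, box x d a -> box x d c ->
    Rabs (f i a - f i c) <= K * nrm (sub a c).
Proof.
move=> H.
have [d [Hd Hj]] : exists d, 0 < d /\ forall i a c, box x d a -> box x d c ->
    Rabs (f i a - f i c) <= / d * nrm (sub a c).
  apply: (fin_radius (P := fun i d => forall a c, box x d a -> box x d c ->
    Rabs (f i a - f i c) <= / d * nrm (sub a c))).
    move=> i d d' G [Hd' Hdd] a c Ha Hc.
    apply: Rle_trans (G a c (box_le Hdd Ha) (box_le Hdd Hc)) _.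
    apply: Rmult_le_compat_r; first exact: nrm_ge0.
    by apply: Rinv_le_contravar.
  move=> i; have [d [K [Hd [HK G]]]] := H i.
  have HiK : 0 < / K by exact: Rinv_0_lt_compat.
  exists (Rmin d (/ K)); split; first exact: Rmin_pos.
  move=> a c Ha Hc; apply: Rle_trans (G a c (box_le (Rmin_l _ _) Ha) (box_le (Rmin_l _ _) Hc)) _.
  apply: Rmult_le_compat_r; first exact: nrm_ge0.
  rewrite -{1}(Rinv_inv K); apply: Rinv_le_contravar; [exact: Rmin_pos | exact: Rmin_r].
by exists d, (/ d); split=> //; split=> //; exact: Rinv_0_lt_compat.
Qed.

Section Dependence.
Variable T : finType.
Implicit Types (x p q a c v : T -> R) (V : (T -> R) -> T -> R).

Definition sol V (a : R -> T -> R) : Prop :=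
  forall s j, derivable_pt_lim (fun u => a u j) s (V (a s) j).

Lemma sol_continuity V (a : R -> T -> R) s j : sol V a -> continuity_pt (fun u => a u j) s.
Proof. by move=> H; exact: derivable_continuity_pt (H s j). Qed.

Lemma vlip V x : (forall j, lip (fun p => V p j) x) ->
  exists d, 0 < d /\ forall a c, box x d a -> box x d c ->
    nrm (sub (V a) (V c)) <= / d * nrm (sub a c).
Proof.
move=> /lip_fin[d [K [Hd [HK H]]]].
have HN := pos_INR #|T|.
have HKN : 0 < K * (INR #|T| + 1) by apply: Rmult_lt_0_compat; lra.
have HiK := Rinv_0_lt_compat _ HKN.
exists (Rmin d (/ (K * (INR #|T| + 1)))); split; first exact: Rmin_pos.
move=> a c Ha Hc.
apply: Rle_trans (nrm_le_const (fun j => H j a c (box_le (Rmin_l _ _) Ha) (box_le (Rmin_l _ _) Hc))) _.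
rewrite -Rmult_assoc; apply: Rmult_le_compat_r; first exact: nrm_ge0.
apply: (Rle_trans _ (K * (INR #|T| + 1))); first lra.
rewrite -{1}(Rinv_inv (K * _)); apply: Rinv_le_contravar; [exact: Rmin_pos | exact: Rmin_r].
Qed.

(** The base point of the derivative varies freely in [cdiff], so on a fixed increment from [x] the
    linear part at any nearby [p] is compared with [f a - f x], which the Lipschitz bound
    controls. *)
Lemma cdiff_bound (f : (T -> R) -> R) (df : (T -> R) -> T -> R) x : cdiff f df x ->
  exists d K, 0 < d /\ 0 < K /\ forall p v, box x d p -> Rabs (\sum_j df p j * v j) <= K * nrm v.
Proof.
move=> H; have [d1 [K1 [Hd1 [HK1 H1]]]] := cdiff_lip H.
have [d2 [Hd2 H2]] := H 1 Rlt_0_1.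
pose d := Rmin d1 d2; have Hd : 0 < d by exact: Rmin_pos.
exists d, (K1 + 1); split=> //; split; first lra.
move=> p v Hp; have Hv := nrm_ge0 v.
(* Scaling by [tau] brings an arbitrary [v] into the box, even when [v] is zero; linearity removes
   the factor at the end. *)
pose tau := d / (nrm v + 1).
have Htau : 0 < tau by apply: Rdiv_lt_0_compat; lra.
have Etau : tau * (nrm v + 1) = d by rewrite /tau; field; lra.
pose a : T -> R := fun j => x j + tau * v j.
have Ea j : a j - x j = tau * v j by rewrite /a; ring.
have Ha : box x d a.
  move=> j; rewrite Ea Rabs_mult (Rabs_pos_eq tau); last lra.
  by have := nrm_term v j; nra.
have En : nrm (sub a x) = tau * nrm v.
  rewrite /nrm -sumZ; apply: eq_bigr => j _.
  by rewrite /sub Ea Rabs_mult (Rabs_pos_eq tau) //; lra.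
have Es : \sum_j df p j * (a j - x j) = tau * \sum_j df p j * v j.
  by rewrite -sumZ; apply: eq_bigr => j _; rewrite Ea; ring.
have B1 := H1 a x (box_le (Rmin_l _ _) Ha) (box_center x Hd1).
have B2 := H2 p a x (box_le (Rmin_r _ _) Hp) (box_le (Rmin_r _ _) Ha) (box_center x Hd2).
rewrite En in B1 B2; rewrite Es in B2.
set S := \sum_j df p j * v j in B2 *.
have B3 : Rabs (tau * S) <= (K1 + 1) * (tau * nrm v).
  have := Rabs_triang (f a - f x) (- (f a - f x - tau * S)); rewrite Rabs_Ropp.
  have -> : f a - f x + - (f a - f x - tau * S) = tau * S by ring.
  lra.
move: B3; rewrite Rabs_mult (Rabs_pos_eq tau); last lra.
move=> B3; apply: (Rmult_le_reg_l tau) => //; lra.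
Qed.

Section AlongCurve.
Variables (b : R -> T -> R) (S : R) (V : (T -> R) -> T -> R) (J : (T -> R) -> T -> T -> R).
Hypothesis Hb : forall s j, continuity_pt (fun u => b u j) s.

(** The arc of [b] over [[-S, S]] is compact, so a local property with a radius becomes uniform
    along it. *)
Lemma unif_along (P : (T -> R) -> R -> Prop) :
  (forall x d d', P x d -> 0 < d' <= d -> P x d') ->
  (forall s, exists d, 0 < d /\ forall x, box (b s) d x -> P x d) ->
  exists d, 0 < d /\ forall s, Rabs s <= S -> P (b s) d.
Proof.
move=> Hm H.
suff [d [Hd G]] : exists d, 0 < d /\ forall s, - S <= s <= S -> P (b s) d.
  by exists d; split=> // s Hs; apply: G; exact/Rabs_le_between.
apply: (unif_compact (P := fun s d => P (b s) d)) => [s d d'|s _]; first exact: Hm.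
have [d [Hd G]] := H s; have [e [He Hbox]] := curve_box (Hb s) Hd.
exists (Rmin d e); split; first exact: Rmin_pos.
move=> u Hu; apply: Hm (G _ (Hbox u _)) _.
  by have := Rmin_r d e; lra.
by split; [exact: Rmin_pos | exact: Rmin_l].
Qed.

Lemma vlip_along : (forall s j, lip (fun p => V p j) (b s)) ->
  exists d, 0 < d /\ forall s, Rabs s <= S -> forall a c, box (b s) d a -> box (b s) d c ->
    nrm (sub (V a) (V c)) <= / d * nrm (sub a c).
Proof.
move=> H; apply: (unif_along (P := fun x d => forall a c, box x d a -> box x d c ->
    nrm (sub (V a) (V c)) <= / d * nrm (sub a c))).
  move=> x d d' G [Hd' Hdd] a c Ha Hc.
  apply: Rle_trans (G a c (box_le Hdd Ha) (box_le Hdd Hc)) _.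
  apply: Rmult_le_compat_r; first exact: nrm_ge0.
  by apply: Rinv_le_contravar.
move=> s; have [d [Hd G]] := vlip (H s).
(* Half the radius, since boxes around every [x] close to [b s] must stay inside the box around
   [b s]. *)
exists (d / 2); split; first lra.
move=> x Hx a c Ha Hc.
have Hbox y : box x (d / 2) y -> box (b s) d y.
  by move=> Hy; have := box_trans Hx Hy; apply: box_le; lra.
apply: Rle_trans (G a c (Hbox _ Ha) (Hbox _ Hc)) _.
apply: Rmult_le_compat_r; first exact: nrm_ge0.
by apply: Rinv_le_contravar; lra.
Qed.

(** This is where the moving base point in [cdiff] pays off: the derivative is taken at each point
    of the curve, not only at the centre of the neighbourhood. *)
Lemma cdiff_along : (forall s j, cdiff (fun p => V p j) (fun p => J p j) (b s)) ->
  forall eps, 0 < eps -> exists d, 0 < d /\ forall s, Rabs s <= S -> forall j a c,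
    box (b s) d a -> box (b s) d c ->
    Rabs (V a j - V c j - \sum_k J (b s) j k * (a k - c k)) <= eps * nrm (sub a c).
Proof.
move=> H eps He; apply: (unif_along (P := fun x d => forall j a c, box x d a -> box x d c ->
    Rabs (V a j - V c j - \sum_k J x j k * (a k - c k)) <= eps * nrm (sub a c))).
  by move=> x d d' G [Hd' Hdd] j a c Ha Hc; apply: G; apply: box_le Hdd _.
move=> s.
have [d [Hd G]] : exists d, 0 < d /\ forall j p a c, box (b s) d p -> box (b s) d a -> box (b s) d c ->
    Rabs (V a j - V c j - \sum_k J p j k * (a k - c k)) <= eps * nrm (sub a c).
  apply: (fin_radius (P := fun j d => forall p a c, box (b s) d p -> box (b s) d a ->
    box (b s) d c -> Rabs (V a j - V c j - \sum_k J p j k * (a k - c k)) <= eps * nrm (sub a c))).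
    by move=> j d d' G [Hd' Hdd] p a c Hp Ha Hc; apply: G; apply: box_le Hdd _.
  by move=> j; exact: H.
exists (d / 2); split; first lra.
move=> x Hx j a c Ha Hc.
have Hbox y : box x (d / 2) y -> box (b s) d y.
  by move=> Hy; have := box_trans Hx Hy; apply: box_le; lra.
by apply: G; [apply: box_le Hx; lra | exact: Hbox | exact: Hbox].
Qed.

Lemma jac_bound_along : (forall s j, cdiff (fun p => V p j) (fun p => J p j) (b s)) ->
  exists K, 0 <= K /\ forall s v, Rabs s <= S ->
    nrm (fun j => \sum_k J (b s) j k * v k) <= K * nrm v.
Proof.
move=> H.
have [d [Hd G]] : exists d, 0 < d /\ forall s, Rabs s <= S -> forall j v,
    Rabs (\sum_k J (b s) j k * v k) <= / d * nrm v.
  apply: (unif_along (P := fun x d => forall j v, Rabs (\sum_k J x j k * v k) <= / d * nrm v)).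
    move=> x d d' G [Hd' Hdd] j v; apply: Rle_trans (G j v) _.
    apply: Rmult_le_compat_r; first exact: nrm_ge0.
    by apply: Rinv_le_contravar.
  move=> s.
  have [d [Hd G]] : exists d, 0 < d /\ forall j p v, box (b s) d p ->
      Rabs (\sum_k J p j k * v k) <= / d * nrm v.
    apply: (fin_radius (P := fun j d => forall p v, box (b s) d p ->
      Rabs (\sum_k J p j k * v k) <= / d * nrm v)).
      move=> j d d' G [Hd' Hdd] p v Hp; apply: Rle_trans (G p v (box_le Hdd Hp)) _.
      apply: Rmult_le_compat_r; first exact: nrm_ge0.
      by apply: Rinv_le_contravar.
    move=> j; have [d [K [Hd [HK G]]]] := cdiff_bound (H s j).
    have HiK : 0 < / K by exact: Rinv_0_lt_compat.
    exists (Rmin d (/ K)); split; first exact: Rmin_pos.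
    move=> p v Hp; apply: Rle_trans (G p v (box_le (Rmin_l _ _) Hp)) _.
    apply: Rmult_le_compat_r; first exact: nrm_ge0.
    rewrite -{1}(Rinv_inv K); apply: Rinv_le_contravar; [exact: Rmin_pos | exact: Rmin_r].
  by exists d; split=> // x Hx j v; exact: G.
exists (INR #|T| * / d); split.
  apply: Rmult_le_pos; [exact: pos_INR | apply: Rlt_le; exact: Rinv_0_lt_compat].
by move=> s v Hs; rewrite Rmult_assoc; apply: nrm_le_const => j; exact: G.
Qed.

End AlongCurve.

(** The Lipschitz constant is available only in a tube of radius [d] around [b]. Gronwall with
    threshold [d ^ 2] shows that a solution starting close enough never leaves the tube. *)
Lemma stability V (b : R -> T -> R) (S : R) : 0 <= S -> sol V b ->
  (forall s j, lip (fun p => V p j) (b s)) ->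
  exists eta K, 0 < eta /\ 0 < K /\ forall a : R -> T -> R, sol V a -> nrm (sub (a 0) (b 0)) < eta ->
    forall s, Rabs s <= S -> nrm (sub (a s) (b s)) <= K * nrm (sub (a 0) (b 0)).
Proof.
move=> HS Hsb Hl.
have [d [Hd G]] := vlip_along S (fun s j => sol_continuity s j Hsb) Hl.
have Hid : 0 < / d by exact: Rinv_0_lt_compat.
pose E := exp (growth T (/ d) * S).
have HE : 0 < E by exact: exp_pos.
have Hd2 : 0 < d ^ 2 by apply: pow_lt.
(* The bound 1 makes the squared initial distance at most the distance, so [d ^ 2 / E] suffices for
   the threshold. The constant dominates the square root of [INR #|T| * E], the factor produced by
   Gronwall and the comparison of norms. *)
exists (Rmin 1 (d ^ 2 / E)), (INR #|T| * E + 1).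
have HN := pos_INR #|T|.
have HNE : 0 <= INR #|T| * E by apply: Rmult_le_pos; lra.
split; first by apply: Rmin_pos; [lra | exact: Rdiv_lt_0_compat].
split; first lra.
move=> a Hsa Ha s Hs.
have Hn0 := nrm_ge0 (sub (a 0) (b 0)).
have Hsq := sq_nrm (sub (a 0) (b 0)).
have Hs1 : nrm (sub (a 0) (b 0)) * E < d ^ 2.
  apply/Rlt_div_r => //; have := Rmin_r 1 (d ^ 2 / E); lra.
have Hn1 : nrm (sub (a 0) (b 0)) < 1 by have := Rmin_l 1 (d ^ 2 / E); lra.
have main : sqn (sub (a s) (b s)) + 0 ^ 2 <= (sqn (sub (a 0) (b 0)) + 0 ^ 2) * E.
  apply: (gronwall_vec (p := fun s => sub (a s) (b s)) (dp := fun s => sub (V (a s)) (V (b s)))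
    (eta := d ^ 2) (K := / d) (S := S)) => //; first (by apply: Rlt_le).
  - by move=> u j _; apply: derivable_pt_lim_minus; [exact: Hsa | exact: Hsb].
  - move=> u Hu Hlt; rewrite Rabs_R0 Rplus_0_r; apply: (G u Hu); last exact: box_center.
    move=> j; have := sqn_term (sub (a u) (b u)) j; rewrite -pow2_abs /sub => H.
    apply: Rnot_le_lt => Hle.
    have : d ^ 2 <= Rabs (a u j - b u j) ^ 2 by apply: pow_incr; lra.
    change (sqn (fun j => a u j - b u j)) with (sqn (sub (a u) (b u))) in H.
    lra.
  - rewrite -/E; nra.
rewrite pow_ne_zero // !Rplus_0_r in main.
apply: sq_le_sq; first by apply: Rmult_le_pos; lra.
apply: Rle_trans (nrm_sq _) _.
apply: (Rle_trans _ (INR #|T| * E * nrm (sub (a 0) (b 0)) ^ 2)).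
  rewrite Rmult_assoc; apply: Rmult_le_compat_l => //.
  by apply: Rle_trans main _; rewrite Rmult_comm; apply: Rmult_le_compat_l; lra.
rewrite Rpow_mult_distr; apply: Rmult_le_compat_r; first exact: pow2_ge_0.
nra.
Qed.

End Dependence.

Lemma Deriv_eq (f : R -> R) (t l : R) : derivable_pt_lim f t l -> Deriv f t = l.
Proof.
move=> H; apply: (uniqueness_limite f t) => //.
by apply: (epsilon_spec (inhabits 0) (fun l => derivable_pt_lim f t l)); exists l.
Qed.

Lemma inv_nat_small (d : R) : 0 < d -> exists N : nat, forall n, (N <= n)%coq_nat -> 0 < / INR n.+1 < d.
Proof.
move=> Hd; have [N [HN HN0]] := archimed_cor1 d Hd; exists N => n Hn.
have Hp : 0 < INR n.+1 by apply: lt_0_INR; apply: PeanoNat.Nat.lt_0_succ.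
split; first exact: Rinv_0_lt_compat.
apply: Rle_lt_trans HN; apply: Rinv_le_contravar; first by apply: lt_0_INR.
by apply: le_INR; apply: PeanoNat.Nat.le_trans Hn (PeanoNat.Nat.le_succ_diag_r _).
Qed.

(** The limit is chosen before [eps] and [d], so it inherits every Cauchy bound satisfied by [q].
    Bounds uniform in flow time thereby survive a limit taken pointwise. *)
Lemma cauchy_limit (q : R -> R) :
  (forall eps, 0 < eps -> exists d, 0 < d /\ forall h k, 0 < Rabs h < d -> 0 < Rabs k < d ->
     Rabs (q h - q k) <= eps) ->
  exists l, forall eps d, 0 < d ->
    (forall h k, 0 < Rabs h < d -> 0 < Rabs k < d -> Rabs (q h - q k) <= eps) ->
    forall h, 0 < Rabs h < d -> Rabs (q h - l) <= eps.
Proof.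
move=> H; pose u n := q (/ INR n.+1).
have Hsmall n d : 0 < / INR n.+1 < d -> 0 < Rabs (/ INR n.+1) < d.
  by move=> Hn; rewrite Rabs_pos_eq; lra.
have [l Hl] : {l | Un_cv u l}.
  apply: R_complete => eps He.
  have [d [Hd G]] := H (eps / 2) ltac:(lra).
  have [N HN] := inv_nat_small Hd; exists N => n m Hn Hm.
  apply: (Rle_lt_trans _ (eps / 2)); last lra.
  by apply: G; apply: Hsmall; exact: HN.
exists l => eps d Hd G h Hh.
apply: le_epsilon => e He.
have [N1 HN1] := inv_nat_small Hd; have [N2 HN2] := Hl e He.
pose n := Nat.max N1 N2.
have E1 := G h (/ INR n.+1) Hh (Hsmall _ _ (HN1 n (PeanoNat.Nat.le_max_l _ _))).
have := HN2 n (PeanoNat.Nat.le_max_r _ _); rewrite /Rdist /u => E2.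
have := Rabs_triang (q h - q (/ INR n.+1)) (q (/ INR n.+1) - l).
have -> : q h - q (/ INR n.+1) + (q (/ INR n.+1) - l) = q h - l by ring.
lra.
Qed.

(** * Differentiability of solutions with respect to a parameter *)

Section Differentiability.
Variables (T : finType) (V : (T -> R) -> T -> R) (J : (T -> R) -> T -> T -> R).
Variables (w : R -> R -> T -> R) (t0 rho : R) (v0 : T -> R).
Hypothesis Hrho : 0 < rho.
Hypothesis Hsol : forall t, Rabs (t - t0) < rho -> sol V (w t).
Hypothesis HV : forall t s j, Rabs (t - t0) < rho -> cdiff (fun p => V p j) (fun p => J p j) (w t s).
Hypothesis Hv0 : forall j, derivable_pt_lim (fun t => w t 0 j) t0 (v0 j).

Let b := w t0.
Let Q (h s : R) : T -> R := fun j => (w (t0 + h) s j - b s j) / h.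
Let dQ (h s : R) : T -> R := fun j => (V (w (t0 + h) s) j - V (b s) j) / h.
Let Jm (s : R) (v : T -> R) : T -> R := fun j => \sum_k J (b s) j k * v k.

Lemma near_t0 : Rabs (t0 - t0) < rho.
Proof. by rewrite Rminus_diag Rabs_R0. Qed.

Lemma near_t0h h : Rabs h < rho -> Rabs (t0 + h - t0) < rho.
Proof. by have -> : t0 + h - t0 = h by ring. Qed.

Let Hb s j : continuity_pt (fun u => b u j) s.
Proof. exact: sol_continuity (Hsol near_t0). Qed.

Lemma quotient_bound (S : R) : 0 <= S -> exists h0 M, 0 < h0 <= rho /\ 0 < M /\
  forall h s, 0 < Rabs h < h0 -> Rabs s <= S -> nrm (Q h s) <= M.
Proof.
move=> HS.
have Hl s j : lip (fun p => V p j) (b s) by exact: cdiff_lip (HV s j near_t0).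
have [eta [K [Heta [HK G]]]] := stability HS (Hsol near_t0) Hl.
have [d [Hd Hdl]] : exists d, 0 < d /\ forall j h, Rabs h < d ->
    Rabs (w (t0 + h) 0 j - w t0 0 j) <= (Rabs (v0 j) + 1) * Rabs h.
  apply: (fin_radius (P := fun j d => forall h, Rabs h < d ->
    Rabs (w (t0 + h) 0 j - w t0 0 j) <= (Rabs (v0 j) + 1) * Rabs h)).
    by move=> j d d' H [_ Hdd] h Hh; apply: H; lra.
  by move=> j; exact: derivable_lip_at (Hv0 j).
pose M0 := \sum_j (Rabs (v0 j) + 1) + 1.
have HM0 : 0 < M0.
  suff : 0 <= \sum_j (Rabs (v0 j) + 1) by rewrite /M0; lra.
  by apply: sum_ge0 => j; have := Rabs_pos (v0 j); lra.
have Hinit h : Rabs h < d -> nrm (sub (w (t0 + h) 0) (b 0)) <= M0 * Rabs h.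
  move=> Hh; apply: (Rle_trans _ (\sum_j ((Rabs (v0 j) + 1) * Rabs h))).
    by apply: sum_le => j; exact: Hdl.
  by rewrite sumZr; apply: Rmult_le_compat_r; [exact: Rabs_pos | rewrite /M0; lra].
have Hq : 0 < eta / M0 by exact: Rdiv_lt_0_compat.
exists (Rmin rho (Rmin d (eta / M0))), (K * M0).
have L1 := Rmin_l rho (Rmin d (eta / M0)); have L2 := Rmin_r rho (Rmin d (eta / M0)).
have L3 := Rmin_l d (eta / M0); have L4 := Rmin_r d (eta / M0).
split; first by split=> //; apply: Rmin_pos => //; exact: Rmin_pos.
split; first exact: Rmult_lt_0_compat.
move=> h s [Hh0 Hh] Hs.
have Hi : nrm (sub (w (t0 + h) 0) (b 0)) <= M0 * Rabs h by apply: Hinit; lra.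
have Hlt : nrm (sub (w (t0 + h) 0) (b 0)) < eta.
  apply: Rle_lt_trans Hi _; rewrite Rmult_comm; apply/Rlt_div_r => //; lra.
have Hhr : Rabs h < rho by lra.
have Hw := G (w (t0 + h)) (Hsol (near_t0h Hhr)) Hlt s Hs.
have EQ : nrm (Q h s) * Rabs h = nrm (sub (w (t0 + h) s) (b s)).
  rewrite /nrm -sumZr; apply: eq_bigr => j _; rewrite -Rabs_mult /Q /sub; congr Rabs.
  by field => Eh; rewrite Eh Rabs_R0 in Hh0; lra.
apply: (Rmult_le_reg_r (Rabs h)) => //; rewrite EQ.
apply: Rle_trans Hw _; rewrite Rmult_assoc; apply: Rmult_le_compat_l => //; lra.
Qed.

Lemma quotient_ode (h s : R) j : 0 < Rabs h < rho ->
  derivable_pt_lim (fun u => Q h u j) s (dQ h s j).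
Proof.
move=> [Hh0 Hh].
apply: (derivable_pt_lim_ext (fun u => / h * (w (t0 + h) u j - b u j))).
  by move=> u; rewrite /Q /Rdiv Rmult_comm.
rewrite /dQ /Rdiv Rmult_comm; apply: derivable_pt_lim_scal; apply: derivable_pt_lim_minus.
  by apply: Hsol; exact: near_t0h.
exact: (Hsol near_t0).
Qed.

(** By stability the increment in the state is at most [M * Rabs h], so the strict differentiability
    error, divided by [h], is small uniformly in [s]: difference quotients almost solve the
    linearised equation. *)
Lemma quotient_ode_error (S eps : R) : 0 <= S -> 0 < eps -> exists h1, 0 < h1 <= rho /\
  forall h s, 0 < Rabs h < h1 -> Rabs s <= S -> nrm (sub (dQ h s) (Jm s (Q h s))) <= eps.
Proof.
move=> HS He.
have [h0 [M [[Hh0 Hh0r] [HM HQ]]]] := quotient_bound HS.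
have HN := pos_INR #|T|.
pose e := eps / ((INR #|T| + 1) * M).
have HNM : 0 < (INR #|T| + 1) * M by apply: Rmult_lt_0_compat; lra.
have He' : 0 < e by exact: Rdiv_lt_0_compat.
have [d [Hd G]] := cdiff_along S Hb (fun s j => HV s j near_t0) He'.
have HdM : 0 < d / M by exact: Rdiv_lt_0_compat.
exists (Rmin h0 (d / M)); split.
  by split; [exact: Rmin_pos | have := Rmin_l h0 (d / M); lra].
move=> h s [Hhp Hh] Hs.
have Hhn : h <> 0 by move=> E; rewrite E Rabs_R0 in Hhp; lra.
have HQs : nrm (Q h s) <= M by apply: HQ => //; have := Rmin_l h0 (d / M); lra.
have EQ j : w (t0 + h) s j - b s j = Q h s j * h by rewrite /Q; field.
have HMh : M * Rabs h < d.
  by rewrite Rmult_comm; apply/Rlt_div_r => //; have := Rmin_r h0 (d / M); lra.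
have Hbox : box (b s) d (w (t0 + h) s).
  move=> j; rewrite EQ Rabs_mult; have := nrm_term (Q h s) j; nra.
have En : nrm (sub (w (t0 + h) s) (b s)) = nrm (Q h s) * Rabs h.
  by rewrite /nrm -sumZr; apply: eq_bigr => j _; rewrite /sub EQ Rabs_mult.
apply: (Rle_trans _ (INR #|T| * (e * M))); last first.
  have -> : e * M = eps / (INR #|T| + 1) by rewrite /e; field; lra.
  have -> : INR #|T| * (eps / (INR #|T| + 1)) = eps - eps / (INR #|T| + 1) by field; lra.
  have : 0 < eps / (INR #|T| + 1) by apply: Rdiv_lt_0_compat; lra.
  lra.
apply: nrm_le_const => j.
have := G s Hs j _ _ Hbox (box_center _ Hd); rewrite En.
have -> : V (w (t0 + h) s) j - V (b s) j - \sum_k J (b s) j k * (w (t0 + h) s k - b s k)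
   = sub (dQ h s) (Jm s (Q h s)) j * h.
  rewrite /sub /Jm Rmult_minus_distr_r -sumZr; congr (_ - _); first by rewrite /dQ; field.
  by apply: eq_bigr => k _; rewrite EQ; ring.
rewrite Rabs_mult -Rmult_assoc => H1.
have H2 := Rmult_le_reg_r _ _ _ Hhp H1.
by apply: Rle_trans H2 _; apply: Rmult_le_compat_l; lra.
Qed.

(** Two quotients almost solve the same linear equation from almost the same initial value, so
    Gronwall bounds their difference. The solution of the linearised equation thus arises as a limit
    and need not be constructed beforehand. *)
Lemma quotient_cauchy (S eps : R) : 0 <= S -> 0 < eps -> exists d, 0 < d <= rho /\
  forall h k, 0 < Rabs h < d -> 0 < Rabs k < d -> forall s j, Rabs s <= S ->
    Rabs (Q h s j - Q k s j) <= eps.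
Proof.
move=> HS He.
have [K [HK HJ]] := jac_bound_along S Hb (fun s j => HV s j near_t0).
pose E := exp (growth T K * S).
have HE : 0 < E by exact: exp_pos.
have HN := pos_INR #|T|.
(* Chosen for the last estimate, where [(INR #|T| ^ 2 + 1) * E] is dominated by the square of
   [(INR #|T| + 1) * (E + 1)]. *)
pose e := eps / (2 * ((INR #|T| + 1) * (E + 1))).
have HNE : 0 < (INR #|T| + 1) * (E + 1) by apply: Rmult_lt_0_compat; lra.
have He' : 0 < e by apply: Rdiv_lt_0_compat; lra.
have Ee : 2 * e * ((INR #|T| + 1) * (E + 1)) = eps by rewrite /e; field; lra.
have [h1 [[Hh1 Hh1r] H1]] := quotient_ode_error HS He'.
have [h2 [Hh2 H2]] : exists d, 0 < d /\ forall j h, 0 < Rabs h < d -> Rabs (Q h 0 j - v0 j) < e.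
  apply: (fin_radius (P := fun j d => forall h, 0 < Rabs h < d -> Rabs (Q h 0 j - v0 j) < e)).
    by move=> j d d' H [_ Hdd] h Hh; apply: H; lra.
  move=> j; have [d Hd] := Hv0 j He'; exists d; split; first exact: cond_pos.
  move=> h [Hh Hhd]; apply: Hd => // Eh; rewrite Eh Rabs_R0 in Hh; lra.
have L1 := Rmin_l h1 h2; have L2 := Rmin_r h1 h2.
exists (Rmin h1 h2); split; first by split; [exact: Rmin_pos | lra].
move=> h k Hh Hk s j Hs.
have main : sqn (sub (Q h s) (Q k s)) + (2 * e) ^ 2 <= (sqn (sub (Q h 0) (Q k 0)) + (2 * e) ^ 2) * E.
  (* The linear estimate holds at every size, so [eta] is merely a number above the bound to be
     proved. *)
  apply: (gronwall_vec (p := fun s => sub (Q h s) (Q k s)) (dp := fun s => sub (dQ h s) (dQ k s))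
    (eta := (sqn (sub (Q h 0) (Q k 0)) + (2 * e) ^ 2) * E + 1) (K := K) (S := S)) => //.
  - by move=> u i _; apply: derivable_pt_lim_minus; apply: quotient_ode; lra.
  - move=> u Hu _; rewrite Rabs_pos_eq; last lra.
    have A1 := H1 h u ltac:(lra) Hu; have A2 := H1 k u ltac:(lra) Hu.
    have A3 := HJ u (sub (Q h u) (Q k u)) Hu.
    apply: (Rle_trans _ (nrm (fun j => \sum_k0 J (b u) j k0 * sub (Q h u) (Q k u) k0) +
      (nrm (sub (dQ h u) (Jm u (Q h u))) + nrm (sub (dQ k u) (Jm u (Q k u)))))); last lra.
    rewrite (nrm_sub_sym (dQ k u)).
    apply: (Rle_trans _ (nrm (fun j => \sum_k0 J (b u) j k0 * sub (Q h u) (Q k u) k0) +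
       nrm (fun j => sub (dQ h u) (Jm u (Q h u)) j + sub (Jm u (Q k u)) (dQ k u) j))); last first.
      by have := nrmD (sub (dQ h u) (Jm u (Q h u))) (sub (Jm u (Q k u)) (dQ k u)); lra.
    apply: Rle_trans (nrmD _ _); apply: Req_le; apply: eq_bigr => i _; congr Rabs.
    have -> : \sum_k0 J (b u) i k0 * sub (Q h u) (Q k u) k0 = Jm u (Q h u) i - Jm u (Q k u) i.
      by rewrite /Jm -sumB; apply: eq_bigr => k0 _; rewrite /sub; ring.
    by rewrite /sub; ring.
  - rewrite -/E; lra.
have Hi : nrm (sub (Q h 0) (Q k 0)) <= INR #|T| * (2 * e).
  apply: nrm_le_const => i; have := H2 i h ltac:(lra); have := H2 i k ltac:(lra).
  have := Rabs_triang (Q h 0 i - v0 i) (- (Q k 0 i - v0 i)); rewrite Rabs_Ropp /sub.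
  have -> : Q h 0 i - v0 i + - (Q k 0 i - v0 i) = Q h 0 i - Q k 0 i by ring.
  lra.
have Hi2 : sqn (sub (Q h 0) (Q k 0)) <= INR #|T| ^ 2 * (2 * e) ^ 2.
  apply: Rle_trans (sq_nrm _) _; rewrite -Rpow_mult_distr; apply: pow_incr; split=> //.
  exact: nrm_ge0.
apply: sq_le_sq; first lra.
rewrite pow2_abs; apply: Rle_trans (sqn_term (sub (Q h s) (Q k s)) j) _.
have P1 := pow2_ge_0 (2 * e).
apply: (Rle_trans _ ((INR #|T| ^ 2 * (2 * e) ^ 2 + (2 * e) ^ 2) * E)).
  apply: (Rle_trans _ ((sqn (sub (Q h 0) (Q k 0)) + (2 * e) ^ 2) * E)); first lra.
  by apply: Rmult_le_compat_r; lra.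
rewrite -Ee (Rpow_mult_distr (2 * e)).
have -> : (INR #|T| ^ 2 * (2 * e) ^ 2 + (2 * e) ^ 2) * E = (2 * e) ^ 2 * ((INR #|T| ^ 2 + 1) * E) by ring.
apply: Rmult_le_compat_l => //; rewrite Rpow_mult_distr.
by apply: Rmult_le_compat; have := pow2_ge_0 (INR #|T|); nra.
Qed.

Lemma flow_quotient_limit s j : exists l, derivable_pt_lim (fun t => w t s j) t0 l /\
  forall eps d, 0 < d ->
    (forall h k, 0 < Rabs h < d -> 0 < Rabs k < d -> Rabs (Q h s j - Q k s j) <= eps) ->
    forall h, 0 < Rabs h < d -> Rabs (Q h s j - l) <= eps.
Proof.
have HC eps : 0 < eps -> exists d, 0 < d /\ forall h k, 0 < Rabs h < d -> 0 < Rabs k < d ->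
    Rabs (Q h s j - Q k s j) <= eps.
  move=> He; have [d [[Hd _] G]] := quotient_cauchy (Rabs_pos s) He.
  by exists d; split=> // h k Hh Hk; apply: G => //; lra.
have [l Hl] := cauchy_limit HC.
exists l; split=> // eps He.
have [d [Hd G]] := HC (eps / 2) ltac:(lra).
exists (mkposreal d Hd) => h Hh Hhd /=.
have := Hl _ _ Hd G h (conj (Rabs_pos_lt _ Hh) Hhd); rewrite /Q /b; lra.
Qed.

(** The quotients converge, and their [s]-derivatives converge uniformly on a ball around [s] to a
    continuous limit; so differentiation in [s] commutes with the limit, and the parameter
    derivative solves the linearised equation. *)
Lemma flow_derivable : exists v : R -> T -> R, v 0 = v0 /\ forall s j,
  derivable_pt_lim (fun t => w t s j) t0 (v s j) /\
  derivable_pt_lim (fun u => v u j) s (\sum_k J (w t0 s) j k * v s k).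
Proof.
pose v (s : R) : T -> R := fun j => Deriv (fun t => w t s j) t0.
have Hd s j : derivable_pt_lim (fun t => w t s j) t0 (v s j).
  by have [l [Hl _]] := flow_quotient_limit s j; rewrite /v (Deriv_eq Hl).
exists v; split; first by apply: functional_extensionality => j; exact: Deriv_eq.
move=> s j; split=> //.
pose S := Rabs s + 1.
have HS : 0 <= S by rewrite /S; have := Rabs_pos s; lra.
have HSp : 0 < S by rewrite /S; have := Rabs_pos s; lra.
have Hlim eps : 0 < eps -> exists d, 0 < d <= rho /\ forall h u i, 0 < Rabs h < d -> Rabs u <= S ->
    Rabs (Q h u i - v u i) <= eps.
  move=> He; have [d [Hdr G]] := quotient_cauchy HS He; exists d; split=> // h u i Hh Hu.
  have [l [Hl Hl']] := flow_quotient_limit u i.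
  rewrite /v (Deriv_eq Hl); apply: (Hl' eps d) => //; first lra.
  by move=> h' k' Hh' Hk'; exact: G.
have [K [HK HJ]] := jac_bound_along S Hb (fun s j => HV s j near_t0).
have [Nr HNr] := inv_nat_small Hrho.
(* The offset [Nr] keeps every term, the first included, below [rho], so each quotient is built from
   genuine solutions. *)
pose hn n := / INR (Nat.add n Nr).+1.
have Hhn d : 0 < d -> exists N : nat, forall n, (N <= n)%coq_nat -> 0 < Rabs (hn n) < d.
  move=> Hdp; have [N HN] := inv_nat_small Hdp; exists N => n Hn; rewrite /hn.
  have := HN (Nat.add n Nr) (PeanoNat.Nat.le_trans _ _ _ Hn (PeanoNat.Nat.le_add_r _ _)) => H.
  by rewrite Rabs_pos_eq; lra.
have Hhr n : 0 < Rabs (hn n) < rho.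
  have H := HNr (Nat.add n Nr) (PeanoNat.Nat.le_add_l _ _).
  by rewrite /hn Rabs_pos_eq; lra.
have Hcvu : CVU (fun n u => dQ (hn n) u j) (fun u => Jm u (v u) j) 0 (mkposreal S HSp).
  move=> eps He.
  pose e := eps / (K * INR #|T| + 2).
  have HN := pos_INR #|T|; have HKN := Rmult_le_pos _ _ HK HN.
  have Hep : 0 < e by apply: Rdiv_lt_0_compat; lra.
  have Ee : e * (K * INR #|T| + 2) = eps by rewrite /e; field; lra.
  have [d1 [[Hd1 _] G1]] := Hlim e Hep.
  have [d2 [[Hd2 _] G2]] := quotient_ode_error HS Hep.
  have [N HN'] := Hhn (Rmin d1 d2) (Rmin_pos _ _ Hd1 Hd2).
  exists N => n u Hn; rewrite /Boule /= Rminus_0_r => Hu.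
  have Hh := HN' n Hn; have L1 := Rmin_l d1 d2; have L2 := Rmin_r d1 d2.
  have A1 : nrm (sub (v u) (Q (hn n) u)) <= INR #|T| * e.
    by apply: nrm_le_const => i; rewrite /sub Rabs_minus_sym; apply: G1; lra.
  have A2 := nrm_term (sub (dQ (hn n) u) (Jm u (Q (hn n) u))) j.
  have A3 := G2 (hn n) u ltac:(lra) ltac:(lra).
  have A4 := HJ u (sub (v u) (Q (hn n) u)) ltac:(lra).
  have A5 := nrm_term (fun j => \sum_k J (b u) j k * sub (v u) (Q (hn n) u) k) j.
  have A6 := Rmult_le_compat_l K _ _ HK A1.
  have E1 : \sum_k J (b u) j k * sub (v u) (Q (hn n) u) k = Jm u (v u) j - Jm u (Q (hn n) u) j.
    by rewrite /Jm -sumB; apply: eq_bigr => k0 _; rewrite /sub; ring.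
  rewrite /= E1 in A5.
  have A7 := Rabs_triang (Jm u (v u) j - Jm u (Q (hn n) u) j) (- sub (dQ (hn n) u) (Jm u (Q (hn n) u)) j).
  rewrite Rabs_Ropp in A7.
  have E2 : Jm u (v u) j - Jm u (Q (hn n) u) j + - sub (dQ (hn n) u) (Jm u (Q (hn n) u)) j =
    Jm u (v u) j - dQ (hn n) u j by rewrite /sub; ring.
  rewrite E2 in A7.
  nra.
have Hin : Boule 0 (mkposreal S HSp) s by rewrite /Boule /= Rminus_0_r /S; lra.
apply: (derivable_pt_lim_CVU (fun n u => Q (hn n) u j) (fun n u => dQ (hn n) u j)
  (fun u => v u j) (fun u => Jm u (v u) j) s 0 (mkposreal S HSp)) => //.
- by move=> y n _; exact: quotient_ode.
- move=> y; rewrite /Boule /= Rminus_0_r => Hy eps He.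
  have [d [[Hdp _] G]] := Hlim (eps / 2) ltac:(lra).
  have [N HN] := Hhn d Hdp; exists N => n Hn; rewrite /Rdist.
  by apply: Rle_lt_trans (G (hn n) y j (HN n Hn) _) _; lra.
- apply: CVU_continuity Hcvu _ => n y _.
  have C t : Rabs (t - t0) < rho -> continuity_pt (fun u => V (w t u) j) y.
    move=> Ht; apply: (cts_comp (f := fun p => V p j)); first exact: lip_cts (cdiff_lip (HV y j Ht)).
    by move=> i; exact: sol_continuity (Hsol Ht).
  have [_ Hr] := Hhr n.
  apply: (continuity_pt_mult (fun u => V (w (t0 + hn n) u) j - V (b u) j) (fun _ => / hn n)).
    exact: (continuity_pt_minus _ _ _ (C _ (near_t0h Hr)) (C _ near_t0)).
  by apply: continuity_pt_const.
Qed.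
End Differentiability.

(** * Local existence of solutions *)

Definition clamp (e y : R) : R := Rmax (- e) (Rmin e y).

Lemma clamp_abs e y : 0 <= e -> Rabs (clamp e y) <= e.
Proof.
move=> He; apply: Rabs_le; split; first exact: Rmax_l.
apply: Rmax_lub; [lra | exact: Rmin_l].
Qed.

Lemma clamp_id e y : Rabs y <= e -> clamp e y = y.
Proof.
move=> /Rabs_le_between[H1 H2]; rewrite /clamp Rmin_right //; exact: Rmax_right.
Qed.

Lemma clamp_lip e y z : Rabs (clamp e y - clamp e z) <= Rabs (y - z).
Proof.
rewrite /clamp /Rmin; case: (Rle_dec e y) => Hy; case: (Rle_dec e z) => Hz; rewrite /Rmax;
  do ![case: (Rle_dec (- e) _) => ?]; rewrite /Rabs; do ![case: (Rcase_abs _) => ?]; lra.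
Qed.

Lemma derivable_RInt (f : R -> R) (s : R) : (forall u, continuity_pt f u) ->
  derivable_pt_lim (fun u => RInt f 0 u) s (f s).
Proof.
move=> Hf; apply/is_derive_Reals; apply: is_derive_RInt; last exact/continuity_pt_filterlim.
apply: filter_forall => u; apply: RInt_correct; apply: ex_RInt_continuous => z _.
exact/continuity_pt_filterlim.
Qed.

Lemma RInt_diff_le (f g : R -> R) (D s : R) : (forall u, continuity_pt f u) ->
  (forall u, continuity_pt g u) -> (forall u, Rabs (f u - g u) <= D) ->
  Rabs (RInt f 0 s - RInt g 0 s) <= D * Rabs s.
Proof.
move=> Hf Hg HD.
have := bounded_variation (fun u => RInt f 0 u - RInt g 0 u) (fun u => f u - g u) D 0 s.
rewrite !RInt_point !Rminus_0_r; apply=> t _; split; last exact: HD.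
by apply/is_derive_Reals; apply: derivable_pt_lim_minus; exact: derivable_RInt.
Qed.

Section Picard.
Variables (T : finType) (V : (T -> R) -> T -> R) (x0 : T -> R) (e L M delta : R).
Hypotheses (He : 0 < e) (HL : 0 < L) (HM : 0 < M) (Hdelta : 0 < delta).
Hypothesis HV : forall a c, (forall j, Rabs (a j - x0 j) <= e) -> (forall j, Rabs (c j - x0 j) <= e) ->
  nrm (sub (V a) (V c)) <= L * nrm (sub a c).
Hypothesis HVM : forall a j, (forall j, Rabs (a j - x0 j) <= e) -> Rabs (V a j) <= M.
Hypothesis HdM : delta * M <= e.
Hypothesis HdL : INR #|T| * delta * L <= / 2.

(* Truncating both the state and the time makes the Picard operator a contraction for the
   supremum norm on all of R, so that no domain has to be tracked along the iteration. *)
Let cl (p : T -> R) : T -> R := fun j => x0 j + clamp e (p j - x0 j).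
Let W (p : T -> R) : T -> R := V (cl p).

Let cl_in p j : Rabs (cl p j - x0 j) <= e.
Proof. by rewrite /cl Rplus_minus_l; apply: clamp_abs; lra. Qed.

Let W_lip a c : nrm (sub (W a) (W c)) <= L * nrm (sub a c).
Proof.
apply: Rle_trans (HV _ _) _; [exact: cl_in | exact: cl_in |].
apply: Rmult_le_compat_l; first lra.
apply: sum_le => j; rewrite /sub /cl.
have := clamp_lip e (a j - x0 j) (c j - x0 j).
have -> : a j - x0 j - (c j - x0 j) = a j - c j by ring.
by have -> : x0 j + clamp e (a j - x0 j) - (x0 j + clamp e (c j - x0 j)) =
  clamp e (a j - x0 j) - clamp e (c j - x0 j) by ring.
Qed.

Let W_M a j : Rabs (W a j) <= M.
Proof. exact: HVM. Qed.

Let W_cts a j : cts (fun p => W p j) a.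
Proof.
apply: lip_cts; exists 1, L; split; [lra | split=> //] => p q _ _.
by apply: Rle_trans (W_lip p q); exact: (nrm_term (sub (W p) (W q))).
Qed.

Fixpoint picard_iter (m : nat) (s : R) : T -> R :=
  match m with
  | O => x0
  | m'.+1 => fun j => x0 j + RInt (fun u => W (picard_iter m' u) j) 0 (clamp delta s)
  end.

Let clamp_cts s : continuity_pt (clamp delta) s.
Proof.
move=> eps Heps; exists eps; split=> // u [_ Hu].
by apply: Rle_lt_trans Hu; exact: clamp_lip.
Qed.

Let iter_cts m : forall s j, continuity_pt (fun u => picard_iter m u j) s.
Proof.
elim: m => [|m IH] s j; first exact: continuity_pt_const.
apply: continuity_pt_plus; first exact: continuity_pt_const.
apply: (continuity_pt_comp (clamp delta) (fun v => RInt (fun u => W (picard_iter m u) j) 0 v)).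
  exact: clamp_cts.
apply: derivable_continuity_pt; apply: derivable_RInt => u.
by apply: (cts_comp (f := fun p => W p j)).
Qed.

Let W_iter_cts m s j : continuity_pt (fun u => W (picard_iter m u) j) s.
Proof. by apply: (cts_comp (f := fun p => W p j)). Qed.

Let B := INR #|T| * (M * delta).

Let B_ge0 : 0 <= B.
Proof. by apply: Rmult_le_pos; [exact: pos_INR | nra]. Qed.

Let iter_near m s j : Rabs (picard_iter m s j - x0 j) <= M * delta.
Proof.
case: m => [|m] /=; first by rewrite Rminus_diag Rabs_R0; nra.
rewrite Rplus_minus_l.
have := @RInt_diff_le (fun u => W (picard_iter m u) j) (fun _ => 0) M (clamp delta s).
have -> : RInt (fun _ => 0) 0 (clamp delta s) = 0 by rewrite RInt_const; exact: Rmult_0_r.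
rewrite Rminus_0_r => H.
apply: Rle_trans (H _ _ _) _.
- by move=> u; exact: W_iter_cts.
- by move=> u; exact: continuity_pt_const.
- by move=> u; rewrite Rminus_0_r; exact: W_M.
by apply: Rmult_le_compat_l; [lra | apply: clamp_abs; lra].
Qed.

Let iter_step m : forall s, nrm (sub (picard_iter m.+1 s) (picard_iter m s)) <= B * (/ 2) ^ m.
Proof.
elim: m => [|m IH] s.
  by rewrite Rmult_1_r; apply: nrm_le_const => j; exact: (iter_near 1 s j).
apply: (Rle_trans _ (INR #|T| * (L * (B * (/ 2) ^ m) * delta))).
  apply: nrm_le_const => j; rewrite /sub /=.
  have -> : forall a b c, a + b - (a + c) = b - c by move=> a b c; ring.
  apply: Rle_trans (RInt_diff_le (D := L * (B * (/ 2) ^ m)) _ _ _ _) _.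
  - by move=> u; exact: (W_iter_cts m.+1).
  - by move=> u; exact: W_iter_cts.
  - move=> u; apply: Rle_trans (nrm_term (sub (W (picard_iter m.+1 u)) (W (picard_iter m u))) j) _.
    by apply: Rle_trans (W_lip _ _) _; apply: Rmult_le_compat_l; [lra | exact: IH].
  apply: Rmult_le_compat_l; last by apply: clamp_abs; lra.
  apply: Rmult_le_pos; first lra.
  by apply: Rmult_le_pos => //; apply: pow_le; lra.
have H := pow_le (/ 2) m ltac:(lra).
have -> : INR #|T| * (L * (B * (/ 2) ^ m) * delta) = (INR #|T| * delta * L) * (B * (/ 2) ^ m) by ring.
have -> : B * (/ 2) ^ m.+1 = / 2 * (B * (/ 2) ^ m) by rewrite /=; ring.
by apply: Rmult_le_compat_r => //; exact: Rmult_le_pos.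
Qed.

(** The telescoped geometric sum is kept in closed form: each step of size [B * (/ 2) ^ n] is
    exactly the change of the right side, so the induction on [k] closes. *)
Let iter_tail m k s :
  nrm (sub (picard_iter (m + k)%coq_nat s) (picard_iter m s)) <= 2 * B * (/ 2) ^ m - 2 * B * (/ 2) ^ (m + k)%coq_nat.
Proof.
elim: k => [|k IH].
  rewrite PeanoNat.Nat.add_0_r Rminus_diag; apply: Req_le; apply: big1 => j _.
  by rewrite /sub Rminus_diag Rabs_R0.
rewrite PeanoNat.Nat.add_succ_r; set n := (m + k)%coq_nat in IH *.
have H := iter_step n s.
have Hp : (/ 2) ^ n.+1 = / 2 * (/ 2) ^ n by [].
have : nrm (sub (picard_iter n.+1 s) (picard_iter m s)) <=
   nrm (sub (picard_iter n.+1 s) (picard_iter n s)) + nrm (sub (picard_iter n s) (picard_iter m s)).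
  apply: Rle_trans (nrmD _ _); apply: Req_le; apply: eq_bigr => j _; congr Rabs.
  by rewrite /sub; ring.
rewrite Hp; nra.
Qed.

Let half_pow_small eps : 0 < eps -> exists N, forall n, (N <= n)%coq_nat -> 2 * B * (/ 2) ^ n < eps.
Proof.
move=> Heps.
have HB1 : 0 < 2 * B + 1 by have := B_ge0; lra.
have [N HN] := pow_lt_1_zero (/ 2) ltac:(rewrite Rabs_pos_eq; lra) (eps / (2 * B + 1)) ltac:(exact: Rdiv_lt_0_compat).
exists N => n Hn; have := HN n Hn; have Hp := pow_lt (/ 2) n ltac:(lra).
rewrite Rabs_pos_eq; last lra.
by move=> /Rlt_div_r -/(_ HB1); nra.
Qed.

Lemma picard_limit : exists c : R -> T -> R, forall m s j,
  Rabs (c s j - picard_iter m s j) <= 2 * B * (/ 2) ^ m.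
Proof.
have tail m n s j : (m <= n)%coq_nat ->
    Rabs (picard_iter n s j - picard_iter m s j) <= 2 * B * (/ 2) ^ m.
  move=> Hmn; have [k ->] : exists k, n = (m + k)%coq_nat.
    by exists (n - m)%coq_nat; rewrite PeanoNat.Nat.add_comm PeanoNat.Nat.sub_add.
  apply: Rle_trans (nrm_term (sub (picard_iter _ s) (picard_iter m s)) j) _.
  apply: Rle_trans (iter_tail _ _ _) _.
  have HB2 : 0 <= 2 * B by have := B_ge0; lra.
  have := Rmult_le_pos _ _ HB2 (pow_le (/ 2) (m + k)%coq_nat ltac:(lra)); lra.
have lim s j : exists l, forall m, Rabs (l - picard_iter m s j) <= 2 * B * (/ 2) ^ m.
  have [l Hl] : {l | Un_cv (fun n => picard_iter n s j) l}.
    apply: R_complete => eps Heps.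
    have Heps2 : 0 < eps / 2 by lra.
    have [N HN] := half_pow_small Heps2.
    exists N => n m Hn Hm; rewrite /Rdist.
    have A := tail N n s j Hn; have A' := tail N m s j Hm; have A'' := HN N (le_n _).
    have := Rabs_triang (picard_iter n s j - picard_iter N s j) (- (picard_iter m s j - picard_iter N s j)).
    rewrite Rabs_Ropp.
    have -> : picard_iter n s j - picard_iter N s j + - (picard_iter m s j - picard_iter N s j) =
      picard_iter n s j - picard_iter m s j by ring.
    lra.
  exists l => m; apply: le_epsilon => eps Heps.
  have [N HN] := Hl eps Heps.
  have := HN _ (PeanoNat.Nat.le_max_l N m); rewrite /Rdist => A.
  have A' := tail m _ s j (PeanoNat.Nat.le_max_r N m).
  have := Rabs_triang (- (picard_iter (Nat.max N m) s j - l)) (picard_iter (Nat.max N m) s j - picard_iter m s j).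
  rewrite Rabs_Ropp.
  have -> : - (picard_iter (Nat.max N m) s j - l) + (picard_iter (Nat.max N m) s j - picard_iter m s j) =
     l - picard_iter m s j by ring.
  lra.
exists (fun s j => epsilon (inhabits 0) (fun l => forall m, Rabs (l - picard_iter m s j) <= 2 * B * (/ 2) ^ m)).
by move=> m s j; exact: (epsilon_spec (inhabits 0) _ (lim s j)).
Qed.

(** For [Rabs s < delta] neither truncation acts: the time stays in range, and [delta * M <= e]
    keeps the limit in the box. The limit therefore solves the original equation there. *)
Lemma picard_truncated : exists c : R -> T -> R, c 0 = x0 /\ forall s, Rabs s < delta ->
  (forall j, Rabs (c s j - x0 j) <= e) /\ forall j, derivable_pt_lim (fun u => c u j) s (V (c s) j).
Proof.
have [c Hc] := picard_limit.
have close eps a b : 0 < eps -> (forall m : nat, Rabs (a - b) <= 2 * B * (/ 2) ^ m) -> a = b.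
  move=> _ H; apply: NNPP => Hab.
  have Hpos : 0 < Rabs (a - b) by apply: Rabs_pos_lt; lra.
  have [N HN] := half_pow_small Hpos; have := HN N (le_n _); have := H N; lra.
have cbox s j : Rabs (c s j - x0 j) <= e.
  apply: (Rle_trans _ (M * delta)); last lra.
  apply: le_epsilon => eps Heps; have [N HN] := half_pow_small Heps.
  have A := Hc N s j; have A' := HN N (le_n _); have A'' := iter_near N s j.
  have := Rabs_triang (c s j - picard_iter N s j) (picard_iter N s j - x0 j).
  have -> : c s j - picard_iter N s j + (picard_iter N s j - x0 j) = c s j - x0 j by ring.
  lra.
have Hcvu r j : CVU (fun m u => picard_iter m u j) (fun u => c u j) 0 r.
  move=> eps Heps; have [N HN] := half_pow_small Heps; exists N => n y Hn _.
  by apply: Rle_lt_trans (Hc n y j) _; exact: HN.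
have ccts s j : continuity_pt (fun u => c u j) s.
  have Hr : 0 < Rabs s + 1 by have := Rabs_pos s; lra.
  apply: (CVU_continuity _ _ 0 (mkposreal _ Hr) (Hcvu _ j)).
    by move=> n y _; exact: iter_cts.
  by rewrite /Boule /= Rminus_0_r; lra.
exists c; split.
  apply: functional_extensionality => j; apply: (close 1); first lra.
  move=> m; have := Hc m 0 j; suff -> : picard_iter m 0 j = x0 j by [].
  case: m => //= m; rewrite clamp_id ?Rabs_R0; last lra.
  by rewrite RInt_point Rplus_0_r.
move=> s Hs; split=> // j.
have EV : V (c s) = W (c s).
  congr V; apply: functional_extensionality => i; rewrite /cl clamp_id //; ring.
rewrite EV.
apply: (derivable_pt_lim_CVU (fun m u => picard_iter m.+1 u j) (fun m u => W (picard_iter m u) j)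
  (fun u => c u j) (fun u => W (c u) j) s 0 (mkposreal delta Hdelta)).
- by rewrite /Boule /= Rminus_0_r.
- move=> y m; rewrite /Boule /= Rminus_0_r => Hy.
  rewrite -[W _ j]Rplus_0_l; apply: derivable_pt_lim_plus; first exact: derivable_pt_lim_const.
  have Hd : 0 < delta - Rabs y by lra.
  have HR := derivable_RInt y (fun u => W_iter_cts m u j).
  move=> eps Heps; have [d Hdd] := HR eps Heps.
  (* Increments are kept small enough that [y + h] also lies where the time truncation is the
     identity. *)
  have Hm : 0 < Rmin d (delta - Rabs y) by apply: Rmin_pos => //; exact: cond_pos.
  exists (mkposreal _ Hm) => h Hh /= Hhd.
  have L1 := Rmin_l d (delta - Rabs y); have L2 := Rmin_r d (delta - Rabs y).
  rewrite !clamp_id; [by apply: Hdd => //; lra | lra |].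
  by have := Rabs_triang y h; lra.
- move=> y _ eps Heps; have [N HN] := half_pow_small Heps; exists N => n Hn.
  rewrite /Rdist Rabs_minus_sym; apply: Rle_lt_trans (Hc n.+1 y j) _.
  by apply: HN; apply: PeanoNat.Nat.le_trans Hn (PeanoNat.Nat.le_succ_diag_r _).
- move=> eps Heps.
  have HNn := pos_INR #|T|.
  have HK : 0 < L * INR #|T| + 1 by nra.
  have Hq : 0 < eps / (L * INR #|T| + 1) by exact: Rdiv_lt_0_compat.
  have [N HN] := half_pow_small Hq.
  exists N => n y Hn _.
  apply: Rle_lt_trans (nrm_term (sub (W (c y)) (W (picard_iter n y))) j) _.
  apply: Rle_lt_trans (W_lip _ _) _.
  have A : nrm (sub (c y) (picard_iter n y)) <= INR #|T| * (2 * B * (/ 2) ^ n).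
    by apply: nrm_le_const => i; exact: Hc.
  have A' := Rmult_lt_compat_r _ _ _ HK (HN n Hn).
  have EK : eps / (L * INR #|T| + 1) * (L * INR #|T| + 1) = eps by field; lra.
  rewrite EK in A'.
  have A'' : 0 <= 2 * B * (/ 2) ^ n by apply: Rmult_le_pos; [have := B_ge0; lra | apply: pow_le; lra].
  have := Rmult_le_compat_l L _ _ (Rlt_le _ _ HL) A; nra.
- by move=> y _; apply: (cts_comp (f := fun p => W p j)).
Qed.

End Picard.

Lemma picard (T : finType) (V : (T -> R) -> T -> R) (x0 : T -> R) (r : R) : 0 < r ->
  (forall j, lip (fun p => V p j) x0) -> exists delta, 0 < delta /\ exists c : R -> T -> R,
  c 0 = x0 /\ forall s, Rabs s < delta ->
  box x0 r (c s) /\ forall j, derivable_pt_lim (fun u => c u j) s (V (c s) j).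
Proof.
move=> Hr /vlip[d [Hd H]].
pose e := Rmin r d / 2.
have Hm : 0 < Rmin r d by exact: Rmin_pos.
have [L1 L2] := (Rmin_l r d, Rmin_r r d).
have He : 0 < e by rewrite /e; lra.
have HL : 0 < / d by exact: Rinv_0_lt_compat.
have HN := pos_INR #|T|.
have Hn0 := nrm_ge0 (V x0).
have HV a c : (forall j, Rabs (a j - x0 j) <= e) -> (forall j, Rabs (c j - x0 j) <= e) ->
    nrm (sub (V a) (V c)) <= / d * nrm (sub a c).
  by move=> Ha Hc; apply: H => j; [have := Ha j | have := Hc j]; rewrite /e; lra.
pose M := nrm (V x0) + / d * (INR #|T| * e) + 1.
have HdNe : 0 <= / d * (INR #|T| * e) by apply: Rmult_le_pos; [lra | apply: Rmult_le_pos; lra].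
have HM : 0 < M by rewrite /M; lra.
have HVM a j : (forall j, Rabs (a j - x0 j) <= e) -> Rabs (V a j) <= M.
  move=> Ha.
  have A := HV a x0 Ha ltac:(move=> i; rewrite Rminus_diag Rabs_R0; lra).
  have A1 : nrm (sub a x0) <= INR #|T| * e by exact: nrm_le_const.
  have A2 := Rmult_le_compat_l _ _ _ (Rlt_le _ _ HL) A1.
  have A3 := nrm_term (sub (V a) (V x0)) j; have A4 := nrm_term (V x0) j.
  have := Rabs_triang (V a j - V x0 j) (V x0 j).
  have -> : V a j - V x0 j + V x0 j = V a j by ring.
  change (Rabs (V a j - V x0 j) <= nrm (sub (V a) (V x0))) in A3.
  rewrite /M; lra.
(* The first bound keeps the iterates within [e] of [x0]; the second makes the contraction factor at
   most one half. *)
pose delta := Rmin (e / M) (/ (2 * ((INR #|T| + 1) * / d))).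
have HNd : 0 < (INR #|T| + 1) * / d by apply: Rmult_lt_0_compat; lra.
have Hdelta : 0 < delta.
  by apply: Rmin_pos; [exact: Rdiv_lt_0_compat | apply: Rinv_0_lt_compat; lra].
have HdM : delta * M <= e by apply/Rle_div_r => //; exact: Rmin_l.
have HdL : INR #|T| * delta * / d <= / 2.
  apply: (Rle_trans _ ((INR #|T| + 1) * / d * delta)).
    have : 0 <= delta * / d by apply: Rmult_le_pos; lra.
    lra.
  apply: (Rle_trans _ ((INR #|T| + 1) * / d * / (2 * ((INR #|T| + 1) * / d)))).
    by apply: Rmult_le_compat_l; [lra | exact: Rmin_r].
  by apply: Req_le; field; lra.
have [c [Hc0 Hc]] := picard_truncated He HL HM Hdelta HV HVM HdM HdL.
exists delta; split=> //; exists c; split=> // s Hs; have [Hb Hd'] := Hc s Hs.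
by split=> // j; have := Hb j; rewrite /e; lra.
Qed.

(** * Identities for Finsler functions *)

Lemma derivable_near (f g : R -> R) (t d l : R) : 0 < d ->
  (forall u, Rabs (u - t) < d -> f u = g u) -> derivable_pt_lim f t l -> derivable_pt_lim g t l.
Proof.
move=> Hd H; apply: (derivable_pt_lim_locally_ext _ _ _ (t - d) (t + d)); first lra.
by move=> z Hz; apply: H; apply: Rabs_def1; lra.
Qed.

Section Coordinates.
Variable n : nat.
Implicit Types (x y : vec n) (w : 'I_n + 'I_n -> R) (G : vec n -> vec n -> R).

Definition wl w : vec n := fun i => w (inl i).
Definition wr w : vec n := fun i => w (inr i).
(** A point of the tangent bundle becomes one vector over a sum type, so the calculus above applies
    to functions of [(x, y)] without a two-variable version. *)
Definition jn x y : 'I_n + 'I_n -> R := fun k => match k with inl i => x i | inr i => y i end.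
Definition flat G : ('I_n + 'I_n -> R) -> R := fun w => G (wl w) (wr w).
Definition dflat G w (k : 'I_n + 'I_n) : R :=
  match k with inl i => Dx i G (wl w) (wr w) | inr i => Dy i G (wl w) (wr w) end.

Lemma jn_eta w : jn (wl w) (wr w) = w.
Proof. by apply: functional_extensionality => -[]. Qed.

Lemma shift0 x i : shift x i 0 = x.
Proof. exact: upd0. Qed.

Lemma shift_box x i h d : Rabs h < d -> box x d (shift x i h).
Proof.
move=> Hh j; rewrite /shift; case: eqP => _; first by rewrite Rplus_minus_l.
by rewrite Rminus_diag Rabs_R0; have := Rabs_pos h; lra.
Qed.

Lemma cts_flat W G x y : cont2 W G -> W x y -> cts (flat G) (jn x y).
Proof.
move=> H HW eps He; have [d [Hd Hc]] := H x y HW eps He.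
exists d; split=> // w Hw; apply: Hc => j.
by split; [exact: (Hw (inl j)) | exact: (Hw (inr j))].
Qed.

Lemma cdiff_flat W G x y r : 0 < r -> (forall w, box (jn x y) r w -> W (wl w) (wr w)) ->
  Ck2 1 W G -> cdiff (flat G) (dflat G) (jn x y).
Proof.
move=> Hr HW [_ HG].
have Hxy : W x y by exact: (HW _ (box_center (jn x y) Hr)).
apply: (cdiff_of_partials Hr).
  move=> w [i|i] /HW Hw; have [Hx [Hy _]] := HG i; rewrite /flat /=.
    exact: (Hx _ _ Hw).
  exact: (Hy _ _ Hw).
move=> [i|i]; have [_ [_ [[Hx _] [Hy _]]]] := HG i; [exact: (cts_flat Hx) | exact: (cts_flat Hy)].
Qed.

Lemma smooth2_Dx W G i : smooth2 W G -> smooth2 W (Dx i G).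
Proof. by move=> H k; have [_ /(_ i)[_ [_ []]]] := H k.+1. Qed.

Lemma smooth2_Dy W G i : smooth2 W G -> smooth2 W (Dy i G).
Proof. by move=> H k; have [_ /(_ i)[_ [_ []]]] := H k.+1. Qed.

Lemma smooth2_has_Dx W G i : smooth2 W G -> has_Dx W G i.
Proof. by move=> /(_ (S O))[_ /(_ i)[]]. Qed.

Lemma smooth2_has_Dy W G i : smooth2 W G -> has_Dy W G i.
Proof. by move=> /(_ (S O))[_ /(_ i)[_ []]]. Qed.

End Coordinates.

Section Finsler.
Variables (n : nat) (U : vec n -> Prop).
Hypothesis HU : open_set U.
Implicit Types (x y : vec n) (w : 'I_n + 'I_n -> R) (G : vec n -> vec n -> R).
Local Notation W := (TM0 U).

Lemma TM0_open x y : W x y ->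
  exists r, 0 < r /\ forall w, box (jn x y) r w -> W (wl w) (wr w).
Proof.
move=> [Hx [j Hj]]; have [d [Hd Hd']] := HU Hx.
have Hyj : 0 < Rabs (y j) by exact: Rabs_pos_lt.
exists (Rmin d (Rabs (y j))); split; first exact: Rmin_pos.
move=> w Hw; split.
  by apply: Hd' => k; have := Hw (inl k); have := Rmin_l d (Rabs (y j)); rewrite /wl /=; lra.
exists j => E; have := Hw (inr j); have := Rmin_r d (Rabs (y j)).
by rewrite /wr in E; rewrite E /= Rminus_0_l Rabs_Ropp; lra.
Qed.

Lemma TM0_shift x y i k : W x y -> exists r, 0 < r /\ forall a b, Rabs a < r -> Rabs b < r ->
  W (shift x k a) (shift y i b).
Proof.
move=> /TM0_open[r [Hr H]]; exists r; split=> // a b Ha Hb.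
by apply: (H (jn (shift x k a) (shift y i b))) => -[j|j]; apply: shift_box.
Qed.

Lemma cdiff_smooth G x y : smooth2 W G -> W x y -> cdiff (flat G) (dflat G) (jn x y).
Proof. by move=> HG /TM0_open[r [Hr H]]; exact: (cdiff_flat Hr H (HG (S O))). Qed.

Lemma lip_smooth G w : smooth2 W G -> W (wl w) (wr w) -> lip (flat G) w.
Proof. by move=> HG Hw; rewrite -(jn_eta w); exact: cdiff_lip (cdiff_smooth HG Hw). Qed.

Lemma chain_rule G (a b : R -> vec n) (da db : vec n) (t : R) : smooth2 W G -> W (a t) (b t) ->
  (forall j, derivable_pt_lim (fun u => a u j) t (da j)) ->
  (forall j, derivable_pt_lim (fun u => b u j) t (db j)) ->
  derivable_pt_lim (fun u => G (a u) (b u)) t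
    (\sum_k (Dx k G (a t) (b t) * da k) + \sum_k (Dy k G (a t) (b t) * db k)).
Proof.
move=> HG Ht Ha Hb.
have := cdiff_partial (c := fun u => jn (a u) (b u)) (v := jn da db) (t := t) (erefl _)
  (cdiff_smooth HG Ht).
rewrite big_sumType /=; apply.
by case=> j /=.
Qed.

Lemma derivable_zero (f : R -> R) (d l : R) : 0 < d -> (forall h, Rabs h < d -> f h = 0) ->
  derivable_pt_lim f 0 l -> l = 0.
Proof.
move=> Hd H Hl; apply: (uniqueness_limite f 0) => //.
apply: (derivable_near (f := fun _ => 0) Hd); last exact: derivable_pt_lim_const.
by move=> u Hu; rewrite H // -(Rminus_0_r u).
Qed.

Lemma derivable_proj_shift y s k :
  derivable_pt_lim (fun h => shift y s h k) 0 (if k == s then 1 else 0).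
Proof.
rewrite /shift; case: eqP => _; last exact: derivable_pt_lim_const.
rewrite -[1]Rplus_0_l; apply: derivable_pt_lim_plus; first exact: derivable_pt_lim_const.
exact: derivable_pt_lim_id.
Qed.

Lemma contraction_Dx (G : 'I_n -> vec n -> vec n -> R) (s : 'I_n) x y :
  (forall k, smooth2 W (G k)) -> (forall x y, W x y -> \sum_k G k x y * y k = 0) ->
  W x y -> \sum_k Dx s (G k) x y * y k = 0.
Proof.
move=> HG H Hxy; have [r [Hr Hsh]] := TM0_shift s s Hxy.
apply: (derivable_zero (f := fun h => \sum_k G k (shift x s h) y * y k) Hr).
  move=> h Hh; apply: H; rewrite -(shift0 y s); apply: Hsh => //.
  by rewrite Rabs_R0; lra.
apply: derivable_sum => k.
apply: (derivable_pt_lim_ext (fun h => y k * G k (shift x s h) y)); first by move=> h; ring.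
by rewrite Rmult_comm; apply: derivable_pt_lim_scal; exact: (smooth2_has_Dx s (HG k)).
Qed.

(** Differentiating the contraction in direction [y^s] also hits the factor [y^s], which leaves the
    term [G s] on the other side. *)
Lemma contraction_Dy (G : 'I_n -> vec n -> vec n -> R) (s : 'I_n) x y :
  (forall k, smooth2 W (G k)) -> (forall x y, W x y -> \sum_k G k x y * y k = 0) ->
  W x y -> \sum_k Dy s (G k) x y * y k = - G s x y.
Proof.
move=> HG H Hxy; have [r [Hr Hsh]] := TM0_shift s s Hxy.
suff : \sum_k (Dy s (G k) x y * y k + G k x y * (if k == s then 1 else 0)) = 0.
  have -> : \sum_k (Dy s (G k) x y * y k + G k x y * (if k == s then 1 else 0)) =
      \sum_k Dy s (G k) x y * y k + G s x y; last lra.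
  rewrite sumD; congr (_ + _).
  rewrite (bigD1 s) //= eqxx big1 => [|k /negbTE->]; ring.
apply: (derivable_zero (f := fun h => \sum_k G k x (shift y s h) * shift y s h k) Hr).
  move=> h Hh; apply: H; rewrite -(shift0 x s); apply: Hsh => //.
  by rewrite Rabs_R0; lra.
apply: derivable_sum => k.
have := derivable_pt_lim_mult _ _ _ _ _ (smooth2_has_Dy s (HG k) Hxy) (derivable_proj_shift y s k).
by rewrite shift0.
Qed.

(** Schwarz's theorem on the two-parameter slice through [(x, y)]. The displayed expression contains
    [Dy i (Dx s F)], while differentiating the Euler-Lagrange expression produces
    [Dx s (Dy i F)]. *)
Lemma mixed_partials G x y k i : smooth2 W G -> W x y -> Dx k (Dy i G) x y = Dy i (Dx k G) x y.
Proof.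
move=> HG Hxy; have [r [Hr Hsh]] := TM0_shift i k Hxy.
have HX := smooth2_Dx k HG; have HY := smooth2_Dy i HG.
have HXY := smooth2_Dx k HY; have HYX := smooth2_Dy i HX.
have dX (H : vec n -> vec n -> R) (a b : R) : smooth2 W H -> Rabs a < r -> Rabs b < r ->
    is_derive (fun z => H (shift x k z) (shift y i b)) a (Dx k H (shift x k a) (shift y i b)).
  move=> HH Ha Hb; apply/is_derive_Reals; apply: derivable_shift.
  apply: derivable_pt_lim_ext (smooth2_has_Dx k HH (Hsh a b Ha Hb)).
  by move=> h; rewrite -[shift (shift x k a) k h]/(upd (upd x k a) k h) updD.
have dY (H : vec n -> vec n -> R) (a b : R) : smooth2 W H -> Rabs a < r -> Rabs b < r ->
    is_derive (fun z => H (shift x k a) (shift y i z)) b (Dy i H (shift x k a) (shift y i b)).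
  move=> HH Ha Hb; apply/is_derive_Reals; apply: derivable_shift.
  apply: derivable_pt_lim_ext (smooth2_has_Dy i HH (Hsh a b Ha Hb)).
  by move=> h; rewrite -[shift (shift y i b) i h]/(upd (upd y i b) i h) updD.
pose f a b := G (shift x k a) (shift y i b).
have near a : Rabs a < r -> locally a (fun z => Rabs z < r).
  move=> Ha; have Hp : 0 < r - Rabs a by lra.
  exists (mkposreal _ Hp) => z; rewrite /ball /= /AbsRing_ball /abs /minus /plus /opp /= => Hz.
  have := Rabs_triang (z + - a) a; have -> : z + - a + a = z by ring.
  lra.
have dxy a b : Rabs a < r -> Rabs b < r ->
    is_derive (fun z => Derive (fun t => f z t) b) a (Dx k (Dy i G) (shift x k a) (shift y i b)).
  move=> Ha Hb; apply: is_derive_ext_loc (dX _ a b HY Ha Hb).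
  apply: filter_imp (near a Ha) => z Hz; apply: esym; apply: is_derive_unique; exact: dY.
have dyx a b : Rabs a < r -> Rabs b < r ->
    is_derive (fun z => Derive (fun t => f t z) a) b (Dy i (Dx k G) (shift x k a) (shift y i b)).
  move=> Ha Hb; apply: is_derive_ext_loc (dY _ a b HX Ha Hb).
  apply: filter_imp (near b Hb) => z Hz; apply: esym; apply: is_derive_unique; exact: dX.
have R0 : Rabs 0 < r by rewrite Rabs_R0.
have cts2 (H : vec n -> vec n -> R) (g : R -> R -> R) : smooth2 W H -> (forall a b, Rabs a < r -> Rabs b < r ->
    g a b = H (shift x k a) (shift y i b)) -> continuity_2d_pt g 0 0.
  move=> HH Hg eps.
  have [d [Hd Hc]] := lip_cts (lip_smooth (w := jn x y) HH Hxy) (cond_pos eps).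
  have Hm : 0 < Rmin r d by exact: Rmin_pos.
  exists (mkposreal _ Hm) => a b /=; rewrite !Rminus_0_r => Ha Hb.
  have L1 := Rmin_l r d; have L2 := Rmin_r r d.
  rewrite !Hg ?shift0; try lra.
  apply: (Hc (jn (shift x k a) (shift y i b))) => -[j|j]; apply: shift_box; lra.
have := Schwarz f 0 0.
rewrite (is_derive_unique _ _ _ (dxy 0 0 R0 R0)) (is_derive_unique _ _ _ (dyx 0 0 R0 R0)) !shift0.
apply.
- exists (mkposreal r Hr) => a b /=; rewrite !Rminus_0_r => Ha Hb.
  split; first by exists (Dx k G (shift x k a) (shift y i b)); exact: dX.
  split; first by exists (Dy i G (shift x k a) (shift y i b)); exact: dY.
  split; first by exists (Dx k (Dy i G) (shift x k a) (shift y i b)); exact: dxy.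
  by exists (Dy i (Dx k G) (shift x k a) (shift y i b)); exact: dyx.
- by apply: (cts2 _ _ HXY) => a b Ha Hb; apply: is_derive_unique; exact: dxy.
- by apply: (cts2 _ _ HYX) => a b Ha Hb; apply: is_derive_unique; exact: dyx.
Qed.

Variable F : vec n -> vec n -> R.
Hypothesis HF : Finsler U F.

Lemma F_smooth : smooth2 W F. Proof. by case: HF. Qed.

Lemma F_pos x y : W x y -> 0 < F x y.
Proof. by case: HF => _ [H _] [Hx Hy]; exact: H. Qed.

Lemma scal1 y : scal 1 y = y.
Proof. by apply: functional_extensionality => j; rewrite /scal Rmult_1_l. Qed.

Lemma scal_derivable y t j : derivable_pt_lim (fun u => scal u y j) t (y j).
Proof.
rewrite -[y j]Rmult_1_r; apply: (derivable_pt_lim_ext (fun u => y j * u)).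
  by move=> u; rewrite /scal Rmult_comm.
by apply: derivable_pt_lim_scal; exact: derivable_pt_lim_id.
Qed.

Lemma euler_derivable G x y : smooth2 W G -> W x y ->
  derivable_pt_lim (fun u => G x (scal u y)) 1 (\sum_k Dy k G x y * y k).
Proof.
move=> HG Hxy.
have := chain_rule (a := fun _ => x) (b := fun u => scal u y) (da := fun _ => 0) (db := y) (t := 1) HG.
rewrite scal1 => /(_ Hxy (fun j => derivable_pt_lim_const _ _) (scal_derivable y 1)).
by rewrite [X in X + _]big1 ?Rplus_0_l // => k _; rewrite Rmult_0_r.
Qed.

Lemma euler x y : W x y -> \sum_k Dy k F x y * y k = F x y.
Proof.
move=> Hxy; have [Hx _] := Hxy; apply: (uniqueness_limite _ _ _ _ (euler_derivable F_smooth Hxy)).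
apply: (derivable_near (f := fun u => F x y * u) Rlt_0_1).
  move=> u /Rabs_lt_between Hu; case: HF => _ [_ [Hh _]]; rewrite Hh //; last lra.
  by rewrite Rmult_comm.
rewrite -[X in derivable_pt_lim _ _ X]Rmult_1_r.
by apply: derivable_pt_lim_scal; exact: derivable_pt_lim_id.
Qed.

Lemma Dy_hom i x y l : W x y -> 0 < l -> Dy i F x (scal l y) = Dy i F x y.
Proof.
move=> Hxy Hl; have [Hx _] := Hxy; apply: Deriv_eq.
(* Shifting [scal l y] by [h] is scaling by [l] the shift of [y] by [/ l * h]. *)
apply: (derivable_pt_lim_ext (fun h => l * F x (shift y i (/ l * h)))).
  move=> h; case: HF => _ [_ [Hh _]]; rewrite -Hh //; congr (F x _).
  apply: functional_extensionality => j; rewrite /scal /shift; case: eqP => _ //; field; lra.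
have -> : Dy i F x y = l * (Dy i F x y * / l) by field; lra.
apply: derivable_pt_lim_scal.
apply: (derivable_pt_lim_comp (fun h => / l * h) (fun h => F x (shift y i h))).
  rewrite -[X in derivable_pt_lim _ _ X]Rmult_1_r.
  by apply: derivable_pt_lim_scal; exact: derivable_pt_lim_id.
by rewrite Rmult_0_r; exact: (smooth2_has_Dy i F_smooth).
Qed.

(** [Dy i F] is homogeneous of degree zero, hence constant along the ray through [y]. This is the
    degeneracy that leaves accelerations undetermined along the velocity. *)
Lemma hessian_y i x y : W x y -> \sum_k Dy k (Dy i F) x y * y k = 0.
Proof.
move=> Hxy; apply: (uniqueness_limite _ _ _ _ (euler_derivable (smooth2_Dy i F_smooth) Hxy)).
apply: (derivable_near (f := fun _ => Dy i F x y) Rlt_0_1); last exact: derivable_pt_lim_const.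
by move=> u /Rabs_lt_between Hu; rewrite Dy_hom //; lra.
Qed.

Lemma Dx_hessian_y s i x y : W x y -> \sum_k Dx s (Dy k (Dy i F)) x y * y k = 0.
Proof.
apply: (contraction_Dx (G := fun k => Dy k (Dy i F))); last by move=> *; exact: hessian_y.
by move=> k; do 2! apply: smooth2_Dy; exact: F_smooth.
Qed.

Lemma Dy_hessian_y s i x y : W x y ->
  \sum_k Dy s (Dy k (Dy i F)) x y * y k = - Dy s (Dy i F) x y.
Proof.
apply: (contraction_Dy (G := fun k => Dy k (Dy i F))); last by move=> *; exact: hessian_y.
by move=> k; do 2! apply: smooth2_Dy; exact: F_smooth.
Qed.

(** The fundamental tensor: half the [y]-Hessian of [F ^ 2], written out so that only derivatives of
    [F] occur. *)
Definition metric x y (i k : 'I_n) : R := F x y * Dy k (Dy i F) x y + Dy i F x y * Dy k F x y.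

Lemma Dy_sqr j x y : W x y -> Dy j (fun x' y' => F x' y' ^ 2) x y = 2 * (F x y * Dy j F x y).
Proof.
move=> Hxy; apply: Deriv_eq.
have H := smooth2_has_Dy j F_smooth Hxy.
have := derivable_pt_lim_mult _ _ _ _ _ H H; rewrite shift0.
have -> : Dy j F x y * F x y + F x y * Dy j F x y = 2 * (F x y * Dy j F x y) by ring.
by apply: derivable_pt_lim_ext => h; rewrite /mult_fct /=; ring.
Qed.

Lemma metric_posdef x y xi : W x y -> nonzero xi ->
  0 < \sum_i \sum_k metric x y i k * xi k * xi i.
Proof.
move=> Hxy Hxi; case: HF => _ [_ [_ Hpos]].
have [Hx Hy] := Hxy.
have {Hpos} := Hpos x y xi Hx Hy Hxi; rewrite /sumI exchange_big /=.
suff -> : \sum_j \sum_i (Dy i (Dy j (fun x' y' => F x' y' ^ 2)) x y * xi i * xi j)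
    = 2 * \sum_i \sum_k metric x y i k * xi k * xi i.
  by move=> H; apply: (Rmult_lt_reg_l 2); [lra | rewrite Rmult_0_r; exact: H].
rewrite -sumZ; apply: eq_bigr => j _; rewrite -sumZ; apply: eq_bigr => i _.
suff -> : Dy i (Dy j (fun x' y' => F x' y' ^ 2)) x y = 2 * metric x y j i by ring.
apply: Deriv_eq.
have [r [Hr Hsh]] := TM0_shift i i Hxy.
apply: (derivable_near (f := fun h => 2 * (F x (shift y i h) * Dy j F x (shift y i h))) Hr).
  move=> h; rewrite Rminus_0_r => Hh; rewrite Dy_sqr //.
  by rewrite -(shift0 x i); apply: Hsh => //; rewrite Rabs_R0.
apply: derivable_pt_lim_scal.
have := derivable_pt_lim_mult _ _ _ _ _ (smooth2_has_Dy i F_smooth Hxy)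
  (smooth2_has_Dy i (smooth2_Dy j F_smooth) Hxy).
by rewrite shift0 /metric Rplus_comm [_ * Dy j F _ _]Rmult_comm.
Qed.

End Finsler.

(** * Existence of geodesics *)

(** Turns the definiteness of the metric into an explicit inverse, from which a quantitative lower
    bound can be read off. *)
Lemma injective_left_inverse (n : nat) (A : 'I_n -> 'I_n -> R) :
  (forall xi : vec n, (forall i, \sum_k A i k * xi k = 0) -> forall k, xi k = 0) ->
  exists B : 'I_n -> 'I_n -> R, forall (xi : vec n) k, xi k = \sum_i B k i * \sum_j A i j * xi j.
Proof.
move=> H.
(* [M] is the transpose of [A], because row vectors are multiplied from the left. *)
pose M : 'M[R]_n := matrix_of_fun matrix_key (fun k i => A i k).
have EM (v : 'rV[R]_n) i : mulmx v M ord0 i = \sum_k A i k * v ord0 k.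
  by rewrite mxE; apply: eq_bigr => k _; rewrite mxE; exact: Rmult_comm.
have HM : M \in unitmx.
  rewrite -row_free_unit; apply: inj_row_free => v Hv.
  apply/rowP => k; rewrite [RHS]mxE; apply: (H (fun k => v ord0 k)) => i.
  by rewrite -EM Hv mxE.
exists (fun k i => invmx M i k) => xi k.
pose v : 'rV[R]_n := matrix_of_fun matrix_key (fun _ k => xi k).
have Ev i : v ord0 i = xi i by rewrite mxE.
rewrite -{1}Ev -(mulmxK HM v) mxE; apply: eq_bigr => i _.
rewrite EM; under eq_bigr => j _ do rewrite Ev.
exact: Rmult_comm.
Qed.

Section Spray.
Variables (n : nat) (U : vec n -> Prop).
Hypothesis HU : open_set U.
Variable F : vec n -> vec n -> R.
Hypothesis HF : Finsler U F.
Variable C : vec n -> vec n -> vec n.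
Local Notation W := (TM0 U).
Hypothesis HC : forall x y, W x y -> forall i,
  \sum_k Dy k (Dy i F) x y * C x y k = Dx i F x y - \sum_k Dx k (Dy i F) x y * y k.
Implicit Types (x y : vec n) (w p : 'I_n + 'I_n -> R).

Let sF := F_smooth HF.
Let sFx i : smooth2 W (Dx i F) := smooth2_Dx i sF.
Let sFy i : smooth2 W (Dy i F) := smooth2_Dy i sF.

Lemma lip_metric w i k : W (wl w) (wr w) -> lip (fun p => metric F (wl p) (wr p) i k) w.
Proof.
move=> Hw; apply: lip_add; apply: lip_mul.
- exact: (lip_smooth HU sF Hw).
- exact: (lip_smooth HU (smooth2_Dy k (sFy i)) Hw).
- exact: (lip_smooth HU (sFy i) Hw).
- exact: (lip_smooth HU (sFy k) Hw).
Qed.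

(** The inverse at [w] gives a bound there; a perturbation of the entries small against that inverse
    loses at most half of it. *)
Lemma metric_lower_bound w : W (wl w) (wr w) -> exists d c, 0 < d /\ 0 < c /\
  forall p, box w d p -> forall xi : vec n,
    c * nrm xi <= nrm (fun i => \sum_k metric F (wl p) (wr p) i k * xi k).
Proof.
move=> Hw.
pose g p (xi : vec n) : vec n := fun i => \sum_k metric F (wl p) (wr p) i k * xi k.
have [|B HB] := @injective_left_inverse n (metric F (wl w) (wr w)).
  move=> xi Hxi k; apply: NNPP => Hk.
  have := metric_posdef HU HF Hw (ex_intro _ k Hk); rewrite big1; first by lra.
  by move=> i _; rewrite sumZr Hxi Rmult_0_l.
pose H := \sum_k \sum_i Rabs (B k i) + 1.
have HH : 0 < H.
  suff : 0 <= \sum_k \sum_i Rabs (B k i) by rewrite /H; lra.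
  by apply: sum_ge0 => k; apply: sum_ge0 => i; exact: Rabs_pos.
have HN := pos_INR #|'I_n|; set N := INR #|'I_n| in HN.
have inv xi : nrm xi <= H * nrm (g w xi).
  apply: (Rle_trans _ (\sum_k (\sum_i Rabs (B k i)) * nrm (g w xi))).
    by apply: sum_le => k; rewrite (HB xi k); exact: sum_mul_le.
  rewrite sumZr; apply: Rmult_le_compat_r; [exact: nrm_ge0 | rewrite /H; lra].
(* With entries off by less than [e], the perturbation contributes at most [nrm xi / 2] after
   multiplication by [H], which leaves the constant [/ (2 * H)]. *)
pose e := / (2 * H * (N + 1)).
have HHN : 0 < 2 * H * (N + 1) by apply: Rmult_lt_0_compat; lra.
have He : 0 < e by exact: Rinv_0_lt_compat.
have Ee : 2 * H * (N + 1) * e = 1 by rewrite /e; field; lra.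
have [d [Hd Hdd]] : exists d, 0 < d /\ forall (ik : 'I_n * 'I_n) p, box w d p ->
    Rabs (metric F (wl p) (wr p) ik.1 ik.2 - metric F (wl w) (wr w) ik.1 ik.2) < e.
  apply: (fin_radius (P := fun (ik : 'I_n * 'I_n) d => forall p, box w d p ->
    Rabs (metric F (wl p) (wr p) ik.1 ik.2 - metric F (wl w) (wr w) ik.1 ik.2) < e)).
    by move=> ik d d' G [_ Hdd] p Hp; apply: G; exact: box_le Hp.
  by move=> [i k]; exact: (lip_cts (lip_metric i k Hw) He).
exists d, (/ (2 * H)); split=> //; split; first by apply: Rinv_0_lt_compat; lra.
move=> p Hp xi; rewrite -/(g p xi).
have diff : nrm (sub (g w xi) (g p xi)) <= N * (e * nrm xi).
  apply: nrm_le_const => i; rewrite /sub /g -sumB.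
  apply: Rle_trans (sum_abs _) _; rewrite /nrm -sumZ; apply: sum_le => k.
  rewrite -Rmult_minus_distr_r Rabs_mult; apply: Rmult_le_compat_r; first exact: Rabs_pos.
  by rewrite Rabs_minus_sym; apply: Rlt_le; exact: (Hdd (i, k)).
have tri : nrm (g w xi) <= nrm (sub (g w xi) (g p xi)) + nrm (g p xi).
  apply: Rle_trans (nrmD _ _); apply: Req_le; apply: eq_bigr => i _; congr Rabs.
  by rewrite /sub; ring.
have Hi := inv xi; have Hx := nrm_ge0 xi.
move: (nrm xi) (nrm (g w xi)) (nrm (g p xi)) (nrm (sub (g w xi) (g p xi))) Hi Hx diff tri.
move=> a b c0 d0 Hi Hx diff tri.
have A : H * b <= H * (N * (e * a) + c0) by apply: Rmult_le_compat_l; lra.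
have A1 : 0 <= H * e * a by apply: Rmult_le_pos => //; apply: Rmult_le_pos; lra.
have A2 : H * (N * (e * a)) <= a / 2.
  have -> : a / 2 = a * (2 * H * (N + 1) * e) / 2 by rewrite Ee; field.
  lra.
have A3 : a <= 2 * H * c0 by lra.
apply: (Rmult_le_reg_l (2 * H)); first lra.
by have -> : 2 * H * (/ (2 * H) * a) = a by field; lra.
Qed.

(** A multiple of [y] may be subtracted from [C] because the Hessian of [F] annihilates [y]. By
    Euler's identity this multiple makes [F] constant along the integral curves, as a geodesic
    requires. *)
Definition spray x y : vec n := fun k =>
  C x y k - (\sum_j Dx j F x y * y j + \sum_j Dy j F x y * C x y j) / F x y * y k.

Lemma spray_hessian i x y : W x y ->
  \sum_k Dy k (Dy i F) x y * spray x y k = Dx i F x y - \sum_k Dx k (Dy i F) x y * y k.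
Proof.
move=> Hxy; rewrite -HC // /spray; set a := _ / _.
have -> : \sum_k Dy k (Dy i F) x y * (C x y k - a * y k) =
    \sum_k Dy k (Dy i F) x y * C x y k - a * \sum_k Dy k (Dy i F) x y * y k.
  by rewrite -sumZ -sumB; apply: eq_bigr => k _; ring.
by rewrite (hessian_y HU HF) //; ring.
Qed.

Lemma spray_speed x y : W x y ->
  \sum_k Dx k F x y * y k + \sum_k Dy k F x y * spray x y k = 0.
Proof.
move=> Hxy; rewrite /spray; set a := _ / _.
have -> : \sum_k Dy k F x y * (C x y k - a * y k) =
    \sum_k Dy k F x y * C x y k - a * \sum_k Dy k F x y * y k.
  by rewrite -sumZ -sumB; apply: eq_bigr => k _; ring.
have := F_pos HF Hxy; rewrite (euler HU HF) // /a => HFp; field; lra.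
Qed.

(** The Hessian equation and the constancy of [F], combined in the proportions in which the two
    terms of [metric] occur. No [C] remains, so the right side is as regular as the derivatives of
    [F]. *)
Definition spray_rhs x y : vec n := fun i =>
  F x y * (Dx i F x y - \sum_k Dx k (Dy i F) x y * y k) - Dy i F x y * \sum_k Dx k F x y * y k.

Lemma spray_metric x y i : W x y -> \sum_k metric F x y i k * spray x y k = spray_rhs x y i.
Proof.
move=> Hxy; rewrite /spray_rhs -spray_hessian //.
have E := Rplus_opp_r_uniq _ _ (spray_speed Hxy).
have -> : \sum_k metric F x y i k * spray x y k =
   F x y * \sum_k Dy k (Dy i F) x y * spray x y k + Dy i F x y * \sum_k Dy k F x y * spray x y k.
  by rewrite -!sumZ -sumD; apply: eq_bigr => k _; rewrite /metric; ring.
by rewrite E; ring.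
Qed.

Lemma lip_spray_rhs w i : W (wl w) (wr w) -> lip (fun p => spray_rhs (wl p) (wr p) i) w.
Proof.
move=> Hw; apply: lip_sub; apply: lip_mul.
- exact: (lip_smooth HU sF Hw).
- apply: lip_sub; first exact: (lip_smooth HU (sFx i) Hw).
  apply: lip_sum => k; apply: lip_mul; last exact: (lip_proj (inr k)).
  exact: (lip_smooth HU (smooth2_Dx k (sFy i)) Hw).
- exact: (lip_smooth HU (sFy i) Hw).
- apply: lip_sum => k; apply: lip_mul; last exact: (lip_proj (inr k)).
  exact: (lip_smooth HU (sFx k) Hw).
Qed.

(* [C] itself need not even be continuous; its normalisation [spray] solves a linear system
   whose matrix is positive definite and whose coefficients are locally Lipschitz. *)
Lemma lip_spray w j : W (wl w) (wr w) -> lip (fun p => spray (wl p) (wr p) j) w.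
Proof.
move=> Hw.
have [d1 [c [Hd1 [Hc H1]]]] := metric_lower_bound Hw.
have [d2 [K2 [Hd2 [HK2 H2]]]] := lip_fin (f := fun (ik : 'I_n * 'I_n) p => metric F (wl p) (wr p) ik.1 ik.2)
  (x := w) (fun ik => lip_metric ik.1 ik.2 Hw).
have [d3 [K3 [Hd3 [HK3 H3]]]] := lip_fin (fun i => lip_spray_rhs i Hw).
have [d4 [Hd4 H4]] := TM0_open HU Hw; rewrite jn_eta in H4.
have [d5 [Hd5 H5]] : exists d, 0 < d /\ forall i p, box w d p ->
    Rabs (spray_rhs (wl p) (wr p) i) <= Rabs (spray_rhs (wl w) (wr w) i) + 1.
  apply: (fin_radius (P := fun i d => forall p, box w d p ->
    Rabs (spray_rhs (wl p) (wr p) i) <= Rabs (spray_rhs (wl w) (wr w) i) + 1)).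
    by move=> i d d' G [_ Hdd] p Hp; apply: G; exact: box_le Hp.
  by move=> i; exact: (cts_bound (lip_cts (lip_spray_rhs i Hw))).
pose b := \sum_i (Rabs (spray_rhs (wl w) (wr w) i) + 1).
have Hb : 0 <= b by apply: sum_ge0 => i; have := Rabs_pos (spray_rhs (wl w) (wr w) i); lra.
have [d [Hd [L1 [L2 [L3 [L4 L5]]]]]] :
    exists d, 0 < d /\ d <= d1 /\ d <= d2 /\ d <= d3 /\ d <= d4 /\ d <= d5.
  exists (Rmin (Rmin d1 d2) (Rmin d3 (Rmin d4 d5))).
  have := Rmin_l (Rmin d1 d2) (Rmin d3 (Rmin d4 d5)).
  have := Rmin_r (Rmin d1 d2) (Rmin d3 (Rmin d4 d5)).
  have := Rmin_l d1 d2; have := Rmin_r d1 d2; have := Rmin_l d3 (Rmin d4 d5).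
  have := Rmin_r d3 (Rmin d4 d5); have := Rmin_l d4 d5; have := Rmin_r d4 d5.
  split; first by do !apply: Rmin_pos.
  by do !split; lra.
have HN := pos_INR #|'I_n|; set N := INR #|'I_n| in HN.
exists d, (/ c * (N * K3 + N * (K2 * (/ c * b))) + 1).
have Hic : 0 < / c by exact: Rinv_0_lt_compat.
have Hcb : 0 <= / c * b by apply: Rmult_le_pos; lra.
have HKK : 0 <= / c * (N * K3 + N * (K2 * (/ c * b))).
  apply: Rmult_le_pos; first lra.
  have := Rmult_le_pos N K3 HN (Rlt_le _ _ HK3).
  by have := Rmult_le_pos N _ HN (Rmult_le_pos _ _ (Rlt_le _ _ HK2) Hcb); lra.
split=> //; split; first lra.
move=> p q Hp Hq.
have Wp := H4 p (box_le L4 Hp); have Wq := H4 q (box_le L4 Hq).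
pose g u (xi : vec n) : vec n := fun i => \sum_k metric F (wl u) (wr u) i k * xi k.
pose Z u := spray (wl u) (wr u).
have EZ u : W (wl u) (wr u) -> g u (Z u) = spray_rhs (wl u) (wr u).
  by move=> Wu; apply: functional_extensionality => i; exact: spray_metric.
have HZq : nrm (Z q) <= / c * b.
  apply: (Rmult_le_reg_l c) => //; have -> : c * (/ c * b) = b by field; lra.
  apply: Rle_trans (H1 q (box_le L1 Hq) (Z q)) _; rewrite -/(g q (Z q)) EZ //.
  by apply: sum_le => i; apply: H5; exact: box_le Hq.
have En := nrm_ge0 (sub p q).
(* Applying the metric at [p] to the difference leaves the variation of the right side plus that of
   the metric acting on [Z q], which is already bounded. *)
have diff : c * nrm (sub (Z p) (Z q)) <= (N * K3 + N * (K2 * (/ c * b))) * nrm (sub p q).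
  apply: Rle_trans (H1 p (box_le L1 Hp) _) _; rewrite -/(g p (sub (Z p) (Z q))).
  apply: (Rle_trans _ (nrm (sub (spray_rhs (wl p) (wr p)) (spray_rhs (wl q) (wr q))) +
     nrm (sub (g q (Z q)) (g p (Z q))))).
    apply: Rle_trans (nrmD _ _); apply: Req_le; apply: eq_bigr => i _; congr Rabs.
    rewrite -!EZ // /sub.
    have -> : g p (fun j => Z p j - Z q j) i = g p (Z p) i - g p (Z q) i.
      by rewrite /g -sumB; apply: eq_bigr => k _; ring.
    by ring.
  rewrite Rmult_plus_distr_r; apply: Rplus_le_compat.
    rewrite Rmult_assoc; apply: nrm_le_const => i.
    exact: (H3 i p q (box_le L3 Hp) (box_le L3 Hq)).
  rewrite Rmult_assoc; apply: nrm_le_const => i; rewrite /sub /g -sumB.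
  apply: Rle_trans (sum_abs _) _.
  apply: (Rle_trans _ (\sum_k (K2 * nrm (sub p q) * Rabs (Z q k)))).
    apply: sum_le => k; rewrite -Rmult_minus_distr_r Rabs_mult.
    apply: Rmult_le_compat_r; first exact: Rabs_pos.
    rewrite Rabs_minus_sym.
    exact: (H2 (i, k) p q (box_le L2 Hp) (box_le L2 Hq)).
  rewrite sumZ -/(nrm (Z q)).
  apply: Rle_trans (Rmult_le_compat_l (K2 * nrm (sub p q)) _ _ (Rmult_le_pos _ _ (Rlt_le _ _ HK2) En) HZq) _.
  apply: Req_le; rewrite [LHS]Rmult_assoc [RHS]Rmult_assoc; congr (_ * _); exact: Rmult_comm.
apply: Rle_trans (nrm_term (sub (Z p) (Z q)) j) _.
apply: (Rle_trans _ (/ c * ((N * K3 + N * (K2 * (/ c * b))) * nrm (sub p q)))); last lra.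
apply: (Rmult_le_reg_l c) => //.
set S := _ * nrm (sub p q) in diff *.
by have -> : c * (/ c * S) = S by field; lra.
Qed.

Lemma geodesic_exists x y : W x y -> exists (I : R -> Prop) (g : R -> vec n),
  geodesic U F I g /\ I 0 /\ g 0 = x /\ vel g 0 = y /\
  (forall j, Deriv (fun t => vel g t j) 0 = spray x y j).
Proof.
move=> Hxy; have [r [Hr Hbox]] := TM0_open HU Hxy.
pose V (w : 'I_n + 'I_n -> R) (k : 'I_n + 'I_n) : R :=
  match k with inl i => wr w i | inr i => spray (wl w) (wr w) i end.
have HV k : lip (fun p => V p k) (jn x y).
  by case: k => i; [exact: (lip_proj (inr i)) | exact: (lip_spray (w := jn x y) i Hxy)].
have [delta [Hdelta [c [Hc0 Hc]]]] := picard Hr HV.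
pose I t := Rabs t < delta.
pose g t : vec n := wl (c t).
have HW t : I t -> W (wl (c t)) (wr (c t)) by move=> /Hc[/Hbox].
have Hgd t : I t -> forall j, derivable_pt_lim (fun u => g u j) t (wr (c t) j).
  by move=> /Hc[_ H] j; exact: (H (inl j)).
have Hvel t : I t -> vel g t = wr (c t).
  by move=> Ht; apply: functional_extensionality => j; apply: Deriv_eq; exact: Hgd.
have near t : I t -> exists d, 0 < d /\ forall u, Rabs (u - t) < d -> I u.
  rewrite /I => Ht; exists (delta - Rabs t); split; first lra.
  move=> u Hu; have := Rabs_triang (u - t) t.
  have -> : u - t + t = u by ring.
  lra.
(* [vel g] is known to be [wr (c u)] only inside [I], so derivatives are transferred through local
   equality. *)
have Hvd t : I t -> forall j, derivable_pt_lim (fun u => vel g u j) t (spray (wl (c t)) (wr (c t)) j).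
  move=> Ht j; have [d [Hd Hn]] := near t Ht.
  apply: (derivable_near (f := fun u => wr (c u) j) Hd); first by move=> u /Hn Hu; rewrite Hvel.
  by have [_ H] := Hc t Ht; exact: (H (inr j)).
have Hacc t : I t -> forall j, Deriv (fun u => vel g u j) t = spray (wl (c t)) (wr (c t)) j.
  by move=> Ht j; exact: Deriv_eq (Hvd t Ht j).
have I0 : I 0 by rewrite /I Rabs_R0.
exists I, g; split; last first.
  by rewrite Hvel // /g Hc0; split=> //; split=> //; split=> // j; rewrite Hacc // Hc0.
have HI : open_interval I.
  split; first by exists 0.
  split=> // a b t /Rabs_lt_between Ha /Rabs_lt_between Hb Ht.
  by apply/Rabs_lt_between; lra.
have HF' t : I t -> derivable_pt_lim (fun u => F (g u) (wr (c u))) t 0.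
  move=> Ht; rewrite -(spray_speed (HW t Ht)).
  apply: (chain_rule HU (a := g) (b := fun u => wr (c u)) sF (HW t Ht) (Hgd t Ht)) => j.
  by have [_ H] := Hc t Ht; exact: (H (inr j)).
split.
  split=> //; split; first by move=> t /HW[].
  split.
    move=> j; split; first by move=> t Ht; rewrite Hvel //; exact: Hgd.
    split; first by move=> t Ht; rewrite Hacc //; exact: Hvd.
    move=> t Ht; have [d [Hd Hn]] := near t Ht.
    have Hcont : continuity_pt (fun u => spray (wl (c u)) (wr (c u)) j) t.
      apply: (cts_comp (f := fun p => spray (wl p) (wr p) j)).
        exact: lip_cts (lip_spray j (HW t Ht)).
      by move=> k; have [_ H] := Hc t Ht; exact: derivable_continuity_pt (H k).
    move=> eps He; have [e [He' G]] := Hcont eps He.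
    exists (Rmin d e); split; first exact: Rmin_pos.
    move=> u [Hu1 Hu2]; have Hu : R_dist u t < Rmin d e := Hu2.
    rewrite !Hacc //; first by apply: G; split=> //; apply: Rlt_le_trans Hu2 _; exact: Rmin_r.
    by apply: Hn; apply: Rlt_le_trans Hu _; exact: Rmin_l.
  split; first by move=> t Ht; rewrite Hvel //; have [] := HW t Ht.
  move=> i t Ht; rewrite Hvel //; have [d [Hd Hn]] := near t Ht.
  apply: (derivable_near (f := fun u => Dy i F (g u) (wr (c u))) Hd).
    by move=> u /Hn Hu; rewrite Hvel.
  have := chain_rule HU (a := g) (b := fun u => wr (c u)) (db := spray (wl (c t)) (wr (c t)))
    (sFy i) (HW t Ht) (Hgd t Ht).
  rewrite spray_hessian ?Rplus_minus; last exact: HW.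
  by apply=> j; have [_ H] := Hc t Ht; exact: (H (inr j)).
exists (F x y); split; first exact: (F_pos HF Hxy).
move=> t Ht; rewrite Hvel //.
pose h u := F (g u) (wr (c u)).
have Hbv : Rabs (h t - h 0) <= 0 * Rabs (t - 0).
  apply: (bounded_variation h (fun _ => 0)) => u; rewrite !Rminus_0_r => Hu.
  rewrite Rabs_R0; split; last lra.
  by apply/is_derive_Reals; apply: HF'; apply: Rle_lt_trans Hu Ht.
have H0 : h 0 = F x y by rewrite /h /g Hc0.
have : h t - h 0 = 0 by apply: NNPP => /Rabs_pos_lt; lra.
by rewrite H0 /h; lra.
Qed.
End Spray.

(** * Prolongation of the flow *)

Lemma cts_reindex (S T : finType) (h : S -> T) (f : (S -> R) -> R) (x : T -> R) :
  cts f (fun i => x (h i)) -> cts (fun w => f (fun i => w (h i))) x.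
Proof.
move=> H eps He; have [d [Hd G]] := H eps He; exists d; split=> // p Hp.
by apply: G => i; exact: Hp.
Qed.

Lemma lip_reindex (S T : finType) (h : S -> T) (f : (S -> R) -> R) (x : T -> R) :
  lip f (fun i => x (h i)) -> lip (fun w => f (fun i => w (h i))) x.
Proof.
move=> [d [K [Hd [HK G]]]]; have HN := pos_INR #|S|.
exists d, (K * (INR #|S| + 1)); split=> //; split; first by apply: Rmult_lt_0_compat; lra.
move=> a c Ha Hc.
apply: Rle_trans (G (fun i => a (h i)) (fun i => c (h i)) _ _) _.
- by move=> i; exact: Ha.
- by move=> i; exact: Hc.
rewrite Rmult_assoc; apply: Rmult_le_compat_l; first lra.
apply: (Rle_trans _ (INR #|S| * nrm (sub a c))).
  by apply: nrm_le_const => i; exact: (nrm_term (sub a c) (h i)).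
by have := nrm_ge0 (sub a c); lra.
Qed.

Definition acc (n : nat) (g : R -> vec n) (t : R) : vec n := fun j => Deriv (fun u => vel g u j) t.

Section Field.
Variables (n : nat) (U : vec n -> Prop) (X : vec n -> vec n).
Hypothesis HU : open_set U.
Hypothesis HX : smooth_field U X.
Implicit Types (x y : vec n) (w : 'I_n + 'I_n -> R).

Lemma smooth1_pd f i : smooth1 U f -> smooth1 U (pd f i).
Proof. by move=> H k; have [_ /(_ i)[]] := H (S k). Qed.

Lemma smooth1_has_pd f i : smooth1 U f -> has_pd U f i.
Proof. by move=> /(_ (S O))[_ /(_ i)[]]. Qed.

Lemma smooth1_cts f x : smooth1 U f -> U x -> cts f x.
Proof. by move=> /(_ O)[H _] Hx; exact: H. Qed.

Lemma smooth1_cdiff f x : smooth1 U f -> U x -> cdiff f (fun p k => pd f k p) x.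
Proof.
move=> Hf Hx; have [d [Hd Hd']] := HU Hx; apply: (cdiff_of_partials Hd).
  by move=> p i /Hd' Hp; exact: (smooth1_has_pd i Hf Hp).
by move=> i; exact: (smooth1_cts (smooth1_pd i Hf) Hx).
Qed.

Lemma smooth1_lip f x : smooth1 U f -> U x -> lip f x.
Proof. by move=> Hf Hx; exact: cdiff_lip (smooth1_cdiff Hf Hx). Qed.

Lemma smooth_dX s r : smooth1 U (dX X s r).
Proof. exact: smooth1_pd (HX s). Qed.

Lemma smooth_ddX s m r : smooth1 U (ddX X s m r).
Proof. exact: smooth1_pd (smooth_dX s r). Qed.

(* The complete lift of [X] to the tangent bundle: its flow is the differential of the flow of [X]. *)
Definition lift_field w (k : 'I_n + 'I_n) : R :=
  match k with inl j => X (wl w) j | inr j => \sum_r dX X j r (wl w) * wr w r end.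

Definition lift_jac w (k l : 'I_n + 'I_n) : R :=
  match k, l with
  | inl j, inl m => dX X j m (wl w)
  | inl _, inr _ => 0
  | inr j, inl m => \sum_r ddX X j m r (wl w) * wr w r
  | inr j, inr m => dX X j m (wl w)
  end.

Lemma cdiff_lift w k : U (wl w) -> cdiff (fun p => lift_field p k) (fun p => lift_jac p k) w.
Proof.
move=> Hw; have [d [Hd Hd']] := HU Hw.
apply: (cdiff_of_partials Hd).
  move=> p l Hp; have {Hp} Hp : U (wl p) by apply: Hd' => j; exact: (Hp (inl j)).
  case: k l => [j|j] [m|m] /=.
  - exact: (smooth1_has_pd m (HX j) Hp).
  - exact: (derivable_pt_lim_const (X (wl p) j)).
  - apply: derivable_sum => r.
    apply: (derivable_pt_lim_ext (fun h => wr p r * dX X j r (shift (wl p) m h))).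
      by move=> h; rewrite Rmult_comm.
    by rewrite Rmult_comm; apply: derivable_pt_lim_scal; exact: (smooth1_has_pd m (smooth_dX j r) Hp).
  - have -> : dX X j m (wl p) = \sum_r dX X j r (wl p) * (if r == m then 1 else 0).
      by rewrite (bigD1 m) //= eqxx big1 => [|r /negbTE->]; ring.
    apply: derivable_sum => r.
    exact: (derivable_pt_lim_scal _ (dX X j r (wl p)) _ _ (derivable_proj_shift (wr p) m r)).
case: k => [j|j] [m|m] /=.
- by apply: (cts_reindex (h := inl)); exact: (smooth1_cts (smooth_dX j m)).
- exact: cts_const.
- apply: cts_sum => r; apply: cts_mul; last exact: (cts_proj (inr r)).
  by apply: (cts_reindex (h := inl)); exact: (smooth1_cts (smooth_ddX j m r)).
- by apply: (cts_reindex (h := inl)); exact: (smooth1_cts (smooth_dX j m)).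
Qed.

Variable phi : R -> vec n -> vec n.
Hypothesis Hphi : is_flow U X phi.
Variables (I : R -> Prop) (g : R -> vec n).
Hypothesis HI : open_interval I.
Hypothesis HgU : forall t, I t -> U (g t).
Hypothesis Hg : C2_on I g.

Local Notation gs s := (fun t => phi s (g t)).

Lemma I_near t : I t -> exists d, 0 < d /\ forall u, Rabs (u - t) < d -> I u.
Proof. by case: HI => _ [_]; apply. Qed.

Lemma flow_in s t : I t -> U (phi s (g t)).
Proof. by move=> /HgU /Hphi[_ [H _]]. Qed.

Lemma flow_id t : I t -> phi 0 (g t) = g t.
Proof. by move=> /HgU /Hphi[]. Qed.

Lemma flow_sol t : I t -> sol X (fun s => phi s (g t)).
Proof. by move=> /HgU /Hphi[_ [_ H]] s j; exact: H. Qed.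

(** [flow_derivable] for the flow lines through the points [g t]: differentiability of [phi] is
    obtained only along the curve, which is all that is used. *)
Lemma flow_vel t : I t -> vel (gs 0) t = vel g t /\ forall s j,
  derivable_pt_lim (fun u => phi s (g u) j) t (vel (gs s) t j) /\
  derivable_pt_lim (fun u => vel (gs u) t j) s (\sum_k dX X j k (phi s (g t)) * vel (gs s) t k).
Proof.
move=> Ht; have [d [Hd Hn]] := I_near Ht.
have [v [Hv0 Hv]] := @flow_derivable _ X (fun p j k => dX X j k p) (fun t s => phi s (g t)) t d (vel g t)
  Hd (fun u Hu => flow_sol (Hn u Hu))
  (fun u s j Hu => smooth1_cdiff (HX j) (flow_in s (Hn u Hu)))
  (fun j => derivable_near Hd (fun u Hu => f_equal (fun p => p j) (esym (flow_id (Hn u Hu)))) (proj1 (Hg j) t Ht)).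
have Ev s : v s = vel (gs s) t.
  by apply: functional_extensionality => j; have [H _] := Hv s j; rewrite /vel (Deriv_eq H).
split; first by rewrite -Ev.
move=> s j; rewrite -Ev; have [H1 H2] := Hv s j; split=> //.
by apply: derivable_pt_lim_ext H2 => u; rewrite Ev.
Qed.

(** The pair of transported point and velocity solves the complete lift, with initial value
    [(g, vel g)] differentiable in [t]; the parameter theorem applies a second time. *)
Lemma flow_acc t : I t -> acc (gs 0) t = acc g t /\ forall s j,
  derivable_pt_lim (fun u => vel (gs s) u j) t (acc (gs s) t j) /\
  derivable_pt_lim (fun u => acc (gs u) t j) s
    (\sum_m (\sum_r ddX X j m r (phi s (g t)) * vel (gs s) t r) * vel (gs s) t m +
     \sum_r dX X j r (phi s (g t)) * acc (gs s) t r).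
Proof.
move=> Ht; have [d [Hd Hn]] := I_near Ht.
pose w u s := jn (phi s (g u)) (vel (gs s) u).
have Hsol u : Rabs (u - t) < d -> sol lift_field (w u).
  move=> /Hn Hu s [j|j] /=; first exact: flow_sol.
  by have [_ H] := flow_vel Hu; have [_] := H s j.
have Hdiff u s k : Rabs (u - t) < d -> cdiff (fun p => lift_field p k) (fun p => lift_jac p k) (w u s).
  by move=> /Hn Hu; apply: cdiff_lift; exact: flow_in.
have Hv0 k : derivable_pt_lim (fun u => w u 0 k) t (jn (vel g t) (acc g t) k).
  case: k => j /=.
    apply: (derivable_near (f := fun u => g u j) Hd); first by move=> u /Hn Hu; rewrite flow_id.
    by have [H _] := Hg j; exact: H.
  apply: (derivable_near (f := fun u => vel g u j) Hd).
    by move=> u /Hn Hu; have [-> _] := flow_vel Hu.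
  by have [_ [H _]] := Hg j; exact: H.
have [v [Ev0 Hv]] := flow_derivable Hd Hsol Hdiff Hv0.
have Ev s : v s = jn (vel (gs s) t) (acc (gs s) t).
  by apply: functional_extensionality => k; have [H _] := Hv s k; rewrite -(Deriv_eq H); case: k {H}.
split.
  by apply: functional_extensionality => j; have := f_equal (fun p => p (inr j)) Ev0; rewrite Ev.
move=> s j; have [H1 H2] := Hv s (inr j); rewrite !Ev /= in H1 H2; split=> //.
rewrite big_sumType /= in H2.
by apply: derivable_pt_lim_ext H2 => u; rewrite Ev.
Qed.

(** The velocity solves a linear equation in [s], so if it vanished at one flow time it would vanish
    at time zero. *)
Lemma flow_vel_nonzero s t : I t -> nonzero (vel g t) -> nonzero (vel (gs s) t).
Proof.
move=> Ht [i Hi]; apply: NNPP => Hn.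
have H0 j : vel (gs s) t j = 0 by apply: NNPP => Hj; apply: Hn; exists j.
have [E0 Hd] := flow_vel Ht.
(* Flow time is recentred at [s]: Gronwall starts from the supposed zero and is evaluated at
   [- s]. *)
pose b u := phi (s + u) (g t).
have Hb u j : continuity_pt (fun u => b u j) u.
  apply: (continuity_pt_comp (fun u => s + u) (fun u => phi u (g t) j)).
    apply: continuity_pt_plus; first exact: continuity_pt_const.
    exact: derivable_continuity_pt (derivable_pt_lim_id u).
  exact: sol_continuity (flow_sol Ht).
have Hc u j : cdiff (fun p => X p j) (fun p k => dX X j k p) (b u).
  by apply: smooth1_cdiff; [exact: HX | exact: flow_in].
have [K [HK HJ]] := @jac_bound_along _ b (Rabs s) X (fun p j k => dX X j k p) Hb Hc.
have Hsq0 : sqn (vel (gs (s + 0)) t) = 0.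
  by rewrite Rplus_0_r; apply: big1 => j _; rewrite H0; ring.
have := @gronwall_vec _ (fun u => vel (gs (s + u)) t)
  (fun u j => \sum_k dX X j k (b u) * vel (gs (s + u)) t k) (Rabs s) K 0 1 HK (Rabs_pos s).
rewrite Hsq0 (_ : 0 ^ 2 = 0); last ring.
rewrite Rplus_0_l Rmult_0_l => /(_ _ _ Rlt_0_1 (- s)) H.
have : sqn (vel (gs (s + - s)) t) + 0 <= 0.
  apply: H.
  - move=> u j _; apply: (derivable_pt_lim_ext (fun h => vel (gs (s + h)) t j)) => //.
    have [_ H] := Hd (s + u) j.
    have := derivable_pt_lim_comp (fun h => s + h) (fun h => vel (gs h) t j) u 1 _ _ H.
    rewrite Rmult_1_r; apply.
    rewrite -[1]Rplus_0_l; apply: derivable_pt_lim_plus; first exact: derivable_pt_lim_const.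
    exact: derivable_pt_lim_id.
  - by move=> u Hu _; rewrite Rabs_R0 Rplus_0_r; exact: HJ.
  - by rewrite Rabs_Ropp; lra.
rewrite Rplus_opp_r E0 => Hle; apply: Hi.
have := sqn_term (vel g t) i; have := pow2_ge_0 (vel g t i) => H1 H2.
have H3 : vel g t i ^ 2 = 0 by lra.
by move: H3; rewrite /= Rmult_1_r => /Rmult_integral[].
Qed.

(** The acceleration of [g] is merely continuous, so the parameter theorem cannot be used a third
    time. Point, velocity and acceleration together solve a locally Lipschitz system, and stability
    carries continuity in [t] from flow time zero to [s]. *)
Lemma flow_acc_continuous s t j : I t -> continuity_pt (fun u => acc (gs s) u j) t.
Proof.
move=> Ht.
pose T3 := (('I_n + 'I_n) + 'I_n)%type.
pose st (x y z : vec n) (k : T3) : R := match k with inl l => jn x y l | inr i => z i end.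
pose V3 (w : T3 -> R) (k : T3) : R := match k with
  | inl l => lift_field (fun i => w (inl i)) l
  | inr j => \sum_m (\sum_r ddX X j m r (fun i => w (inl (inl i))) * w (inl (inr r))) * w (inl (inr m))
             + \sum_r dX X j r (fun i => w (inl (inl i))) * w (inr r)
  end.
pose a u s := st (phi s (g u)) (vel (gs s) u) (acc (gs s) u).
have Hsol u : I u -> sol V3 (a u).
  move=> Hu s' [[i|i]|i] /=; first exact: flow_sol.
    by have [_ H] := flow_vel Hu; have [_] := H s' i.
  by have [_ H] := flow_acc Hu; have [_] := H s' i.
have Hlip s' k : lip (fun p => V3 p k) (a t s').
  have HUx : U (phi s' (g t)) by exact: flow_in.
  case: k => [l|i] /=.
    by apply: (lip_reindex (h := inl) (f := fun w => lift_field w l)); exact: cdiff_lip (cdiff_lift l HUx).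
  apply: lip_add; apply: lip_sum => m; apply: lip_mul.
  - apply: lip_sum => r; apply: lip_mul; last exact: (lip_proj (inl (inr r))).
    by apply: (lip_reindex (h := fun i => inl (inl i)) (f := ddX X i m r)); exact: (smooth1_lip (smooth_ddX i m r)).
  - exact: (lip_proj (inl (inr m))).
  - by apply: (lip_reindex (h := fun i => inl (inl i)) (f := dX X i m)); exact: (smooth1_lip (smooth_dX i m)).
  - exact: (lip_proj (inr m)).
have [eta [K [Heta [HK Hst]]]] := stability (Rabs_pos s) (Hsol t Ht) Hlip.
pose c u := st (g u) (vel g u) (acc g u).
have Ea u : I u -> a u 0 = c u.
  move=> Hu; rewrite /a /c flow_id //; have [-> _] := flow_vel Hu; by have [-> _] := flow_acc Hu.
have Hc k : continuity_pt (fun u => c u k) t.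
  case: k => [[i|i]|i] /=.
  - by have [H _] := Hg i; exact: derivable_continuity_pt (H t Ht).
  - by have [_ [H _]] := Hg i; exact: derivable_continuity_pt (H t Ht).
  - by have [_ [_ H]] := Hg i; exact: H.
move=> eps He.
have HN := pos_INR #|{: T3}|.
pose m := Rmin eta (eps / K).
have Hm : 0 < m by apply: Rmin_pos => //; exact: Rdiv_lt_0_compat.
pose e := m / (INR #|{: T3}| + 1).
have He' : 0 < e by apply: Rdiv_lt_0_compat; lra.
have Ee : INR #|{: T3}| * e < m.
  have : e * (INR #|{: T3}| + 1) = m by rewrite /e; field; lra.
  lra.
have [d1 [Hd1 Hbox]] := curve_box Hc He'; have [d2 [Hd2 Hn]] := I_near Ht.
exists (Rmin d1 d2); split; first exact: Rmin_pos.
move=> u [_ Hu]; have {}Hu : Rabs (u - t) < Rmin d1 d2 := Hu.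
have Hu1 : Rabs (u - t) < d1 by apply: Rlt_le_trans Hu _; exact: Rmin_l.
have HIu : I u by apply: Hn; apply: Rlt_le_trans Hu _; exact: Rmin_r.
have Hinit : nrm (sub (a u 0) (a t 0)) < m.
  apply: Rle_lt_trans Ee; rewrite !Ea //; apply: nrm_le_const => k.
  by apply: Rlt_le; exact: Hbox.
have Hfin := Hst (a u) (Hsol u HIu) (Rlt_le_trans _ _ _ Hinit (Rmin_l _ _)) s (Rle_refl _).
have Hterm := nrm_term (sub (a u s) (a t s)) (inr j).
apply: (Rle_lt_trans _ _ _ (Rle_trans _ _ _ Hterm Hfin)).
apply: (Rlt_le_trans _ (K * (eps / K))).
  apply: Rmult_lt_compat_l => //; apply: Rlt_le_trans Hinit _; exact: Rmin_r.
by apply: Req_le; field; lra.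
Qed.

Lemma flow_C2 s : C2_on I (gs s).
Proof.
move=> j; split; first by move=> t Ht; have [_ H] := flow_vel Ht; have [] := H s j.
split; first by move=> t Ht; have [_ H] := flow_acc Ht; have [] := H s j.
by move=> t Ht; exact: (flow_acc_continuous s j).
Qed.

End Field.

(** * Linearised Euler-Lagrange equations *)

Section Linearization.
Variable n : nat.
Implicit Types (y z a d e h : vec n) (b c dXm : 'I_n -> 'I_n -> R).

Lemma sum_exchange b y (Xs : vec n) :
  \sum_k (\sum_m b m k * Xs m) * y k = \sum_m (\sum_k b m k * y k) * Xs m.
Proof.
under eq_bigr => k _ do rewrite -sumZr.
under [RHS]eq_bigr => m _ do rewrite -sumZr.
by rewrite exchange_big; apply: eq_bigr => m _; apply: eq_bigr => k _; rewrite /=; ring.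
Qed.

(** Regroups the displayed expression by the components of the second prolongation of [X]: the
    field, its derivative along [y], and the induced acceleration. *)
Lemma linear_part_expand a b c d e h (bY cY : 'I_n -> 'I_n -> R) dXm (Xs : vec n) y z (ddXm : 'I_n -> 'I_n -> 'I_n -> R) :
  \sum_s (a s - \sum_k b s k * y k - \sum_k c s k * z k) * Xs s
  + \sum_s \sum_r ((d s - e s) * y r - h s * z r
       - (\sum_k bY s k * y k + \sum_k cY s k * z k) * y r) * dXm s r
  - \sum_s \sum_m \sum_r h s * y m * y r * ddXm s m r
  = \sum_s ((a s - \sum_k b s k * y k - \sum_k c s k * z k) * Xs s
     + (d s - e s - \sum_k bY s k * y k - \sum_k cY s k * z k) * (\sum_r dXm s r * y r)
     - h s * (\sum_m (\sum_r ddXm s m r * y r) * y m + \sum_r dXm s r * z r)).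
Proof.
rewrite -sumD -sumB; apply: eq_bigr => s _.
set B := \sum_k bY s k * y k; set C := \sum_k cY s k * z k.
have -> : \sum_r ((d s - e s) * y r - h s * z r - (B + C) * y r) * dXm s r =
    (d s - e s - B - C) * (\sum_r dXm s r * y r) - h s * \sum_r dXm s r * z r.
  by rewrite -!sumZ -sumB; apply: eq_bigr => r _; ring.
have -> : \sum_m \sum_r h s * y m * y r * ddXm s m r =
    h s * \sum_m (\sum_r ddXm s m r * y r) * y m.
  rewrite -sumZ; apply: eq_bigr => m _; rewrite -sumZr -sumZ; apply: eq_bigr => r _; ring.
by ring.
Qed.

(** Brings the outcome of the product and chain rules, with [Y] and [Z] the variations of velocity
    and acceleration, to the same grouping as [linear_part_expand]. *)
Lemma derivative_expand a b c d e h (bY cY : 'I_n -> 'I_n -> R) (Xs : vec n) y z (Y Z : vec n) :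
  (\sum_k a k * Xs k + \sum_k d k * Y k)
  - \sum_k ((\sum_m b m k * Xs m + \sum_m bY m k * Y m) * y k + e k * Y k)
  - \sum_k ((\sum_m c m k * Xs m + \sum_m cY m k * Y m) * z k + h k * Z k)
  = \sum_s ((a s - \sum_k b s k * y k - \sum_k c s k * z k) * Xs s
     + (d s - e s - \sum_k bY s k * y k - \sum_k cY s k * z k) * Y s - h s * Z s).
Proof.
have split (p pY : 'I_n -> 'I_n -> R) (v q Z' : vec n) :
    \sum_k ((\sum_m p m k * Xs m + \sum_m pY m k * Y m) * v k + q k * Z' k) =
    \sum_s ((\sum_k p s k * v k) * Xs s + (\sum_k pY s k * v k) * Y s + q s * Z' s).
  rewrite sumD [RHS]sumD; congr (_ + _).
  rewrite [RHS]sumD -(sum_exchange p) -(sum_exchange pY) -sumD; apply: eq_bigr => k _; ring.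
by rewrite !split -sumD -!sumB; apply: eq_bigr => s _; ring.
Qed.

End Linearization.

(** * The Euler-Lagrange expression under the flow, and the equivalence *)

Section Main.
Variables (n : nat) (U : vec n -> Prop) (F : vec n -> vec n -> R) (X : vec n -> vec n).
Hypothesis HU : open_set U.
Hypothesis HF : Finsler U F.
Hypothesis HX : smooth_field U X.
Local Notation W := (TM0 U).
Implicit Types x y z : vec n.

Let sF := F_smooth HF.
Let sFx i : smooth2 W (Dx i F) := smooth2_Dx i sF.
Let sFy i : smooth2 W (Dy i F) := smooth2_Dy i sF.

Definition EL x y z : vec n := fun i =>
  Dx i F x y - \sum_k Dx k (Dy i F) x y * y k - \sum_k Dy k (Dy i F) x y * z k.

(** The displayed expression depends on [C] only through its value at [(x, y)], so a constant
    function there frees the acceleration as a variable. *)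
Definition linEL x y z : vec n := fun i => thm3_expr F (fun _ _ => z) X i x y.

Lemma linELE x y z i : W x y -> linEL x y z i =
  \sum_s ((Dx s (Dx i F) x y - \sum_k Dx s (Dx k (Dy i F)) x y * y k
             - \sum_k Dx s (Dy k (Dy i F)) x y * z k) * X x s
     + (Dy s (Dx i F) x y - Dx s (Dy i F) x y - \sum_k Dy s (Dx k (Dy i F)) x y * y k
             - \sum_k Dy s (Dy k (Dy i F)) x y * z k) * (\sum_r dX X s r x * y r)
     - Dy s (Dy i F) x y * (\sum_m (\sum_r ddX X s m r x * y r) * y m + \sum_r dX X s r x * z r)).
Proof.
move=> Hxy; rewrite /linEL /thm3_expr /sumI.
rewrite (linear_part_expand (fun s => Dx s (Dx i F) x y) (fun s k => Dx s (Dx k (Dy i F)) x y)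
  (fun s k => Dx s (Dy k (Dy i F)) x y) (fun s => Dy s (Dx i F) x y) (fun s => Dy i (Dx s F) x y)
  (fun s => Dy s (Dy i F) x y) (fun s k => Dy s (Dx k (Dy i F)) x y)
  (fun s k => Dy s (Dy k (Dy i F)) x y) (fun s r => dX X s r x) (X x) y z (fun s m r => ddX X s m r x)).
by apply: eq_bigr => s _; rewrite (mixed_partials HU s i sF Hxy).
Qed.

Lemma EL_derivable (a b c : R -> vec n) (s : R) i : W (a s) (b s) ->
  (forall j, derivable_pt_lim (fun u => a u j) s (X (a s) j)) ->
  (forall j, derivable_pt_lim (fun u => b u j) s (\sum_r dX X j r (a s) * b s r)) ->
  (forall j, derivable_pt_lim (fun u => c u j) s
     (\sum_m (\sum_r ddX X j m r (a s) * b s r) * b s m + \sum_r dX X j r (a s) * c s r)) ->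
  derivable_pt_lim (fun u => EL (a u) (b u) (c u) i) s (linEL (a s) (b s) (c s) i).
Proof.
move=> Hs Ha Hb Hc; rewrite linELE //.
rewrite -(derivative_expand (fun s' => Dx s' (Dx i F) (a s) (b s))).
have chain G (HG : smooth2 W G) := chain_rule HU HG Hs Ha Hb.
apply: derivable_pt_lim_minus.
  apply: derivable_pt_lim_minus; first exact: chain.
  apply: derivable_sum => k; apply: derivable_pt_lim_mult; last exact: Hb.
  by apply: chain; apply: smooth2_Dx.
apply: derivable_sum => k; apply: derivable_pt_lim_mult; last exact: Hc.
by apply: chain; apply: smooth2_Dy.
Qed.

Lemma extremal_eqP (g : R -> vec n) (t : R) i : W (g t) (vel g t) ->
  (forall j, derivable_pt_lim (fun u => g u j) t (vel g t j)) ->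
  (forall j, derivable_pt_lim (fun u => vel g u j) t (acc g t j)) ->
  (derivable_pt_lim (fun u => Dy i F (g u) (vel g u)) t (Dx i F (g t) (vel g t)) <->
   EL (g t) (vel g t) (acc g t) i = 0).
Proof.
move=> Ht Hg Hv; have H := chain_rule HU (sFy i) Ht Hg Hv.
rewrite /EL; split=> [H'|E].
  by rewrite -(uniqueness_limite _ _ _ _ H H'); ring.
suff <- : \sum_k Dx k (Dy i F) (g t) (vel g t) * vel g t k +
          \sum_k Dy k (Dy i F) (g t) (vel g t) * acc g t k = Dx i F (g t) (vel g t) by [].
lra.
Qed.

(** Minus the linear part of [linEL] in the acceleration: the derivative of the Hessian of [F] along
    the complete lift of [X], plus the Hessian contracted with the Jacobian of [X]. *)
Definition linEL_coef x y i k : R :=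
  \sum_s (Dx s (Dy k (Dy i F)) x y * X x s
    + Dy s (Dy k (Dy i F)) x y * (\sum_r dX X s r x * y r) + Dy s (Dy i F) x y * dX X s k x).

Lemma linEL_sub x y z z' i : W x y ->
  linEL x y z i - linEL x y z' i = - \sum_k linEL_coef x y i k * (z k - z' k).
Proof.
move=> Hxy; rewrite !linELE // -sumB /linEL_coef.
under [X in - X]eq_bigr => k _ do rewrite -sumZr.
rewrite exchange_big -sum_opp /=; apply: eq_bigr => s _.
set A := Dx s (Dx i F) x y - _; set B := _ - _ - \sum_k Dy s (Dx k (Dy i F)) x y * y k.
set Y := \sum_r dX X s r x * y r.
have -> : \sum_k (Dx s (Dy k (Dy i F)) x y * X x s + Dy s (Dy k (Dy i F)) x y * Y
     + Dy s (Dy i F) x y * dX X s k x) * (z k - z' k) =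
   (\sum_k Dx s (Dy k (Dy i F)) x y * z k - \sum_k Dx s (Dy k (Dy i F)) x y * z' k) * X x s +
   (\sum_k Dy s (Dy k (Dy i F)) x y * z k - \sum_k Dy s (Dy k (Dy i F)) x y * z' k) * Y +
   Dy s (Dy i F) x y * (\sum_k dX X s k x * z k - \sum_k dX X s k x * z' k).
  by rewrite -!sumB -!sumZr -!sumZ -!sumD; apply: eq_bigr => k _; ring.
have ring_id (a b u v l q s1 s2 t1 t2 r1 r2 : R) :
    (a - s1) * u + (b - t1) * v - l * (q + r1) - ((a - s2) * u + (b - t2) * v - l * (q + r2)) =
    - ((s1 - s2) * u + (t1 - t2) * v + l * (r1 - r2)) by ring.
exact: ring_id.
Qed.

(** The [x]-derivative of the Hessian still annihilates [y]; its [y]-derivative contributes minus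
    the Hessian, which cancels the Jacobian term. *)
Lemma linEL_coef_y x y i : W x y -> \sum_k linEL_coef x y i k * y k = 0.
Proof.
move=> Hxy; rewrite /linEL_coef.
under eq_bigr => k _ do rewrite -sumZr.
rewrite exchange_big; apply: big1 => s _ /=.
set Y := \sum_r dX X s r x * y r.
have -> : \sum_k (Dx s (Dy k (Dy i F)) x y * X x s + Dy s (Dy k (Dy i F)) x y * Y
     + Dy s (Dy i F) x y * dX X s k x) * y k =
   (\sum_k Dx s (Dy k (Dy i F)) x y * y k) * X x s +
   (\sum_k Dy s (Dy k (Dy i F)) x y * y k) * Y + Dy s (Dy i F) x y * Y.
  by rewrite -!sumZr -!sumZ -!sumD; apply: eq_bigr => k _; ring.
by rewrite (Dx_hessian_y HU HF) // (Dy_hessian_y HU HF) //; ring.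
Qed.

Variable C : vec n -> vec n -> vec n.
Hypothesis HC : forall x y, W x y -> forall i,
  \sum_k Dy k (Dy i F) x y * C x y k = Dx i F x y - \sum_k Dx k (Dy i F) x y * y k.

(* Subtracting a multiple of [y] from [z - C] changes neither side of the linear equations and
   makes the metric, instead of the degenerate Hessian of [F], control the result. *)
Lemma linEL_normal x y z : W x y -> exists w : vec n,
  (forall i, \sum_k metric F x y i k * w k = - (F x y * EL x y z i)) /\
  (forall i, linEL x y z i - thm3_expr F C X i x y = - \sum_k linEL_coef x y i k * w k).
Proof.
move=> Hxy; have HFp := F_pos HF Hxy.
(* By Euler's identity this [l] makes the contraction of [w] with [Dy k F] vanish, so only the
   Hessian part of the metric acts on [w]. *)
pose l := (\sum_k Dy k F x y * (z k - C x y k)) / F x y.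
exists (fun k => z k - C x y k - l * y k); split=> i.
  have -> : \sum_k metric F x y i k * (z k - C x y k - l * y k) =
     F x y * (\sum_k Dy k (Dy i F) x y * z k - \sum_k Dy k (Dy i F) x y * C x y k
        - l * \sum_k Dy k (Dy i F) x y * y k) +
     Dy i F x y * (\sum_k Dy k F x y * (z k - C x y k) - l * \sum_k Dy k F x y * y k).
    rewrite -!sumZ -!sumB -!sumZ -!sumD; apply: eq_bigr => k _; rewrite /metric; ring.
  rewrite (hessian_y HU HF) // (euler HU HF) // HC // /EL /l; field; lra.
rewrite -[thm3_expr F C X i x y]/(linEL x y (C x y) i) linEL_sub //; congr (- _).
have -> : \sum_k linEL_coef x y i k * (z k - C x y k - l * y k) =
   \sum_k linEL_coef x y i k * (z k - C x y k) - l * \sum_k linEL_coef x y i k * y k.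
  by rewrite -!sumZ -!sumB; apply: eq_bigr => k _; ring.
by rewrite linEL_coef_y //; ring.
Qed.

Lemma cts_linEL_coef x y i k : W x y ->
  cts (fun p => linEL_coef (wl p) (wr p) i k) (jn x y).
Proof.
move=> Hxy; have [Hx _] := Hxy.
have L G : smooth2 W G -> cts (flat G) (jn x y).
  by move=> HG; exact: (lip_cts (lip_smooth HU (w := jn x y) HG Hxy)).
have cX f : smooth1 U f -> cts (fun p : 'I_n + 'I_n -> R => f (wl p)) (jn x y).
  by move=> Hf; apply: (cts_reindex (h := inl)); exact: (smooth1_cts Hf).
have sH j : smooth2 W (Dy j (Dy i F)) by exact: smooth2_Dy.
apply: cts_sum => s; apply: cts_add; first apply: cts_add.
- apply: cts_mul; last exact: cX (HX s).
  exact: (L _ (smooth2_Dx s (sH k))).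
- apply: cts_mul; first exact: (L _ (smooth2_Dy s (sH k))).
  apply: cts_sum => r; apply: cts_mul; last exact: (cts_proj (inr r)).
  exact: cX (smooth_dX HX s r).
- apply: cts_mul; last exact: cX (smooth_dX HX s k).
  exact: (L _ (sH s)).
Qed.

(** Under the condition, [linEL] is linear in the normalised difference [w], which the metric bounds
    by a multiple of [EL]. The bound is uniform in [z] and locally uniform in the point, with [/ d]
    as constant so that compactness along a curve applies. *)
Lemma linEL_bound x y : W x y -> exists d, 0 < d /\ forall p, box (jn x y) d p ->
  (forall i, thm3_expr F C X i (wl p) (wr p) = 0) ->
  forall z i, Rabs (linEL (wl p) (wr p) z i) <= / d * nrm (EL (wl p) (wr p) z).
Proof.
move=> Hxy.
have [d1 [c [Hd1 [Hc H1]]]] := metric_lower_bound HU HF (w := jn x y) Hxy.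
have [d2 [Hd2 H2]] := TM0_open HU Hxy.
have [d3 [Hd3 H3]] := cts_bound (lip_cts (lip_smooth HU (w := jn x y) sF Hxy)).
have [d4 [Hd4 H4]] : exists d, 0 < d /\ forall (ik : 'I_n * 'I_n) p, box (jn x y) d p ->
    Rabs (linEL_coef (wl p) (wr p) ik.1 ik.2) <= Rabs (linEL_coef x y ik.1 ik.2) + 1.
  apply: (fin_radius (P := fun (ik : 'I_n * 'I_n) d => forall p, box (jn x y) d p ->
    Rabs (linEL_coef (wl p) (wr p) ik.1 ik.2) <= Rabs (linEL_coef x y ik.1 ik.2) + 1)).
    by move=> ik d d' G [_ Hdd] p Hp; apply: G; exact: box_le Hp.
  by move=> [i k]; exact: (cts_bound (cts_linEL_coef i k Hxy)).
pose A := \sum_i \sum_k (Rabs (linEL_coef x y i k) + 1).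
have pos i k : 0 <= Rabs (linEL_coef x y i k) + 1 by have := Rabs_pos (linEL_coef x y i k); lra.
have HA : 0 <= A by apply: sum_ge0 => i; apply: sum_ge0 => k; exact: pos.
pose Fm := Rabs (F x y) + 1.
have HFm : 0 < Fm by rewrite /Fm; have := Rabs_pos (F x y); lra.
have Hic : 0 < / c by exact: Rinv_0_lt_compat.
pose K := A * (/ c * Fm) + 1.
have HAF : 0 <= A * (/ c * Fm) by apply: Rmult_le_pos => //; apply: Rmult_le_pos; lra.
have HK : 0 < / K by apply: Rinv_0_lt_compat; rewrite /K; lra.
have [d [Hd [L1 [L2 [L3 [L4 L5]]]]]] :
    exists d, 0 < d /\ d <= d1 /\ d <= d2 /\ d <= d3 /\ d <= d4 /\ d <= / K.
  exists (Rmin (Rmin d1 d2) (Rmin d3 (Rmin d4 (/ K)))).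
  have := Rmin_l (Rmin d1 d2) (Rmin d3 (Rmin d4 (/ K))).
  have := Rmin_r (Rmin d1 d2) (Rmin d3 (Rmin d4 (/ K))).
  have := Rmin_l d1 d2; have := Rmin_r d1 d2; have := Rmin_l d3 (Rmin d4 (/ K)).
  have := Rmin_r d3 (Rmin d4 (/ K)); have := Rmin_l d4 (/ K); have := Rmin_r d4 (/ K).
  split; first by do !apply: Rmin_pos.
  by do !split; lra.
exists d; split=> // p Hp Hthm z i.
have Wp := H2 p (box_le L2 Hp).
have [w [Hw1 Hw2]] := linEL_normal z Wp.
have := Hw2 i; rewrite Hthm Rminus_0_r => ->; rewrite Rabs_Ropp.
have En := nrm_ge0 (EL (wl p) (wr p) z).
have B1 : nrm w <= / c * (Fm * nrm (EL (wl p) (wr p) z)).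
  apply: (Rmult_le_reg_l c) => //; rewrite -Rmult_assoc Rinv_r; last lra.
  rewrite Rmult_1_l; apply: Rle_trans (H1 p (box_le L1 Hp) w) _.
  rewrite /nrm -sumZ; apply: sum_le => j; rewrite Hw1 Rabs_Ropp Rabs_mult.
  apply: Rmult_le_compat_r; first exact: Rabs_pos.
  exact: H3 p (box_le L3 Hp).
have B2 : nrm (fun k => linEL_coef (wl p) (wr p) i k) <= A.
  apply: (Rle_trans _ (\sum_k (Rabs (linEL_coef x y i k) + 1))).
    by apply: sum_le => k; exact: (H4 (i, k) p (box_le L4 Hp)).
  by apply: (sum_term_le (f := fun i => \sum_k (Rabs (linEL_coef x y i k) + 1))) => j; exact: sum_ge0.
apply: Rle_trans (sum_mul_le _ _) _.
apply: (Rle_trans _ (A * (/ c * (Fm * nrm (EL (wl p) (wr p) z))))).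
  by apply: Rmult_le_compat => //; exact: nrm_ge0.
apply: (Rle_trans _ (K * nrm (EL (wl p) (wr p) z))).
  have -> : A * (/ c * (Fm * nrm (EL (wl p) (wr p) z))) =
    A * (/ c * Fm) * nrm (EL (wl p) (wr p) z) by ring.
  by apply: Rmult_le_compat_r => //; rewrite /K; lra.
apply: Rmult_le_compat_r => //; rewrite -(Rinv_inv K); exact: Rinv_le_contravar.
Qed.

Variable phi : R -> vec n -> vec n.
Hypothesis Hphi : is_flow U X phi.

Section Transport.
Variables (I : R -> Prop) (g : R -> vec n).
Hypothesis Hg : extremal U F I g.

Local Notation gs s := (fun t => phi s (g t)).
Local Notation EL_flow s t := (EL (phi s (g t)) (vel (gs s) t) (acc (gs s) t)).

Let HI : open_interval I. Proof. by case: Hg. Qed.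
Let HgU t : I t -> U (g t). Proof. by case: Hg => _ [H _]; exact: H. Qed.
Let HgC2 : C2_on I g. Proof. by case: Hg => _ [_ []]. Qed.

Lemma flow_TM0 s t : I t -> W (phi s (g t)) (vel (gs s) t).
Proof.
move=> Ht; split; first exact: (flow_in Hphi HgU).
by apply: (flow_vel_nonzero HU HX Hphi HI HgU HgC2) => //; case: Hg => _ [_ [_ [H _]]]; exact: H.
Qed.

Lemma EL_flow_derivable s t i : I t ->
  derivable_pt_lim (fun u => EL_flow u t i) s
    (linEL (phi s (g t)) (vel (gs s) t) (acc (gs s) t) i).
Proof.
move=> Ht; apply: (EL_derivable (a := fun u => phi u (g t)) (b := fun u => vel (gs u) t)
  (c := fun u => acc (gs u) t)) => [|j|j|j].
- exact: flow_TM0.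
- exact: (flow_sol Hphi HgU Ht).
- by have [_ H] := flow_vel HU HX Hphi HI HgU HgC2 Ht; have [] := H s j.
- by have [_ H] := flow_acc HU HX Hphi HI HgU HgC2 Ht; have [] := H s j.
Qed.

Lemma EL_flow_extremal s : extremal U F I (gs s) <-> forall t, I t -> forall i, EL_flow s t i = 0.
Proof.
have HC2 := flow_C2 HU HX Hphi HI HgU HgC2 s.
have dv t j (Ht : I t) : derivable_pt_lim (fun u => phi s (g u) j) t (vel (gs s) t j).
  by have [H _] := HC2 j; exact: H.
have da t j (Ht : I t) : derivable_pt_lim (fun u => vel (gs s) u j) t (acc (gs s) t j).
  by have [_ [H _]] := HC2 j; exact: H.
split=> [[_ [_ [_ [_ H]]]] t Ht i | H].
  apply/(extremal_eqP i (flow_TM0 s Ht)); [| | exact: H].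
    by move=> j; exact: dv.
  by move=> j; exact: da.
split=> //; split; first by move=> t Ht; have [] := flow_TM0 s Ht.
split=> //; split; first by move=> t Ht; have [] := flow_TM0 s Ht.
move=> i t Ht; apply/(extremal_eqP i (flow_TM0 s Ht)); [| | exact: H].
  by move=> j; exact: dv.
by move=> j; exact: da.
Qed.

Lemma EL_flow0 t : I t -> EL_flow 0 t = EL (g t) (vel g t) (acc g t).
Proof.
move=> Ht; rewrite (flow_id Hphi HgU Ht).
have [-> _] := flow_vel HU HX Hphi HI HgU HgC2 Ht.
by have [-> _] := flow_acc HU HX Hphi HI HgU HgC2 Ht.
Qed.

Lemma EL_start t i : I t -> EL (g t) (vel g t) (acc g t) i = 0.
Proof.
move=> Ht; case: Hg => _ [_ [_ [Hnz H]]].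
apply/(extremal_eqP i); [by split; [exact: HgU | exact: Hnz] | | | exact: H].
  by move=> j; have [H' _] := HgC2 j; exact: H'.
by move=> j; have [_ [H' _]] := HgC2 j; exact: H'.
Qed.

(** Here [t] is frozen and Gronwall runs in the flow time alone, from the zero initial value at
    [s = 0]; compactness of the flow line in the tangent bundle supplies one constant for all times
    up to [s]. *)
Lemma EL_flow_zero s t i : (forall x y, W x y -> forall i, thm3_expr F C X i x y = 0) ->
  I t -> EL_flow s t i = 0.
Proof.
move=> Hthm Ht.
pose b u := jn (phi u (g t)) (vel (gs u) t).
have Hb u k : continuity_pt (fun u => b u k) u.
  case: k => j /=.
    exact: sol_continuity (flow_sol Hphi HgU Ht).
  have [_ H] := flow_vel HU HX Hphi HI HgU HgC2 Ht; have [_ H'] := H u j.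
  exact: derivable_continuity_pt H'.
have [d [Hd Hbound]] : exists d, 0 < d /\ forall u, Rabs u <= Rabs s -> forall z i,
    Rabs (linEL (wl (b u)) (wr (b u)) z i) <= / d * nrm (EL (wl (b u)) (wr (b u)) z).
  apply: (unif_along (b := b) (Rabs s) Hb (P := fun p d => forall z i,
    Rabs (linEL (wl p) (wr p) z i) <= / d * nrm (EL (wl p) (wr p) z))).
    move=> p d d' H [Hd' Hdd] z j; apply: Rle_trans (H z j) _.
    by apply: Rmult_le_compat_r; [exact: nrm_ge0 | exact: Rinv_le_contravar].
  move=> u; have Wu := flow_TM0 u Ht.
  have [d1 [Hd1 H1]] := linEL_bound Wu; have [d2 [Hd2 H2]] := TM0_open HU Wu.
  exists (Rmin d1 d2); split; first exact: Rmin_pos.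
  move=> p Hp z j; apply: (Rle_trans _ (/ d1 * nrm (EL (wl p) (wr p) z))).
    apply: H1; first exact: box_le (Rmin_l _ _) Hp.
    by move=> k; apply: Hthm; apply: H2; exact: box_le (Rmin_r _ _) Hp.
  apply: Rmult_le_compat_r; first exact: nrm_ge0.
  by apply: Rinv_le_contravar; [exact: Rmin_pos | exact: Rmin_l].
have HN := pos_INR #|'I_n|.
have HK : 0 <= INR #|'I_n| * / d.
  by apply: Rmult_le_pos => //; apply: Rlt_le; exact: Rinv_0_lt_compat.
have Hsq0 : sqn (EL_flow 0 t) = 0.
  by rewrite EL_flow0 //; apply: big1 => j _; rewrite EL_start //; ring.
have := @gronwall_vec _ (fun u => EL_flow u t)
  (fun u => linEL (phi u (g t)) (vel (gs u) t) (acc (gs u) t)) (Rabs s) _ 0 1 HK (Rabs_pos s).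
rewrite Hsq0 (_ : 0 ^ 2 = 0); last ring.
rewrite Rplus_0_l Rmult_0_l => /(_ _ _ Rlt_0_1 s (Rle_refl _)) H.
have : sqn (EL_flow s t) + 0 <= 0.
  apply: H; first by move=> u j _; exact: EL_flow_derivable.
  move=> u Hu _; rewrite Rabs_R0 Rplus_0_r Rmult_assoc; apply: nrm_le_const => j.
  exact: Hbound.
move=> Hle; have := sqn_term (EL_flow s t) i; have := pow2_ge_0 (EL_flow s t i) => H1 H2.
have H3 : EL_flow s t i ^ 2 = 0 by lra.
by move: H3; rewrite /= Rmult_1_r => /Rmult_integral[].
Qed.

End Transport.

Lemma transport_condition (x y : vec n) i : W x y ->
  (forall I g, geodesic U F I g -> forall s, extremal U F I (fun t => phi s (g t))) ->
  thm3_expr F C X i x y = 0.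
Proof.
move=> Hxy H.
have [I [g [Hgeo [I0 [Eg [Ev Ea]]]]]] := geodesic_exists HU HF HC Hxy.
have [Hg _] := Hgeo.
have HEL s j : EL (phi s (g 0)) (vel (fun t => phi s (g t)) 0) (acc (fun t => phi s (g t)) 0) j = 0.
  by apply: (proj1 (EL_flow_extremal Hg s)); first exact: H.
have := EL_flow_derivable Hg 0 i I0.
move=> /(derivable_zero Rlt_0_1 (fun h _ => HEL h i)).
case: Hg => HI [HgU [HgC2 _]].
rewrite (flow_id Hphi HgU I0).
have [-> _] := flow_vel HU HX Hphi HI HgU HgC2 I0.
have [-> _] := flow_acc HU HX Hphi HI HgU HgC2 I0.
rewrite Eg Ev; have -> : acc g 0 = spray F C x y by apply: functional_extensionality.
(* The derivative gives the condition at [spray], not at [C]. Both satisfy the same Hessian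
   equations, so the normalised difference [w] is killed by the metric and vanishes, and the two
   values agree. *)
move=> HL.
have [w [Hw1 Hw2]] := linEL_normal (spray F C x y) Hxy.
have [d [c [Hd [Hc Hlow]]]] := metric_lower_bound HU HF (w := jn x y) Hxy.
have Hw0 : nrm w <= 0.
  apply: (Rmult_le_reg_l c) => //; rewrite Rmult_0_r.
  apply: Rle_trans (Hlow _ (box_center _ Hd) w) _; apply: Req_le; apply: big1 => j _.
  by rewrite Hw1 /EL (spray_hessian HU HF HC) // Rminus_diag Rmult_0_r Ropp_0 Rabs_R0.
have := Hw2 i; rewrite HL big1; first lra.
by move=> k _; rewrite (nrm0_eq Hw0) Rmult_0_r.
Qed.

End Main.

Theorem theorem3 (n : nat) (U : vec n -> Prop) (F : vec n -> vec n -> R)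
    (X : vec n -> vec n) (phi : R -> vec n -> vec n)
    (C : vec n -> vec n -> vec n) :
  open_set U ->
  Finsler U F ->
  smooth_field U X ->
  is_flow U X phi ->
  (forall x y, TM0 U x y -> forall i,
     sumI (fun k => Dy k (Dy i F) x y * C x y k)
     = Dx i F x y - sumI (fun k => Dx k (Dy i F) x y * y k)) ->
  ((forall (I : R -> Prop) (g : R -> vec n), geodesic U F I g ->
      forall s, extremal U F I (fun t => phi s (g t)))
   <->
   (forall x y, TM0 U x y -> forall i, thm3_expr F C X i x y = 0)).
Proof.
move=> HU HF HX Hphi HC; split=> [H x y Hxy i | H I g [Hg _] s].
  exact: (transport_condition HU HF HX HC Hphi i Hxy H).
apply/(EL_flow_extremal HU HF HX Hphi Hg) => t Ht i.
exact: (EL_flow_zero HU HF HX HC Hphi Hg s i H Ht).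
Qed.
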